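(* Fix $\beta_0\in(0,\tfrac\pi2)$ and consider the inner equation described in the context. There exist $\kappa_0,b_1>0$ such that for any $\kappa\ge\kappa_0$ the invariance equation $$\partial_U Z=\mathcal A Z+\mathcal R[Z]$$ has analytic solutions $Z^\diamond(U)=(W^\diamond(U),X^\diamond(U),Y^\diamond(U))^T$, $U\in D^\diamond_\kappa$, $\diamond=u,s$, satisfying $$|U^{8/3}W^\diamond(U)|\le b_1,\qquad |U^{4/3}X^\diamond(U)|\le b_1,\qquad |U^{4/3}Y^\diamond(U)|\le b_1.$$ In addition, there exist $\Theta\in\mathbb C$ and $b_2>0$ independent of $\kappa$, and a function $\chi=(\chi_1,\chi_2,\chi_3)^T$, such that $$\Delta Z(U)=Z^u(U)-Z^s(U)=\Theta e^{-iU}\big((0,0,1)^T+\chi(U)\big),$$ and, for $U\in E_\kappa$, $$|U^{7/3}\chi_1(U)|\le b_2,\qquad |U^2\chi_2(U)|\le b_2,\qquad |U\chi_3(U)|\le b_2.$$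
   Context: Let $\mathcal H(U,W,X,Y)=W+XY+\mathcal K(U,W,X,Y)$, where $$\mathcal K=-\tfrac34U^{2/3}W^2-\frac1{3U^{2/3}}\Big(\frac1{\sqrt{1+\mathcal J}}-1\Big),$$ $$\mathcal J=\frac{4W^2}{9U^{2/3}}-\frac{16W}{27U^{4/3}}+\frac{16}{81U^2}+\frac{4(X+Y)}{9U}\Big(W-\frac2{3U^{2/3}}\Big)-\frac{4i(X-Y)}{3U^{2/3}}-\frac{X^2+Y^2}{3U^{4/3}}+\frac{10XY}{9U^{4/3}}.$$ With $Z=(W,X,Y)$, $\mathcal A=\mathrm{diag}(0,i,-i)$, $f=(-\partial_U\mathcal K,\,i\partial_Y\mathcal K,\,-i\partial_X\mathcal K)^T$, $g=\partial_W\mathcal K$, the Hamiltonian equations are $\dot U=1+g(U,Z)$, $\dot Z=\mathcal AZ+f(U,Z)$, and graphs $Z(U)$ invariant for them satisfy $\partial_UZ=\mathcal AZ+\mathcal R[Z]$ with $\mathcal R[\varphi](U)=\frac{f(U,\varphi(U))-g(U,\varphi(U))\mathcal A\varphi(U)}{1+g(U,\varphi(U))}$. Domains: $D^u_\kappa=\{U\in\mathbb C:|\operatorname{Im}U|\ge\tan\beta_0\operatorname{Re}U+\kappa\}$, $D^s_\kappa=-D^u_\kappa$, $E_\kappa=D^u_\kappa\cap D^s_\kappa\cap\{\operatorname{Im}U<0\}$. Fractional powers of $U$ are taken with a continuous determination of $\arg U$ on each domain with $\arg U\in(-\pi,0)$ on $\{\operatorname{Im}U<0\}$ (the branch inherited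 from $\arg U\in(-\tfrac{3\pi}2,\tfrac\pi2)$). *)

(* Defs.v *)
From Stdlib Require Import Reals ClassicalEpsilon.
From Coquelicot Require Import Coquelicot.

Open Scope C_scope.

(** Principal argument, with values in (-PI, PI] (half-angle formula;
    value PI on the non-positive real axis, irrelevant at 0). *)
Definition Arg (z : C) : R :=
  if Req_EM_T (Im z) 0 then (if Rle_dec (Re z) 0 then PI else 0%R)
  else (2 * atan (Im z / (Cmod z + Re z)))%R.

(** The determination of arg used on D^s_kappa (principal one, values in
    (-PI,PI)) and on D^u_kappa (continuous on C \ [0,+oo), values in
    (-2PI,0)); both have values in (-PI,0) on {Im U < 0}. *)
Definition arg_s (z : C) : R := Arg z.
Definition arg_u (z : C) : R := (Arg (- z) - PI)%R.

Definition cpow (argf : C -> R) (a : R) (z : C) : C :=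
  (Rpower (Cmod z) a * cos (a * argf z), Rpower (Cmod z) a * sin (a * argf z))%R.

Definition csqrt (z : C) : C := cpow Arg (1/2)%R z.

Definition cexp (z : C) : C :=
  (exp (Re z) * cos (Im z), exp (Re z) * sin (Im z))%R.

(** Complex derivative (a total operator, defined by choice; it is the
    derivative whenever f is complex-differentiable at z). *)
Definition CDeriv (f : C -> C) (z : C) : C :=
  epsilon (inhabits (RtoC 0)) (fun l : C => is_derive (f : C_AbsRing -> C_NormedModule) z l).

Section Inner.
Variable argf : C -> R.
Local Notation "U ^^ a" := (cpow argf a%R U) (at level 30).

Definition Jcal (U W X Y : C) : C :=
  4 * W * W / (9 * U ^^ (2/3)) - 16 * W / (27 * U ^^ (4/3))
  + 16 / (81 * (U * U))
  + 4 * (X + Y) / (9 * U) * (W - 2 / (3 * U ^^ (2/3)))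
  - 4 * Ci * (X - Y) / (3 * U ^^ (2/3))
  - (X * X + Y * Y) / (3 * U ^^ (4/3))
  + 10 * X * Y / (9 * U ^^ (4/3)).

Definition Kcal (U W X Y : C) : C :=
  - (3/4) * U ^^ (2/3) * (W * W)
  - 1 / (3 * U ^^ (2/3)) * (1 / csqrt (1 + Jcal U W X Y) - 1).

Definition Hcal (U W X Y : C) : C := W + X * Y + Kcal U W X Y.

Definition dU_K (U W X Y : C) : C := CDeriv (fun u => Kcal u W X Y) U.
Definition dW_K (U W X Y : C) : C := CDeriv (fun w => Kcal U w X Y) W.
Definition dX_K (U W X Y : C) : C := CDeriv (fun x => Kcal U W x Y) X.
Definition dY_K (U W X Y : C) : C := CDeriv (fun y => Kcal U W X y) Y.

End Inner.

Definition C3 := (C * C * C)%type.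
Definition Wc (z : C3) : C := fst (fst z).
Definition Xc (z : C3) : C := snd (fst z).
Definition Yc (z : C3) : C := snd z.
Definition mk3 (w x y : C) : C3 := (w, x, y).
Definition add3 (a b : C3) : C3 := mk3 (Wc a + Wc b) (Xc a + Xc b) (Yc a + Yc b).
Definition sub3 (a b : C3) : C3 := mk3 (Wc a - Wc b) (Xc a - Xc b) (Yc a - Yc b).
Definition scal3 (c : C) (a : C3) : C3 := mk3 (c * Wc a) (c * Xc a) (c * Yc a).

Definition Acal (z : C3) : C3 := mk3 0 (Ci * Xc z) (- Ci * Yc z).

Definition fvec (argf : C -> R) (U : C) (z : C3) : C3 :=
  mk3 (- dU_K argf U (Wc z) (Xc z) (Yc z))
      (Ci * dY_K argf U (Wc z) (Xc z) (Yc z))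
      (- Ci * dX_K argf U (Wc z) (Xc z) (Yc z)).
Definition gfun (argf : C -> R) (U : C) (z : C3) : C :=
  dW_K argf U (Wc z) (Xc z) (Yc z).

Definition Rcal (argf : C -> R) (phi : C -> C3) (U : C) : C3 :=
  scal3 (/ (1 + gfun argf U (phi U)))
        (sub3 (fvec argf U (phi U)) (scal3 (gfun argf U (phi U)) (Acal (phi U)))).

Definition Du (beta0 kappa : R) (U : C) : Prop :=
  (Rabs (Im U) >= tan beta0 * Re U + kappa)%R.
Definition Ds (beta0 kappa : R) (U : C) : Prop := Du beta0 kappa (- U).
Definition Ek (beta0 kappa : R) (U : C) : Prop :=
  Du beta0 kappa U /\ Ds beta0 kappa U /\ (Im U < 0)%R.

Definition analytic_on (D : C -> Prop) (f : C -> C) : Prop :=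
  forall U, D U -> exists r : R, (0 < r)%R /\
    forall V : C, (Cmod (V - U) < r)%R ->
      ex_derive (f : C_AbsRing -> C_NormedModule) V.

Definition inv_solution (argf : C -> R) (D : C -> Prop) (phi : C -> C3) : Prop :=
  analytic_on D (fun u => Wc (phi u)) /\
  analytic_on D (fun u => Xc (phi u)) /\
  analytic_on D (fun u => Yc (phi u)) /\
  forall U, D U ->
    let rhs := add3 (Acal (phi U)) (Rcal argf phi U) in
    is_derive ((fun u => Wc (phi u)) : C_AbsRing -> C_NormedModule) U (Wc rhs) /\
    is_derive ((fun u => Xc (phi u)) : C_AbsRing -> C_NormedModule) U (Xc rhs) /\
    is_derive ((fun u => Yc (phi u)) : C_AbsRing -> C_NormedModule) U (Yc rhs).

(* Main.v *)
Require Import Defs.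
From Stdlib Require Import Reals Lra Lia Psatz ZArith Classical ClassicalEpsilon FunctionalExtensionality.
From Coquelicot Require Import Coquelicot.
Open Scope C_scope.

(** Idea. In terms of [s = U^(1/3)] the vector field is an explicit function whose size
    and Lipschitz constants in [W] and in [X, Y] are powers of [1/|s|]. On [D^u] and [D^s]
    the equation is solved by Picard iteration, integrating each component from infinity
    along a straight ray on which its exponential does not grow; for [X] and [Y] the ray is
    tilted so that the exponential decays and no power of [U] is lost. No Cauchy theory is
    needed: the iteration gives convergence of the derivatives as well as of the functions.

    Along a vertical ray going down, the difference [(w, x, y)] of the two solutions
    satisfies a linear system with [x] expanding, [w] neutral and [y] contracting. Since the
    difference tends to zero, [|x|^2 + |Im U|^2 |w|^2 - |y|^2], which increases along the
    ray, is nonpositive. So [y] controls [w] and [x], and Gronwall's inequality gives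
    [e^(iU) y] a limit [Theta], which is the same on all rays because horizontal variations
    tend to zero. *)

(** * Complex differentiability *)

(** Since [g] contains [U^(2/3) W], the coefficient of [w] in the equations for [x] and [y] decays
    only like [U^(-2/3)], which is not integrable: the difference is not a small perturbation of its
    linear part component by component. The factor [|Im U|^2] in the quadratic form repairs this.
    Its derivative makes even the neutral [w] expand, and the resulting cone [|w| <= |y| / |Im U|]
    turns the coefficient into the integrable [U^(-5/3)]. At the weights 8/3 and 4/3 of the
    statement the vector field leaves no power of [U] to spare. Picard iteration is therefore run in
    the unit ball for the weaker weights 6/3 and 3/3, where each step gains a factor [|U|^(-1/3)]
    that absorbs every constant; the fixed point is then improved to 7/3 and 4/3, and finally to
    8/3. Both solutions are built once, on open neighbourhoods of the largest domains, and only
    restricted when [kappa] grows, so [Theta] and [b2] are independent of [kappa]. Every bound on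
    the difference is relative to [|Theta|]; when [Theta = 0] the two solutions coincide below the
    real axis and [chi] is set to zero. *)

Lemma im_le_Cmod (c : C) : (Rabs (Im c) <= Cmod c)%R.
Proof. eapply Rle_trans; [apply Rmax_r|apply Rmax_Cmod]. Qed.

Lemma Re_le_Cmod' (c : C) : (Re c <= Cmod c)%R.
Proof. eapply Rle_trans; [apply Rle_abs|apply re_le_Cmod]. Qed.

Lemma Cmod_minus_sym (a b : C) : Cmod (a - b) = Cmod (b - a).
Proof. rewrite <- Cmod_opp. f_equal. ring. Qed.

Lemma Cmod_triangle_le (a b : C) (x y : R) :
  (Cmod a <= x -> Cmod b <= y -> Cmod (a + b) <= x + y)%R.
Proof. intros. generalize (Cmod_triangle a b). lra. Qed.

Lemma Cmod_minus_le (a b : C) (x y : R) :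
  (Cmod a <= x -> Cmod b <= y -> Cmod (a - b) <= x + y)%R.
Proof. intros. apply Cmod_triangle_le; [|rewrite Cmod_opp]; auto. Qed.

Lemma Cmod_mult_le (a b : C) (x y : R) :
  (Cmod a <= x -> Cmod b <= y -> Cmod (a * b) <= x * y)%R.
Proof. intros. rewrite Cmod_mult. apply Rmult_le_compat; auto using Cmod_ge_0. Qed.

Lemma Cmod_triangle_inv (a b : C) : (Cmod a - Cmod b <= Cmod (a - b))%R.
Proof. generalize (Cmod_triangle (a - b) b). replace (a - b + b) with a by ring. lra. Qed.

Lemma Cmod_le_ReIm (c : C) : (Cmod c <= Rabs (Re c) + Rabs (Im c))%R.
Proof.
  assert (Hc : c = RtoC (Re c) + RtoC (Im c) * Ci).
  { destruct c; unfold Re, Im, RtoC, Ci, Cplus, Cmult; simpl. f_equal; ring. }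
  rewrite Hc at 1. eapply Rle_trans; [apply Cmod_triangle|].
  rewrite Cmod_mult, Cmod_Ci, !Cmod_R. lra.
Qed.

Lemma C_neq_Re (c : C) : (0 < Re c)%R -> c <> 0.
Proof. intros H E. rewrite E in H. simpl in H. lra. Qed.

(** * Neighbourhoods and continuity in the complex plane *)

Definition near (z : C) (P : C -> Prop) :=
  exists d : R, (0 < d)%R /\ forall w : C, (Cmod (w - z) < d)%R -> P w.

Lemma near_and (z : C) (P Q : C -> Prop) :
  near z P -> near z Q -> near z (fun w => P w /\ Q w).
Proof.
  intros [d [Hd HP]] [e [He HQ]]. exists (Rmin d e). split.
  - now apply Rmin_pos.
  - intros w Hw. split; [apply HP|apply HQ]; eapply Rlt_le_trans; eauto;
      [apply Rmin_l|apply Rmin_r].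
Qed.

Lemma near_mono (z : C) (P Q : C -> Prop) :
  (forall w, P w -> Q w) -> near z P -> near z Q.
Proof. intros H [d [Hd HP]]. exists d; auto. Qed.

Lemma near_self (z : C) (P : C -> Prop) : near z P -> P z.
Proof.
  intros [d [Hd HP]]. apply HP. replace (z - z) with (RtoC 0) by ring. now rewrite Cmod_0.
Qed.

Lemma near_all (z : C) (P : C -> Prop) : (forall w, P w) -> near z P.
Proof. exists 1%R. split; [lra|auto]. Qed.

Definition copen (D : C -> Prop) := forall z, D z -> near z D.

Definition ccont (f : C -> C) (z : C) :=
  forall e : R, (0 < e)%R -> near z (fun w => (Cmod (f w - f z) < e)%R).

Lemma ccont_near (f g : C -> C) (z : C) :
  near z (fun w => f w = g w) -> ccont g z -> ccont f z.
Proof.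
  intros H Hg e He. generalize (near_and _ _ _ H (Hg e He)).
  apply near_mono. intros w [E1 E2]. rewrite E1, (near_self _ _ H). exact E2.
Qed.

Lemma ccont_const (c z : C) : ccont (fun _ => c) z.
Proof.
  intros e He. apply near_all. intros _. replace (c - c) with (RtoC 0) by ring.
  now rewrite Cmod_0.
Qed.

Lemma ccont_id (z : C) : ccont (fun w => w) z.
Proof. intros e He. exists e. auto. Qed.

Lemma ccont_plus (f g : C -> C) (z : C) :
  ccont f z -> ccont g z -> ccont (fun w => f w + g w) z.
Proof.
  intros Hf Hg e He.
  generalize (near_and _ _ _ (Hf (e/2)%R ltac:(lra)) (Hg (e/2)%R ltac:(lra))).
  apply near_mono. intros w [H1 H2].
  replace (f w + g w - (f z + g z)) with ((f w - f z) + (g w - g z)) by ring.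
  generalize (Cmod_triangle (f w - f z) (g w - g z)). lra.
Qed.

Lemma ccont_mult (f g : C -> C) (z : C) :
  ccont f z -> ccont g z -> ccont (fun w => f w * g w) z.
Proof.
  intros Hf Hg e He.
  assert (P1 := Cmod_ge_0 (f z)). assert (P2 := Cmod_ge_0 (g z)).
  set (M := (1 + Cmod (f z) + Cmod (g z))%R). assert (HM : (1 <= M)%R) by (unfold M; lra).
  set (e' := Rmin 1 (e / M)).
  assert (He' : (0 < e')%R) by (apply Rmin_pos; [lra|apply Rdiv_lt_0_compat; lra]).
  generalize (near_and _ _ _ (Hf e' He') (Hg e' He')).
  apply near_mono. intros w [H1 H2].
  replace (f w * g w - f z * g z) with
    ((f w - f z) * (g w - g z) + ((f w - f z) * g z + f z * (g w - g z))) by ring.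
  assert (E1 : (e' <= 1)%R) by apply Rmin_l.
  assert (E2 : (e' * M <= e)%R).
  { apply Rle_trans with (e / M * M)%R; [apply Rmult_le_compat_r; [lra|apply Rmin_r]|].
    right. field. lra. }
  eapply Rle_lt_trans; [apply Cmod_triangle|].
  eapply Rle_lt_trans; [apply Rplus_le_compat_l; apply Cmod_triangle|].
  rewrite !Cmod_mult.
  assert (Q1 := Cmod_ge_0 (f w - f z)). assert (Q2 := Cmod_ge_0 (g w - g z)).
  apply Rlt_le_trans with (e' * M)%R; [|exact E2]. unfold M. nra.
Qed.

Lemma ccont_inv (f : C -> C) (z : C) :
  ccont f z -> f z <> 0 -> ccont (fun w => / f w) z.
Proof.
  intros Hf Hz e He. assert (P : (0 < Cmod (f z))%R) by now apply Cmod_gt_0.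
  set (m := Cmod (f z)) in *.
  assert (He1 : (0 < m / 2)%R) by lra.
  assert (He2 : (0 < e * (m * m) / 2)%R) by (apply Rdiv_lt_0_compat; [|lra];
    apply Rmult_lt_0_compat; [lra|nra]).
  generalize (near_and _ _ _ (Hf _ He1) (Hf _ He2)). apply near_mono. intros w [H1 H2].
  assert (L : (m / 2 < Cmod (f w))%R).
  { generalize (Cmod_triangle_inv (f z) (f w)). rewrite Cmod_minus_sym. fold m. lra. }
  assert (N : f w <> 0) by (apply Cmod_gt_0; lra).
  replace (/ f w - / f z) with ((f z - f w) * (/ f w * / f z)) by (field; auto).
  rewrite !Cmod_mult, !Cmod_inv by auto. fold m. rewrite Cmod_minus_sym.
  apply Rlt_le_trans with (e * (m * m) / 2 * (/ Cmod (f w) * / m))%R.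
  - apply Rmult_lt_compat_r; [|auto]. apply Rmult_lt_0_compat; apply Rinv_0_lt_compat; lra.
  - replace e with (e * (m * m) / 2 * (/ (m/2) * / m))%R at 2 by (field; lra).
    apply Rmult_le_compat_l; [lra|]. apply Rmult_le_compat_r.
    left; apply Rinv_0_lt_compat; lra. apply Rinv_le_contravar; lra.
Qed.

Lemma ccont_comp (f g : C -> C) (z : C) :
  ccont g z -> ccont f (g z) -> ccont (fun w => f (g w)) z.
Proof.
  intros Hg Hf e He. destruct (Hf e He) as [d [Hd H]].
  generalize (Hg d Hd). apply near_mono. auto.
Qed.

(** Caratheodory's form of complex differentiability: the product, quotient and
    chain rules become algebra of continuous functions. *)
Definition cder (f : C -> C) (z l : C) :=
  exists p : C -> C,
    near z (fun w => f w - f z = p w * (w - z)) /\ ccont p z /\ p z = l.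

Lemma cder_ccont (f : C -> C) (z l : C) : cder f z l -> ccont f z.
Proof.
  intros [p [H1 [H2 H3]]].
  apply ccont_near with (fun w => f z + p w * (w - z)).
  - revert H1. apply near_mono. intros w Hw. rewrite <- Hw. ring.
  - apply ccont_plus; [apply ccont_const|]. apply ccont_mult; auto.
    apply ccont_plus; [apply ccont_id|apply ccont_const].
Qed.

Lemma cder_near (f g : C -> C) (z l : C) :
  near z (fun w => f w = g w) -> cder g z l -> cder f z l.
Proof.
  intros H [p [H1 H2]]. exists p. split; auto.
  generalize (near_and _ _ _ H H1). apply near_mono. intros w [E1 E2].
  now rewrite E1, (near_self _ _ H).
Qed.

Lemma cder_eq (f : C -> C) (z l l' : C) : cder f z l -> l = l' -> cder f z l'.
Proof. now intros H <-. Qed.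

Lemma cder_const (c z : C) : cder (fun _ => c) z 0.
Proof.
  exists (fun _ => 0). repeat split; [apply near_all; intros w; cbv beta; ring|apply ccont_const].
Qed.

Lemma cder_id (z : C) : cder (fun w => w) z 1.
Proof.
  exists (fun _ => 1). repeat split; [apply near_all; intros w; cbv beta; ring|apply ccont_const].
Qed.

Lemma cder_plus (f g : C -> C) (z l m : C) :
  cder f z l -> cder g z m -> cder (fun w => f w + g w) z (l + m).
Proof.
  intros [p [H1 [H2 H3]]] [q [K1 [K2 K3]]]. exists (fun w => p w + q w). repeat split.
  - generalize (near_and _ _ _ H1 K1). apply near_mono. intros w [E1 E2].
    transitivity ((f w - f z) + (g w - g z)); [ring|]. rewrite E1, E2. ring.
  - now apply ccont_plus.
  - now rewrite H3, K3.
Qed.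

Lemma cder_mult (f g : C -> C) (z l m : C) :
  cder f z l -> cder g z m -> cder (fun w => f w * g w) z (l * g z + f z * m).
Proof.
  intros Hf Hg. assert (Cg := cder_ccont _ _ _ Hg).
  destruct Hf as [p [H1 [H2 H3]]], Hg as [q [K1 [K2 K3]]].
  exists (fun w => p w * g w + f z * q w). repeat split.
  - generalize (near_and _ _ _ H1 K1). apply near_mono. intros w [E1 E2].
    transitivity ((f w - f z) * g w + f z * (g w - g z)); [ring|]. rewrite E1, E2. ring.
  - apply ccont_plus; apply ccont_mult; auto. apply ccont_const.
  - now rewrite H3, K3.
Qed.

Lemma cder_scal (c : C) (f : C -> C) (z l : C) :
  cder f z l -> cder (fun w => c * f w) z (c * l).
Proof.
  intros H. eapply cder_eq; [apply cder_mult; [apply cder_const|exact H]|]. cbv beta; ring.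
Qed.

Lemma cder_opp (f : C -> C) (z l : C) : cder f z l -> cder (fun w => - f w) z (- l).
Proof.
  intros H. apply cder_near with (fun w => (-(1)) * f w).
  - apply near_all. intros; cbv beta; ring.
  - eapply cder_eq; [apply cder_scal, H|]. cbv beta; ring.
Qed.

Lemma cder_minus (f g : C -> C) (z l m : C) :
  cder f z l -> cder g z m -> cder (fun w => f w - g w) z (l - m).
Proof. intros. apply cder_plus; [|apply cder_opp]; auto. Qed.

Lemma cder_inv (f : C -> C) (z l : C) :
  cder f z l -> f z <> 0 -> cder (fun w => / f w) z (- l / (f z * f z)).
Proof.
  intros Hf Hz. assert (Cf := cder_ccont _ _ _ Hf). destruct Hf as [p [H1 [H2 H3]]].
  assert (Hn : near z (fun w => f w <> 0)).
  { assert (P : (0 < Cmod (f z))%R) by now apply Cmod_gt_0.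
    generalize (Cf _ P). apply near_mono. intros w Hw E. rewrite E in Hw.
    replace (0 - f z) with (- f z) in Hw by ring. rewrite Cmod_opp in Hw. lra. }
  exists (fun w => - (1) * (p w * (/ f w * / f z))). repeat split.
  - generalize (near_and _ _ _ H1 Hn). apply near_mono. intros w [E1 E2].
    transitivity (- (f w - f z) * (/ f w * / f z)); [field; auto|]. rewrite E1. ring.
  - apply ccont_mult; [apply ccont_const|]. apply ccont_mult; auto.
    apply ccont_mult; [|apply ccont_const]. now apply ccont_inv.
  - rewrite H3. field. auto.
Qed.

Lemma cder_comp (f g : C -> C) (z l m : C) :
  cder g z l -> cder f (g z) m -> cder (fun w => f (g w)) z (m * l).
Proof.
  intros Hg Hf. assert (Cg := cder_ccont _ _ _ Hg).
  destruct Hg as [p [H1 [H2 H3]]], Hf as [q [[d [Hd K1]] [K2 K3]]].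
  exists (fun w => q (g w) * p w). repeat split.
  - generalize (near_and _ _ _ H1 (Cg d Hd)). apply near_mono. intros w [E1 E2].
    rewrite K1 by auto. rewrite E1. ring.
  - apply ccont_mult; auto. now apply ccont_comp.
  - now rewrite H3, K3.
Qed.

Lemma cder_spec (f : C -> C) (z l : C) :
  cder f z l <->
  forall e, (0 < e)%R ->
    near z (fun w => (Cmod (f w - f z - l * (w - z)) <= e * Cmod (w - z))%R).
Proof.
  split.
  - intros [p [H1 [H2 H3]]] e He. generalize (near_and _ _ _ H1 (H2 e He)).
    apply near_mono. intros w [E1 E2]. rewrite E1, <- H3.
    replace (p w * (w - z) - p z * (w - z)) with ((p w - p z) * (w - z)) by ring.
    rewrite Cmod_mult. apply Rmult_le_compat_r; [apply Cmod_ge_0|lra].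
  - intros H.
    (* The slope is the difference quotient, completed by [l] at [z] itself; its continuity at [z]
       is then the given estimate divided by [|w - z|]. *)
    exists (fun w => if excluded_middle_informative (w = z) then l else (f w - f z) / (w - z)).
    repeat split.
    + apply near_all. intros w. destruct (excluded_middle_informative (w = z)) as [->|N].
      ring. field. intros E. apply N. replace w with ((w - z) + z) by ring. rewrite E. ring.
    + intros e He. generalize (H (e/2)%R ltac:(lra)). apply near_mono. intros w Hw.
      destruct (excluded_middle_informative (z = z)) as [_|N]; [|now elim N].
      destruct (excluded_middle_informative (w = z)) as [->|N].
      * replace (l - l) with (RtoC 0) by ring. now rewrite Cmod_0.
      * assert (N' : w - z <> 0).
        { intros E. apply N. replace w with ((w - z) + z) by ring. rewrite E. ring. }
        replace ((f w - f z) / (w - z) - l) with ((f w - f z - l * (w - z)) / (w - z))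
          by (field; auto).
        rewrite Cmod_div by auto. assert (P : (0 < Cmod (w - z))%R) by now apply Cmod_gt_0.
        apply Rmult_lt_reg_r with (Cmod (w - z)); auto. unfold Rdiv.
        rewrite Rmult_assoc, Rinv_l by lra. nra.
    + destruct (excluded_middle_informative (z = z)) as [_|N]; [auto|now elim N].
Qed.

Lemma cder_unique (f : C -> C) (z l m : C) : cder f z l -> cder f z m -> l = m.
Proof.
  rewrite !cder_spec. intros Hl Hm.
  destruct (excluded_middle_informative (l = m)) as [E|N]; auto. exfalso.
  assert (P : (0 < Cmod (l - m))%R).
  { apply Cmod_gt_0. intros E. apply N. replace l with ((l - m) + m) by ring. rewrite E. ring. }
  (* With a third of [|l - m|] as tolerance, the two expansions at the common point [z + d/2] would
     give [|l - m| <= (2/3) |l - m|]. *)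
  assert (He : (0 < Cmod (l - m) / 3)%R) by lra.
  destruct (near_and _ _ _ (Hl _ He) (Hm _ He)) as [d [Hd K]].
  destruct (K (z + RtoC (d/2))) as [K1 K2];
    replace (z + RtoC (d/2) - z) with (RtoC (d/2)) in * by ring;
    rewrite ?Cmod_R, ?(Rabs_pos_eq (d/2)) in * by lra; [lra|].
  assert (Q : (Cmod ((l - m) * RtoC (d/2)) <= Cmod (l-m) / 3 * (d/2) + Cmod (l-m) / 3 * (d/2))%R).
  { replace ((l - m) * RtoC (d/2)) with
      ((f (z + RtoC (d/2)) - f z - m * RtoC (d/2)) - (f (z + RtoC (d/2)) - f z - l * RtoC (d/2))) by ring.
    now apply Cmod_minus_le. }
  rewrite Cmod_mult, Cmod_R, (Rabs_pos_eq (d/2)) in Q by lra. nra.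
Qed.

Lemma cder_is_derive (f : C -> C) (z l : C) :
  cder f z l <-> is_derive (f : C_AbsRing -> C_NormedModule) z l.
Proof.
  rewrite cder_spec. split.
  - intros H. split.
    + apply is_linear_scal_l.
    + intros x Hx e.
      (* Coquelicot tests the derivative at every limit point of the filter; the neighbourhoods of
         [z] have only [z]. *)
      apply (is_filter_lim_locally_unique (z : AbsRing_UniformSpace C_AbsRing) x) in Hx.
      subst x. destruct (H e (cond_pos e)) as [d [Hd K]].
      exists (mkposreal d Hd). intros w Hw. specialize (K w Hw).
      match goal with |- (norm ?a <= _ * norm ?b)%R =>
        change (norm a) with (Cmod a); change (norm b) with (Cmod b) end.
      change (Cmod ((f w - f z) - (w - z) * l) <= e * Cmod (w - z))%R.
      now rewrite (Cmult_comm (w - z) l).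
  - intros [_ H] e He.
    destruct (H z (fun P HP => HP) (mkposreal e He)) as [d K].
    exists d. split; [apply cond_pos|]. intros w Hw. specialize (K w Hw).
    change (Cmod ((f w - f z) - (w - z) * l) <= e * Cmod (w - z))%R in K.
    now rewrite (Cmult_comm (w - z) l) in K.
Qed.

(** * Roots and arguments *)

Lemma ccont_neq0 (f : C -> C) (z : C) : ccont f z -> f z <> 0 -> near z (fun w => f w <> 0).
Proof.
  intros Cf Hz. assert (P : (0 < Cmod (f z))%R) by now apply Cmod_gt_0.
  generalize (Cf _ P). apply near_mono. intros w Hw E. rewrite E in Hw.
  replace (0 - f z) with (- f z) in Hw by ring. rewrite Cmod_opp in Hw. lra.
Qed.

Lemma Cmult_eq_reg_l (c a b : C) : c <> 0 -> c * a = c * b -> a = b.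
Proof.
  intros N E. replace a with (/ c * (c * a)) by (field; auto). rewrite E. field. auto.
Qed.

Lemma ccont_lip (f : C -> C) (z : C) :
  (forall w, (Cmod (f w - f z) <= Cmod (w - z))%R) -> ccont f z.
Proof. intros H e He. exists e. split; auto. intros w Hw. specialize (H w). lra. Qed.

Lemma ccont_Re (z : C) : ccont (fun w => RtoC (Re w)) z.
Proof.
  apply ccont_lip. intros w. rewrite <- RtoC_minus, Cmod_R.
  replace (Re w - Re z)%R with (Re (w - z)) by (destruct w, z; simpl; ring).
  apply re_le_Cmod.
Qed.

Lemma ccont_Im (z : C) : ccont (fun w => RtoC (Im w)) z.
Proof.
  apply ccont_lip. intros w. rewrite <- RtoC_minus, Cmod_R.
  replace (Im w - Im z)%R with (Im (w - z)) by (destruct w, z; simpl; ring).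
  apply im_le_Cmod.
Qed.

Lemma ccont_Cmod (z : C) : ccont (fun w => RtoC (Cmod w)) z.
Proof.
  apply ccont_lip. intros w. rewrite <- RtoC_minus, Cmod_R. apply Rabs_le.
  generalize (Cmod_triangle_inv w z) (Cmod_triangle_inv z w).
  rewrite (Cmod_minus_sym z w). lra.
Qed.

Lemma ccont_real_comp (h : R -> R) (u : C -> R) (z : C) :
  ccont (fun w => RtoC (u w)) z -> continuity_pt h (u z) -> ccont (fun w => RtoC (h (u w))) z.
Proof.
  intros Hu Hh e He. destruct (Hh e He) as [d [Hd K]].
  generalize (Hu d Hd). apply near_mono. intros w Hw.
  rewrite <- RtoC_minus, Cmod_R in *.
  destruct (Req_dec (u w) (u z)) as [E|N].
  - rewrite E, Rminus_diag, Rabs_R0. exact He.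
  - apply K. repeat split; auto.
Qed.

Lemma ccont_pair (u v : C -> R) (z : C) :
  ccont (fun w => RtoC (u w)) z -> ccont (fun w => RtoC (v w)) z ->
  ccont (fun w => (u w, v w) : C) z.
Proof.
  intros Hu Hv. apply ccont_near with (fun w => RtoC (u w) + Ci * RtoC (v w)).
  - apply near_all. intros w. unfold RtoC, Ci, Cplus, Cmult; simpl. f_equal; ring.
  - apply ccont_plus; auto. apply ccont_mult; auto. apply ccont_const.
Qed.

Lemma Cmod_polar (r a : R) : (0 <= r)%R -> Cmod (r * cos a, r * sin a)%R = r.
Proof.
  intros H. unfold Cmod. simpl fst. simpl snd.
  replace ((r * cos a) ^ 2 + (r * sin a) ^ 2)%R with (r ^ 2)%R.
  now apply sqrt_pow2.
  generalize (sin2_cos2 a). unfold Rsqr. intros E.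
  transitivity (r ^ 2 * (sin a * sin a + cos a * cos a))%R; [rewrite E|]; ring.
Qed.

Lemma Cmod_cpow (argf : C -> R) (a : R) (z : C) : Cmod (cpow argf a z) = Rpower (Cmod z) a.
Proof. apply Cmod_polar. left. apply exp_pos. Qed.

Lemma cpow_add (argf : C -> R) (a b : R) (z : C) :
  cpow argf (a + b)%R z = cpow argf a z * cpow argf b z.
Proof.
  unfold cpow, Cmult. simpl fst. simpl snd. rewrite Rpower_plus, !Rmult_plus_distr_r.
  rewrite cos_plus, sin_plus. f_equal; ring.
Qed.

Definition polar (argf : C -> R) (z : C) :=
  z = (Cmod z * cos (argf z), Cmod z * sin (argf z))%R.

Lemma cpow_1 (argf : C -> R) (z : C) : polar argf z -> z <> 0 -> cpow argf 1 z = z.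
Proof.
  intros H N. unfold cpow. rewrite Rpower_1 by now apply Cmod_gt_0.
  rewrite Rmult_1_l. now symmetry.
Qed.

Lemma Cmod_sq (z : C) : (Cmod z * Cmod z = Re z * Re z + Im z * Im z)%R.
Proof. generalize (Cmod2_alt z). intros E. simpl in E. nra. Qed.

(** The slit plane: [Cmod z + Re z] vanishes exactly on the closed negative real axis. *)
Lemma slit_pos (z : C) : (Im z <> 0 \/ 0 < Re z)%R -> (0 < Cmod z + Re z)%R.
Proof.
  intros H. assert (P := Cmod_ge_0 z). assert (E := Cmod_sq z).
  destruct (Rle_or_lt (Cmod z + Re z) 0) as [L|]; auto. exfalso.
  destruct H as [H|H]; [|lra].
  assert (0 < Im z * Im z)%R by (apply Rsqr_pos_lt; auto). nra.
Qed.

(** On the positive real axis [Arg] is 0 by a separate clause, in agreement with [atan 0]; so one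
    formula covers the whole slit plane. *)
Lemma Arg_slit (z : C) : (Im z <> 0 \/ 0 < Re z)%R ->
  Arg z = (2 * atan (Im z / (Cmod z + Re z)))%R.
Proof.
  intros H. unfold Arg. destruct (Req_EM_T (Im z) 0) as [E|N]; auto.
  destruct (Rle_dec (Re z) 0) as [L|L]; [destruct H; lra|].
  rewrite E. unfold Rdiv. rewrite Rmult_0_l, atan_0. ring.
Qed.

(** With [t = y / (m + x)], the tangent of half the argument, the cosine is [(1 - t^2) / (1 + t^2)]
    and the sine [2 t / (1 + t^2)]. The link with the modulus is [t^2 (m + x) = m - x], which
    restates [y^2 = m^2 - x^2]. On the negative axis the value [PI] is checked directly. *)
Lemma polar_Arg (z : C) : z <> 0 -> polar Arg z.
Proof.
  intros Nz. unfold polar.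
  assert (P : (0 < Cmod z)%R) by now apply Cmod_gt_0. assert (E := Cmod_sq z).
  destruct (excluded_middle_informative (Im z <> 0 \/ 0 < Re z)%R) as [H|H].
  - rewrite (Arg_slit z H). assert (S := slit_pos z H).
    set (m := Cmod z) in *. set (x := Re z) in *. set (y := Im z) in *.
    set (t := (y / (m + x))%R).
    assert (Ht : (t * (m + x) = y)%R) by (unfold t; field; lra).
    assert (Hq : (0 < 1 + t * t)%R) by nra.
    assert (C1 : (cos (2 * atan t) * (1 + t * t) = 1 - t * t)%R).
    { rewrite cos_2a, cos_atan, sin_atan. unfold Rdiv. rewrite Rmult_1_l.
      assert (Q : (/ sqrt (1 + t²) * / sqrt (1 + t²) = / (1 + t * t))%R).
      { rewrite <- Rinv_mult, sqrt_sqrt; [reflexivity|unfold Rsqr; lra]. }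
      replace ((/ sqrt (1 + t²) * / sqrt (1 + t²) - t * / sqrt (1 + t²) * (t * / sqrt (1 + t²))))%R
        with (/ sqrt (1 + t²) * / sqrt (1 + t²) * (1 - t * t))%R by ring.
      rewrite Q. field. lra. }
    assert (S1 : (sin (2 * atan t) * (1 + t * t) = 2 * t)%R).
    { rewrite sin_2a, cos_atan, sin_atan. unfold Rdiv. rewrite Rmult_1_l.
      assert (Q : (/ sqrt (1 + t²) * / sqrt (1 + t²) = / (1 + t * t))%R).
      { rewrite <- Rinv_mult, sqrt_sqrt; [reflexivity|unfold Rsqr; lra]. }
      replace (2 * (t * / sqrt (1 + t²)) * / sqrt (1 + t²))%R
        with (/ sqrt (1 + t²) * / sqrt (1 + t²) * (2 * t))%R by ring.
      rewrite Q. field. lra. }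
    assert (A : (t * t * (m + x) = m - x)%R).
    { apply Rmult_eq_reg_r with (m + x)%R; [|lra].
      replace (t * t * (m + x) * (m + x))%R with (t * (m + x) * (t * (m + x)))%R by ring.
      rewrite Ht. lra. }
    apply injective_projections; simpl.
    + change (x = m * cos (2 * atan t))%R. apply Rmult_eq_reg_r with (1 + t * t)%R; [|lra].
      rewrite Rmult_assoc, C1. nra.
    + change (y = m * sin (2 * atan t))%R. apply Rmult_eq_reg_r with (1 + t * t)%R; [|lra].
      rewrite Rmult_assoc, S1. rewrite <- Ht.
      replace (t * (m + x) * (1 + t * t))%R with (t * ((m + x) + t * t * (m + x)))%R by ring.
      rewrite A. ring.
  - assert (Hi : Im z = 0%R) by (destruct (Req_dec (Im z) 0); tauto).
    assert (Hr : (Re z <= 0)%R) by (apply Rnot_lt_le; tauto).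
    unfold Arg. destruct (Req_EM_T (Im z) 0) as [_|N]; [|tauto].
    destruct (Rle_dec (Re z) 0) as [_|N]; [|tauto].
    rewrite cos_PI, sin_PI. rewrite Hi in E.
    assert (M : Cmod z = (- Re z)%R) by nra.
    rewrite M. destruct z as [a b]. unfold Re, Im in *. simpl in *. f_equal; lra.
Qed.

Lemma ccont_Arg (z : C) : (Im z <> 0 \/ 0 < Re z)%R -> ccont (fun w => RtoC (Arg w)) z.
Proof.
  intros H. assert (S := slit_pos z H).
  assert (Hc : ccont (fun w => RtoC (Cmod w) + RtoC (Re w)) z)
    by (apply ccont_plus; [apply ccont_Cmod|apply ccont_Re]).
  assert (Hn : RtoC (Cmod z) + RtoC (Re z) <> 0).
  { rewrite <- RtoC_plus. intros E. apply RtoC_inj in E. lra. }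
  (* The real quotient is written as the real part of a complex one, so that the continuity rules
     for complex products and inverses apply to it. *)
  apply ccont_near with (fun w => RtoC (2 * atan (Re (RtoC (Im w) * / (RtoC (Cmod w) + RtoC (Re w)))))).
  - assert (Hs : near z (fun w => (Im w <> 0 \/ 0 < Re w)%R)).
    { destruct H as [H|H].
      - generalize (ccont_neq0 _ _ (ccont_Im z)). intros K.
        eapply near_mono; [|apply K; intros E; apply RtoC_inj in E; auto].
        intros w Hw. left. intros E. apply Hw. now rewrite E.
      - generalize (ccont_Re z (Re z) H). apply near_mono. intros w Hw. right.
        rewrite <- RtoC_minus, Cmod_R in Hw. apply Rabs_def2 in Hw. lra. }
    revert Hs. apply near_mono. intros w Hw. rewrite (Arg_slit w Hw).
    assert (Sw := slit_pos w Hw).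
    rewrite <- RtoC_plus, <- RtoC_inv, <- RtoC_mult by lra. reflexivity.
  - apply ccont_near with (fun w => 2 * RtoC (atan (Re (RtoC (Im w) * / (RtoC (Cmod w) + RtoC (Re w)))))).
    + apply near_all. intros w. now rewrite <- RtoC_mult.
    + apply ccont_mult; [apply ccont_const|].
      apply (ccont_real_comp atan).
      * apply (ccont_comp (fun w => RtoC (Re w))); [|apply ccont_Re].
        apply ccont_mult; [apply ccont_Im|]. now apply ccont_inv.
      * apply derivable_continuous_pt, derivable_pt_atan.
Qed.

Lemma ccont_cpow (argf : C -> R) (a : R) (z : C) :
  z <> 0 -> ccont (fun w => RtoC (argf w)) z -> ccont (cpow argf a) z.
Proof.
  intros Nz Ha. assert (P : (0 < Cmod z)%R) by now apply Cmod_gt_0.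
  assert (Hr : ccont (fun w => RtoC (Rpower (Cmod w) a)) z).
  { apply (ccont_real_comp (fun x => Rpower x a)); [apply ccont_Cmod|].
    apply derivable_continuous_pt. eexists. now apply derivable_pt_lim_power. }
  assert (Ht : ccont (fun w => RtoC (a * argf w)) z).
  { apply ccont_near with (fun w => RtoC a * RtoC (argf w)).
    - apply near_all. intros w. now rewrite RtoC_mult.
    - apply ccont_mult; auto. apply ccont_const. }
  apply ccont_pair.
  - apply ccont_near with (fun w => RtoC (Rpower (Cmod w) a) * RtoC (cos (a * argf w))).
    + apply near_all. intros w. now rewrite RtoC_mult.
    + apply ccont_mult; auto. apply (ccont_real_comp cos); auto. apply continuity_cos.
  - apply ccont_near with (fun w => RtoC (Rpower (Cmod w) a) * RtoC (sin (a * argf w))).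
    + apply near_all. intros w. now rewrite RtoC_mult.
    + apply ccont_mult; auto. apply (ccont_real_comp sin); auto. apply continuity_sin.
Qed.

(** [s^3 = U] near [z] and continuity alone determine the derivative of the cube root. *)
Lemma cder_cbrt (s : C -> C) (z : C) :
  near z (fun w => s w * s w * s w = w) -> ccont s z -> s z <> 0 ->
  cder s z (/ (3 * (s z * s z))).
Proof.
  intros H Cs Nz.
  set (q := fun w => s w * s w + (s w * s z + s z * s z)).
  assert (Cq : ccont q z).
  { unfold q. repeat (apply ccont_plus || apply ccont_mult || apply ccont_const || exact Cs). }
  assert (Nq : q z <> 0).
  { unfold q. replace (s z * s z + (s z * s z + s z * s z)) with (3 * (s z * s z)) by ring.
    repeat apply Cmult_neq_0; auto. intros E. apply RtoC_inj in E. lra. }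
  exists (fun w => / q w). repeat split.
  - generalize (near_and _ _ _ H (ccont_neq0 _ _ Cq Nq)). apply near_mono. intros w [E N].
    assert (Ez := near_self _ _ H). simpl in Ez.
    apply (Cmult_eq_reg_l (q w)); auto.
    transitivity (s w * s w * s w - s z * s z * s z). unfold q; ring.
    rewrite E, Ez. field. exact N.
  - now apply ccont_inv.
  - unfold q. f_equal. ring.
Qed.

Lemma csqrt_sq (z : C) : z <> 0 -> csqrt z * csqrt z = z.
Proof.
  intros Nz. unfold csqrt. rewrite <- cpow_add. replace (1/2 + 1/2)%R with 1%R by lra.
  apply cpow_1; auto. now apply polar_Arg.
Qed.

(** Half of the argument is the arctangent itself, which lies strictly between [-PI/2] and
    [PI/2]. *)
Lemma Re_csqrt_pos (z : C) : (0 < Re z)%R -> (0 < Re (csqrt z))%R.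
Proof.
  intros H. unfold csqrt, cpow. simpl. apply Rmult_lt_0_compat; [apply exp_pos|].
  rewrite Arg_slit by auto.
  generalize (atan_bound (Im z / (Cmod z + Re z))). intros [A B].
  apply cos_gt_0; lra.
Qed.

(** As [w - z] is the product of the difference and the sum of the two roots, the slope is the
    inverse of the sum. Near [z] both roots have positive real part, so the sum does not vanish. *)
Lemma cder_csqrt (z : C) : (0 < Re z)%R -> cder csqrt z (/ (2 * csqrt z)).
Proof.
  intros H. assert (Q := Re_csqrt_pos z H).
  set (q := fun w => csqrt w + csqrt z).
  assert (Hp : near z (fun w => (0 < Re w)%R)).
  { generalize (ccont_Re z (Re z) H). apply near_mono. intros w Hw.
    rewrite <- RtoC_minus, Cmod_R in Hw. apply Rabs_def2 in Hw. lra. }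
  assert (Hc : ccont csqrt z).
  { apply ccont_cpow; [now apply C_neq_Re|]. apply ccont_Arg. auto. }
  exists (fun w => / q w). repeat split.
  - revert Hp. apply near_mono. intros w Hw. assert (Qw := Re_csqrt_pos w Hw).
    assert (N : q w <> 0).
    { apply C_neq_Re. unfold q. change (0 < Re (csqrt w) + Re (csqrt z))%R. lra. }
    apply (Cmult_eq_reg_l (q w)); auto.
    transitivity (csqrt w * csqrt w - csqrt z * csqrt z). unfold q; ring.
    rewrite !csqrt_sq by now apply C_neq_Re. field. exact N.
  - apply ccont_inv.
    + apply ccont_plus; auto. apply ccont_const.
    + apply C_neq_Re. unfold q. change (0 < Re (csqrt z) + Re (csqrt z))%R. lra.
  - unfold q. f_equal. ring.
Qed.

(** * Functions of a real variable with complex values *)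

(** Taken componentwise, so that the mean value theorem and the Riemann integral for real functions
    apply. *)
Definition rder (f : R -> C) (t : R) (l : C) :=
  is_derive (fun x => Re (f x)) t (Re l) /\ is_derive (fun x => Im (f x)) t (Im l).

Lemma rder_eq (f : R -> C) (t : R) (l l' : C) : rder f t l -> l = l' -> rder f t l'.
Proof. now intros H <-. Qed.

Lemma rder_ext (f g : R -> C) (t : R) (l : C) :
  (forall x, f x = g x) -> rder g t l -> rder f t l.
Proof.
  intros E [H1 H2]. split; (eapply is_derive_ext; [|eassumption]); intros x; simpl; now rewrite E.
Qed.

Lemma rder_const (c : C) (t : R) : rder (fun _ => c) t 0.
Proof. split; apply (is_derive_const (V := R_NormedModule)). Qed.

Lemma rder_plus (f g : R -> C) (t : R) (l m : C) :
  rder f t l -> rder g t m -> rder (fun x => f x + g x) t (l + m).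
Proof.
  intros [F1 F2] [G1 G2]. split.
  - apply (is_derive_plus (V := R_NormedModule) (fun x => Re (f x)) (fun x => Re (g x))); auto.
  - apply (is_derive_plus (V := R_NormedModule) (fun x => Im (f x)) (fun x => Im (g x))); auto.
Qed.

Lemma rder_mult (f g : R -> C) (t : R) (l m : C) :
  rder f t l -> rder g t m -> rder (fun x => f x * g x) t (l * g t + f t * m).
Proof.
  intros [F1 F2] [G1 G2]. rewrite is_derive_Reals in *.
  split; rewrite is_derive_Reals.
  - replace (Re (l * g t + f t * m)) with
      ((Re l * Re (g t) + Re (f t) * Re m) - (Im l * Im (g t) + Im (f t) * Im m))%R
      by (unfold Re, Im; simpl; ring).
    apply (derivable_pt_lim_minus (fun x => Re (f x) * Re (g x))%R (fun x => Im (f x) * Im (g x))%R).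
    + apply (derivable_pt_lim_mult (fun x => Re (f x)) (fun x => Re (g x))); auto.
    + apply (derivable_pt_lim_mult (fun x => Im (f x)) (fun x => Im (g x))); auto.
  - replace (Im (l * g t + f t * m)) with
      ((Re l * Im (g t) + Re (f t) * Im m) + (Im l * Re (g t) + Im (f t) * Re m))%R
      by (unfold Re, Im; simpl; ring).
    apply (derivable_pt_lim_plus (fun x => Re (f x) * Im (g x))%R (fun x => Im (f x) * Re (g x))%R).
    + apply (derivable_pt_lim_mult (fun x => Re (f x)) (fun x => Im (g x))); auto.
    + apply (derivable_pt_lim_mult (fun x => Im (f x)) (fun x => Re (g x))); auto.
Qed.

Lemma rder_scal (c : C) (f : R -> C) (t : R) (l : C) :
  rder f t l -> rder (fun x => c * f x) t (c * l).
Proof.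
  intros H. eapply rder_eq; [apply rder_mult; [apply rder_const|exact H]|]. cbv beta; ring.
Qed.

Lemma rder_opp (f : R -> C) (t : R) (l : C) : rder f t l -> rder (fun x => - f x) t (- l).
Proof.
  intros H. apply rder_ext with (fun x => (-(1)) * f x); [intros; cbv beta; ring|].
  eapply rder_eq; [apply rder_scal, H|]. cbv beta; ring.
Qed.

Lemma rder_minus (f g : R -> C) (t : R) (l m : C) :
  rder f t l -> rder g t m -> rder (fun x => f x - g x) t (l - m).
Proof. intros. apply rder_plus; [|apply rder_opp]; auto. Qed.

Lemma rder_id (t : R) : rder (fun x => RtoC x) t 1.
Proof.
  split; simpl; [apply (is_derive_id (K := R_AbsRing))|apply (is_derive_const (V := R_NormedModule))].
Qed.

Lemma rder_cexp (a b : C) (t : R) :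
  rder (fun x => cexp (a + RtoC x * b)) t (b * cexp (a + RtoC t * b)).
Proof.
  destruct a as [a1 a2], b as [b1 b2].
  split; unfold cexp, Re, Im; simpl; auto_derive; auto; unfold Rminus; ring.
Qed.

(** The estimate is made once, for the complex difference quotient; its modulus dominates the errors
    of both components. Dividing tolerances by [1 + |v|] covers [v = 0] as well. *)
Lemma cder_rder (F : C -> C) (U v l : C) (t : R) :
  cder F (U + RtoC t * v) l -> rder (fun x => F (U + RtoC x * v)) t (v * l).
Proof.
  intros [p [[d [Hd H]] [Cp Hl]]]. set (z := U + RtoC t * v) in *.
  assert (K : forall e, (0 < e)%R -> exists dl : posreal, forall h : R, h <> 0%R ->
    (Rabs h < dl)%R -> (Cmod ((F (U + RtoC (t + h) * v)%C - F z) / RtoC h - v * l) < e)%R).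
  { intros e He. assert (Pv := Cmod_ge_0 v).
    assert (He' : (0 < e / (1 + Cmod v))%R) by (apply Rdiv_lt_0_compat; lra).
    destruct (Cp _ He') as [d' [Hd' H']].
    assert (Hm : (0 < Rmin d d' / (1 + Cmod v))%R).
    { apply Rdiv_lt_0_compat; [now apply Rmin_pos|lra]. }
    exists (mkposreal _ Hm). simpl. intros h Nh Hh.
    assert (Ez : U + RtoC (t + h) * v - z = RtoC h * v).
    { unfold z. rewrite RtoC_plus. ring. }
    assert (Bz : (Cmod (U + RtoC (t + h) * v - z) < Rmin d d')%R).
    { rewrite Ez, Cmod_mult, Cmod_R. apply Rle_lt_trans with (Rabs h * (1 + Cmod v))%R.
      - apply Rmult_le_compat_l; [apply Rabs_pos|lra].
      - replace (Rmin d d') with (Rmin d d' / (1 + Cmod v) * (1 + Cmod v))%R by (field; lra).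
        apply Rmult_lt_compat_r; lra. }
    assert (Nh' : RtoC h <> 0) by (intros E; apply RtoC_inj in E; auto).
    rewrite H by (eapply Rlt_le_trans; [exact Bz|apply Rmin_l]). rewrite Ez.
    specialize (H' _ (Rlt_le_trans _ _ _ Bz (Rmin_r _ _))).
    replace (p (U + RtoC (t + h) * v) * (RtoC h * v) / RtoC h - v * l)
      with ((p (U + RtoC (t + h) * v) - p z) * v) by (rewrite Hl; field; auto).
    rewrite Cmod_mult.
    apply Rle_lt_trans with (e / (1 + Cmod v) * Cmod v)%R.
    - apply Rmult_le_compat_r; lra.
    - apply Rlt_le_trans with (e / (1 + Cmod v) * (1 + Cmod v))%R.
      + apply Rmult_lt_compat_l; lra.
      + right. field. lra. }
  split; rewrite is_derive_Reals; intros e He; destruct (K e He) as [dl Hdl]; exists dl;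
    intros h Nh Hh; specialize (Hdl h Nh Hh); (eapply Rle_lt_trans; [|exact Hdl]).
  - match goal with |- (Rabs ?a <= Cmod ?b)%R => replace a with (Re b) end; [apply re_le_Cmod|].
    unfold Re, z; destruct (F (U + RtoC (t + h) * v)), (F (U + RtoC t * v)), (v * l); simpl.
    field. auto.
  - match goal with |- (Rabs ?a <= Cmod ?b)%R => replace a with (Im b) end; [apply im_le_Cmod|].
    unfold Im, z; destruct (F (U + RtoC (t + h) * v)), (F (U + RtoC t * v)), (v * l); simpl.
    field. auto.
Qed.

Lemma nonneg_derive_le (g g' : R -> R) (a b : R) : (a <= b)%R ->
  (forall t, (a <= t <= b)%R -> is_derive g t (g' t)) ->
  (forall t, (a <= t <= b)%R -> (0 <= g' t)%R) -> (g a <= g b)%R.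
Proof.
  intros Hab Hg Hp. destruct (MVT_gen g a b g') as [c [Hc E]].
  - intros x. rewrite Rmin_left, Rmax_right by auto. intros. apply Hg. lra.
  - intros x. rewrite Rmin_left, Rmax_right by auto. intros Hx.
    apply derivable_continuous_pt. exists (g' x). apply is_derive_Reals. auto.
  - rewrite Rmin_left, Rmax_right in Hc by auto. specialize (Hp c Hc). nra.
Qed.

(** Mean value inequality: rotating [f b - f a] onto the positive real axis
    reduces it to monotonicity of a real function. *)
Lemma mvi (f f' : R -> C) (g g' : R -> R) (a b : R) :
  (a <= b)%R ->
  (forall t, (a <= t <= b)%R -> rder f t (f' t)) ->
  (forall t, (a <= t <= b)%R -> is_derive g t (g' t)) ->
  (forall t, (a <= t <= b)%R -> (Cmod (f' t) <= g' t)%R) ->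
  (Cmod (f b - f a) <= g b - g a)%R.
Proof.
  intros Hab Hf Hg Hle.
  set (D := f b - f a). set (u := Cconj D).
  set (h := fun t => (Cmod D * g t - (Re u * Re (f t) - Im u * Im (f t)))%R).
  set (h' := fun t => (Cmod D * g' t - (Re u * Re (f' t) - Im u * Im (f' t)))%R).
  assert (Hh : forall t, (a <= t <= b)%R -> is_derive h t (h' t)).
  { intros t Ht. destruct (Hf t Ht) as [F1 F2]. specialize (Hg t Ht).
    rewrite is_derive_Reals in *.
    apply (derivable_pt_lim_minus (fun t => Cmod D * g t)%R
      (fun t => Re u * Re (f t) - Im u * Im (f t))%R).
    - now apply (derivable_pt_lim_scal g).
    - apply (derivable_pt_lim_minus (fun t => Re u * Re (f t))%R (fun t => Im u * Im (f t))%R).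
      + now apply (derivable_pt_lim_scal (fun t => Re (f t))).
      + now apply (derivable_pt_lim_scal (fun t => Im (f t))). }
  assert (M : (h a <= h b)%R).
  { apply (nonneg_derive_le h h'); auto. intros t Ht. unfold h'.
    replace (Re u * Re (f' t) - Im u * Im (f' t))%R with (Re (u * f' t))
      by (unfold Re, Im; simpl; ring).
    assert (B : (Re (u * f' t) <= Cmod D * g' t)%R).
    { eapply Rle_trans; [apply Re_le_Cmod'|]. rewrite Cmod_mult. unfold u.
      rewrite Cmod_conj. apply Rmult_le_compat_l; [apply Cmod_ge_0|auto]. }
    lra. }
  unfold h in M.
  assert (E : ((Re u * Re (f b) - Im u * Im (f b)) - (Re u * Re (f a) - Im u * Im (f a))
    = Cmod D * Cmod D)%R).
  { rewrite Cmod_sq. unfold u, D, Re, Im. destruct (f a), (f b); simpl. ring. }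
  assert (P := Cmod_ge_0 D).
  assert (M' : (Cmod D * Cmod D <= Cmod D * (g b - g a))%R) by lra.
  (* The factor [|D|] can be cancelled only if it is positive; for [D = 0] the claim is the
     monotonicity of [g]. *)
  destruct P as [P|P].
  - apply Rmult_le_reg_l with (Cmod D); auto.
  - rewrite <- P.
    assert (Q : (g a <= g b)%R).
    { apply (nonneg_derive_le g g'); auto. intros t Ht.
      generalize (Hle t Ht) (Cmod_ge_0 (f' t)). lra. }
    lra.
Qed.

Definition prim (f : R -> C) (T : R) : C :=
  (RInt (fun t => Re (f (Rabs t))) 0 T, RInt (fun t => Im (f (Rabs t))) 0 T).

Lemma prim_0 (f : R -> C) : prim f 0 = 0.
Proof. unfold prim. now rewrite !RInt_point. Qed.

(** Extending the integrand evenly makes it continuous on the whole line, so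
    that the primitive is differentiable at the end point [0] as well. *)
Lemma rder_prim (f : R -> C) (T : R) :
  (forall t, (0 <= t)%R -> exists l, rder f t l) -> (0 <= T)%R -> rder (prim f) T (f T).
Proof.
  intros H HT.
  assert (H1 : forall t, continuous (fun t => Re (f (Rabs t))) t).
  { intros t. apply (continuous_comp Rabs (fun x => Re (f x))).
    - apply continuous_Rabs.
    - destruct (H (Rabs t) (Rabs_pos t)) as [l [A B]].
      apply (ex_derive_continuous (V := R_NormedModule)). eexists; eauto. }
  assert (H2 : forall t, continuous (fun t => Im (f (Rabs t))) t).
  { intros t. apply (continuous_comp Rabs (fun x => Im (f x))).
    - apply continuous_Rabs.
    - destruct (H (Rabs t) (Rabs_pos t)) as [l [A B]].
      apply (ex_derive_continuous (V := R_NormedModule)). eexists; eauto. }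
  split; unfold prim, Re at 1, Im at 1; simpl.
  - replace (Re (f T)) with (Re (f (Rabs T))) by now rewrite Rabs_pos_eq.
    apply (is_derive_RInt (fun t => Re (f (Rabs t))) (fun T => RInt (fun t => Re (f (Rabs t))) 0 T) 0).
    + apply filter_forall. intros b. apply (RInt_correct (V := R_CompleteNormedModule)).
      apply (ex_RInt_continuous (V := R_CompleteNormedModule)). auto.
    + apply H1.
  - replace (Im (f T)) with (Im (f (Rabs T))) by now rewrite Rabs_pos_eq.
    apply (is_derive_RInt (fun t => Im (f (Rabs t))) (fun T => RInt (fun t => Im (f (Rabs t))) 0 T) 0).
    + apply filter_forall. intros b. apply (RInt_correct (V := R_CompleteNormedModule)).
      apply (ex_RInt_continuous (V := R_CompleteNormedModule)). auto.
    + apply H2.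
Qed.

(** Serves to differentiate an integral over the segment with respect to its starting point.
    Compactness makes the radius uniform in [t]: near each point [F'] oscillates by less than [e],
    and the mean value inequality on the segment from [V] to [V + h] turns this into the bound on
    the remainder. *)
Lemma segment_uniform_derivative (F F' : C -> C) (U v : C) (T : R) :
  (forall t, (0 <= t <= T)%R ->
     near (U + RtoC t * v) (fun V => cder F V (F' V)) /\ ccont F' (U + RtoC t * v)) ->
  forall e, (0 < e)%R -> exists d, (0 < d)%R /\ forall t, (0 <= t <= T)%R -> forall h,
    (Cmod h < d)%R ->
    (Cmod (F (U + RtoC t * v + h)%C - F (U + RtoC t * v)%C - F' (U + RtoC t * v)%C * h) <= e * Cmod h)%R.
Proof.
  intros H e He.
  assert (K : forall t, exists d : posreal, (0 <= t <= T)%R -> forall V,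
    (Cmod (V - (U + RtoC t * v)) < 2 * d)%R ->
    cder F V (F' V) /\ (Cmod (F' V - F' (U + RtoC t * v)%C) < e / 2)%R).
  { intros t. destruct (excluded_middle_informative (0 <= t <= T)%R) as [Ht|N].
    - destruct (H t Ht) as [H1 H2].
      destruct (near_and _ _ _ H1 (H2 (e/2)%R ltac:(lra))) as [d [Hd H3]].
      assert (Hd' : (0 < d / 2)%R) by lra. exists (mkposreal _ Hd'). simpl. intros _ V HV.
      apply H3. lra.
    - exists (mkposreal 1 Rlt_0_1). tauto. }
  set (dl := fun t => proj1_sig (constructive_indefinite_description _ (K t))).
  assert (Hdl : forall t, (0 <= t <= T)%R -> forall V,
    (Cmod (V - (U + RtoC t * v)) < 2 * dl t)%R ->
    cder F V (F' V) /\ (Cmod (F' V - F' (U + RtoC t * v)%C) < e / 2)%R).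
  { intros t. unfold dl. destruct (constructive_indefinite_description _ (K t)); auto. }
  assert (Pv := Cmod_ge_0 v).
  (* A parameter distance is multiplied by [|v|] in the plane; the rescaled gauge keeps the point
     within [dl x] of its centre, and the increment [h] uses the other half of the radius
     [2 * dl x]. *)
  assert (Hq : forall t, (0 < dl t / (1 + Cmod v))%R).
  { intros. apply Rdiv_lt_0_compat; [apply cond_pos|lra]. }
  destruct (compactness_value_1d 0 T (fun t => mkposreal _ (Hq t))) as [d Hd].
  exists d. split; [apply cond_pos|]. intros t Ht h Hh.
  (* [compactness_value_1d] delivers the covering point only under a double negation. *)
  apply NNPP. intros NN. apply (Hd t Ht). intros [x [Hx [H1 H2]]]. apply NN. clear NN.
  simpl in H1, H2.
  assert (B0 : (dl x / (1 + Cmod v) * (1 + Cmod v) = dl x)%R) by (field; lra).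
  assert (B1 : (Cmod (U + RtoC t * v - (U + RtoC x * v)) < dl x)%R).
  { replace (U + RtoC t * v - (U + RtoC x * v)) with (RtoC (t - x) * v)
      by (rewrite RtoC_minus; ring).
    rewrite Cmod_mult, Cmod_R. assert (P := Rabs_pos (t - x)). nra. }
  assert (B2 : (Cmod h < dl x)%R).
  { eapply Rlt_le_trans; [exact Hh|]. eapply Rle_trans; [exact H2|].
    rewrite <- B0 at 2. assert (P := Hq x). nra. }
  set (V := U + RtoC t * v) in *.
  assert (B : forall y, (0 <= y <= 1)%R -> cder F (V + RtoC y * h) (F' (V + RtoC y * h)) /\
    (Cmod (F' (V + RtoC y * h)%C - F' V) <= e)%R).
  { intros y Hy. destruct (Hdl x Hx (V + RtoC y * h)) as [A1 A2].
    - replace (V + RtoC y * h - (U + RtoC x * v)) with ((V - (U + RtoC x * v)) + RtoC y * h) by ring.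
      eapply Rle_lt_trans; [apply Cmod_triangle|]. rewrite (Cmod_mult (RtoC y)), Cmod_R, Rabs_pos_eq by lra.
      assert (P := Cmod_ge_0 h). nra.
    - split; auto. destruct (Hdl x Hx V) as [_ A3]; [generalize (cond_pos (dl x)); lra|].
      replace (F' (V + RtoC y * h) - F' V) with
        ((F' (V + RtoC y * h) - F' (U + RtoC x * v)) - (F' V - F' (U + RtoC x * v))) by ring.
      replace e with (e/2 + e/2)%R by lra. apply Cmod_minus_le; lra. }
  assert (M := mvi (fun y => F (V + RtoC y * h) - RtoC y * (F' V * h))
    (fun y => h * F' (V + RtoC y * h) - F' V * h) (fun y => e * Cmod h * y)%R (fun _ => e * Cmod h)%R 0 1).
  simpl in M.
  replace (F (V + h) - F V - F' V * h) with
    (F (V + 1 * h) - 1 * (F' V * h) - (F (V + 0 * h) - 0 * (F' V * h))).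
  2: { rewrite Cmult_1_l, Cmult_0_l, Cplus_0_r. ring. }
  replace (e * Cmod h)%R with (e * Cmod h * 1 - e * Cmod h * 0)%R by ring.
  apply M; [lra| | |].
  - intros y Hy. apply rder_minus; [apply cder_rder; now apply B|].
    eapply rder_eq; [apply rder_mult; [apply rder_id|apply rder_const]|]. cbv beta; ring.
  - intros y Hy. auto_derive; auto. ring.
  - intros y Hy. replace (h * F' (V + RtoC y * h) - F' V * h) with
      ((F' (V + RtoC y * h) - F' V) * h) by ring.
    rewrite Cmod_mult. apply Rmult_le_compat_r; [apply Cmod_ge_0|]. now apply B.
Qed.

(** * A priori bounds and limits *)

Lemma Rpower_pos (x a : R) : (0 < Rpower x a)%R.
Proof. apply exp_pos. Qed.

Lemma Rpower_anti (x y a : R) : (0 < x <= y)%R -> (a <= 0)%R -> (Rpower y a <= Rpower x a)%R.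
Proof.
  intros H Ha. unfold Rpower. destruct (Req_dec (a * ln y) (a * ln x)) as [E|N];
    [rewrite E; lra|left; apply exp_increasing].
  assert (ln x <= ln y)%R by (apply ln_le; lra). nra.
Qed.

Lemma Rpower_1_anti (x a b : R) : (1 <= x)%R -> (b <= a)%R -> (Rpower x b <= Rpower x a)%R.
Proof.
  intros H Hab. destruct H as [H|<-].
  - now apply Rle_Rpower; [lra|].
  - unfold Rpower. rewrite ln_1, !Rmult_0_r. lra.
Qed.

Lemma le_of_exp_decay (x A B c : R) :
  (0 < c)%R -> (forall T, (0 <= T)%R -> (x <= A + B * exp (- (c * T)))%R) -> (x <= A)%R.
Proof.
  intros Hc H. apply le_epsilon. intros e He.
  (* For this [T], [exp (c T) >= 1 + c T > |B| / e], so the second term is at most [e]. *)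
  set (T := (Rabs B / (e * c))%R).
  assert (Hec : (0 < e * c)%R) by nra.
  assert (HT : (0 <= T)%R) by (apply Rcomplements.Rdiv_le_0_compat; [apply Rabs_pos|lra]).
  apply Rle_trans with (1 := H T HT). apply Rplus_le_compat_l.
  assert (E : (1 + c * T <= exp (c * T))%R) by apply exp_ineq1_le.
  assert (Ex := exp_pos (c * T)). rewrite exp_Ropp.
  apply Rmult_le_reg_r with (exp (c * T)); auto. rewrite Rmult_assoc, Rinv_l by lra.
  assert (F : (e * (c * T) = Rabs B)%R) by (unfold T; field; lra).
  generalize (Rle_abs B). nra.
Qed.

Lemma le_of_power_decay (x A B a q : R) :
  (0 < q)%R -> (0 < a)%R -> (forall T, (0 <= T)%R -> (x <= A + B * Rpower (a + T) (- q))%R) ->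
  (x <= A)%R.
Proof.
  intros Hq Ha H. apply (le_of_exp_decay x A (B * Rpower a (- q)) q); auto.
  intros s Hs. assert (E := exp_ineq1_le s).
  (* The substitution [a + T = a exp s] turns power decay of order [q] into exponential decay of
     rate [q]. *)
  generalize (H (a * exp s - a)%R ltac:(nra)).
  replace (a + (a * exp s - a))%R with (a * exp s)%R by ring.
  unfold Rpower. rewrite ln_mult, ln_exp by (auto using exp_pos).
  rewrite Rmult_plus_distr_l, exp_plus.
  replace (- q * s)%R with (- (q * s))%R by ring. lra.
Qed.

Lemma is_derive_Rpower_shift (a p t : R) :
  (0 < a + t)%R -> is_derive (fun x => Rpower (a + x) p) t (p * Rpower (a + t) (p - 1))%R.
Proof.
  intros H. rewrite is_derive_Reals.
  replace (p * Rpower (a + t) (p - 1))%R with (p * Rpower (a + t) (p - 1) * (0 + 1))%R by ring.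
  apply (derivable_pt_lim_comp (fun x => a + x)%R (fun x => Rpower x p)).
  - apply derivable_pt_lim_plus; [apply derivable_pt_lim_const|apply derivable_pt_lim_id].
  - now apply derivable_pt_lim_power.
Qed.

Lemma Cmod_cexp (z : C) : Cmod (cexp z) = exp (Re z).
Proof. apply Cmod_polar. left. apply exp_pos. Qed.

Lemma cexp_0 : cexp 0 = 1.
Proof. unfold cexp. simpl. rewrite exp_0, cos_0, sin_0. unfold RtoC. f_equal; ring. Qed.

Lemma cexp_plus (a b : C) : cexp (a + b) = cexp a * cexp b.
Proof.
  unfold cexp, Cmult. destruct a, b; simpl. rewrite exp_plus, cos_plus, sin_plus. f_equal; ring.
Qed.

(** The summand 0 makes this literally the case [a = 0] of [rder_cexp]. *)
Definition kexp (b : C) (t : R) : C := cexp (0 + RtoC t * b).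

Lemma kexp_0 (b : C) : kexp b 0 = 1.
Proof. unfold kexp. rewrite Cmult_0_l, Cplus_0_l. apply cexp_0. Qed.

Lemma rder_kexp (b : C) (t : R) : rder (kexp b) t (b * kexp b t).
Proof. apply rder_cexp. Qed.

Lemma Cmod_kexp (b : C) (t : R) : Cmod (kexp b t) = exp (t * Re b).
Proof. unfold kexp. rewrite Cmod_cexp. f_equal. destruct b; simpl; ring. Qed.

(** A priori bounds: variation of constants from infinity. *)
Lemma apriori_exp (y h : R -> C) (mu : C) (c Q B : R) :
  (0 < c <= Re mu)%R ->
  (forall t, (0 <= t)%R -> rder y t (mu * y t + h t)) ->
  (forall t, (0 <= t)%R -> (Cmod (h t) <= Q)%R) ->
  (forall t, (0 <= t)%R -> (Cmod (y t) <= B)%R) ->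
  (Cmod (y 0%R) <= Q / c)%R.
Proof.
  intros Hc Hy Hh HB.
  assert (Q0 : (0 <= Q)%R) by (generalize (Hh 0%R ltac:(lra)) (Cmod_ge_0 (h 0%R)); lra).
  apply (le_of_exp_decay _ _ B c); [lra|]. intros T HT.
  assert (E0 : forall t, (0 <= t)%R -> (Cmod (kexp (- mu) t) <= exp (- (c * t)))%R).
  { intros t Ht. rewrite Cmod_kexp. replace (Re (- mu)) with (- Re mu)%R by reflexivity.
    destruct (Req_dec (t * - Re mu) (- (c * t))) as [E|N]; [rewrite E; lra|].
    left. apply exp_increasing. nra. }
  (* After multiplication by [exp (- mu t)] only the source remains in the derivative, and its
     integral is at most [Q / c]. The boundary term at [T] vanishes in the limit because [y] is
     bounded; [B] does not enter the result. *)
  assert (M := mvi (fun t => kexp (- mu) t * y t) (fun t => kexp (- mu) t * h t)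
    (fun t => - (Q / c) * exp (- (c * t)))%R (fun t => Q * exp (- (c * t)))%R 0 T HT).
  assert (M' := M ltac:(
    intros t Ht; eapply rder_eq; [apply rder_mult; [apply rder_kexp|apply Hy; lra]|];
    cbv beta; ring) ltac:(intros t Ht; auto_derive; auto; field; lra)
    ltac:(intros t Ht; cbv beta; rewrite (Rmult_comm Q); apply Cmod_mult_le; [apply E0|apply Hh]; lra)).
  clear M. cbv beta in M'. rewrite kexp_0, Cmult_1_l, Rmult_0_r, Ropp_0, exp_0 in M'.
  assert (B1 : (Cmod (kexp (- mu) T * y T) <= exp (- (c * T)) * B)%R).
  { apply Cmod_mult_le; auto. }
  generalize (Cmod_triangle_inv (y 0%R) (kexp (- mu) T * y T)).
  rewrite Cmod_minus_sym.
  assert (P := exp_pos (- (c * T))).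
  assert (Qc : (0 <= Q / c)%R) by (apply Rcomplements.Rdiv_le_0_compat; lra). nra.
Qed.

(** Without an exponential factor boundedness no longer selects the solution, but decay of any order
    [q] at infinity does. Neither [q] nor [B] appears in the conclusion, so a crude decay is
    upgraded to the one dictated by the source. *)
Lemma apriori_power (y h : R -> C) (a p q Q B : R) :
  (0 < a)%R -> (0 < p)%R -> (0 < q)%R ->
  (forall t, (0 <= t)%R -> rder y t (h t)) ->
  (forall t, (0 <= t)%R -> (Cmod (h t) <= Q * Rpower (a + t) (- p - 1))%R) ->
  (forall t, (0 <= t)%R -> (Cmod (y t) <= B * Rpower (a + t) (- q))%R) ->
  (Cmod (y 0%R) <= Q / p * Rpower a (- p))%R.
Proof.
  intros Ha Hp Hq Hy Hh HB.
  apply (le_of_power_decay _ _ B a q); auto. intros T HT.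
  assert (M := mvi y h (fun t => - (Q / p) * Rpower (a + t) (- p))%R
    (fun t => Q * Rpower (a + t) (- p - 1))%R 0 T HT).
  assert (M' := M ltac:(intros; apply Hy; lra)
    ltac:(intros t Ht; eapply is_derive_ext; [intros; reflexivity|];
      replace (Q * Rpower (a + t) (- p - 1))%R with
       ((- (Q / p)) * (- p * Rpower (a + t) (- p - 1)))%R by (field; lra);
      apply (is_derive_scal (fun t => Rpower (a + t) (- p)));
      apply is_derive_Rpower_shift; lra) ltac:(intros; apply Hh; lra)).
  clear M. cbv beta in M'. rewrite Rplus_0_r in M'. specialize (HB T HT).
  generalize (Cmod_triangle_inv (y 0%R) (y T)). rewrite Cmod_minus_sym.
  assert (Q0 : (0 <= Q)%R).
  { generalize (Hh 0%R ltac:(lra)) (Cmod_ge_0 (h 0%R)) (Rpower_pos (a + 0) (- p - 1)). nra. }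
  assert (Qp : (0 <= Q / p)%R) by (apply Rcomplements.Rdiv_le_0_compat; lra).
  generalize (Rpower_pos (a + T) (- p)). nra.
Qed.

(** * Complex limits with explicit rates *)

Lemma is_lim_seq_power_decay (q : R) :
  (0 < q)%R -> is_lim_seq (fun n => Rpower (1 + INR n) (- q)) 0.
Proof.
  intros Hq. apply is_lim_seq_Reals. intros e He.
  destruct (nfloor_ex (Rpower e (- / q))) as [N [_ HN]]; [left; apply Rpower_pos|].
  exists N. intros n Hn. unfold R_dist. rewrite Rminus_0_r, Rabs_pos_eq by (left; apply Rpower_pos).
  apply Rlt_le_trans with (Rpower (Rpower e (- / q)) (- q)).
  - assert (P := Rpower_pos e (- / q)). assert (L : (Rpower e (- / q) < 1 + INR n)%R).
    { apply le_INR in Hn. lra. }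
    unfold Rpower at 1 2. apply exp_increasing.
    assert (ln (Rpower e (- / q)) < ln (1 + INR n))%R by (apply ln_increasing; lra). nra.
  - rewrite Rpower_mult. replace (- / q * - q)%R with 1%R by (field; lra).
    rewrite Rpower_1 by auto. lra.
Qed.

Lemma complex_cauchy (u : nat -> C) (eps : nat -> R) :
  is_lim_seq eps 0 -> (forall n m, (n <= m)%nat -> (Cmod (u m - u n) <= eps n)%R) ->
  exists l, forall n, (Cmod (l - u n) <= eps n)%R.
Proof.
  intros He Hu. apply is_lim_seq_Reals in He.
  assert (K : forall e : R, (0 < e)%R -> exists N, forall n, (N <= n)%nat -> (eps n < e)%R).
  { intros e H. destruct (He e H) as [N HN]. exists N. intros n Hn. specialize (HN n Hn).
    unfold R_dist in HN. rewrite Rminus_0_r in HN. apply Rabs_def2 in HN. lra. }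
  (* Real and imaginary part are treated together as 1-Lipschitz real functions. *)
  assert (CC : forall p : C -> R, (forall a b, (Rabs (p a - p b) <= Cmod (a - b))%R) ->
    exists l : R, is_lim_seq (fun n => p (u n)) l).
  { intros p Hp. destruct (proj2 (ex_lim_seq_cauchy_corr (fun n => p (u n)))) as [l Hl].
    - intros e. destruct (K (e / 2)%R) as [N HN]; [generalize (cond_pos e); lra|].
      exists N. intros n m Hn Hm. eapply Rle_lt_trans; [apply Hp|].
      replace (u n - u m) with ((u n - u N) - (u m - u N)) by ring.
      assert (A := Hu N n Hn). assert (B := Hu N m Hm). specialize (HN N (Nat.le_refl N)).
      generalize (Cmod_minus_le _ _ _ _ A B). lra.
    - exists l. exact Hl. }
  destruct (CC Re) as [a Ha].
  { intros x y. replace (Re x - Re y)%R with (Re (x - y)) by reflexivity. apply re_le_Cmod. }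
  destruct (CC Im) as [b Hb].
  { intros x y. replace (Im x - Im y)%R with (Im (x - y)) by reflexivity. apply im_le_Cmod. }
  exists (a, b). intros n. apply le_epsilon. intros e H.
  apply is_lim_seq_Reals in Ha. apply is_lim_seq_Reals in Hb.
  destruct (Ha (e/2)%R ltac:(lra)) as [N1 H1]. destruct (Hb (e/2)%R ltac:(lra)) as [N2 H2].
  set (m := Nat.max n (Nat.max N1 N2)).
  specialize (H1 m ltac:(unfold m; lia)). specialize (H2 m ltac:(unfold m; lia)).
  assert (A := Hu n m ltac:(unfold m; lia)).
  replace ((a, b) - u n) with (((a, b) - u m) + (u m - u n)) by ring.
  rewrite Rplus_comm. apply Cmod_triangle_le; auto.
  eapply Rle_trans; [apply Cmod_le_ReIm|]. unfold R_dist in *.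
  replace (Re ((a, b) - u m)) with (- (Re (u m) - a))%R by (unfold Re; simpl; ring).
  replace (Im ((a, b) - u m)) with (- (Im (u m) - b))%R by (unfold Im; simpl; ring).
  rewrite !Rabs_Ropp. lra.
Qed.

(** Continuity of the derivative is carried as data: the uniform expansion along segments and the
    passage to the limit both rely on it. *)
Definition hol (D : C -> Prop) (f : C -> C) :=
  exists f' : C -> C, forall z, D z -> cder f z (f' z) /\ ccont f' z.

Lemma ccont_unif_limit (D : C -> Prop) (g : nat -> C -> C) (G : C -> C) (eps : nat -> R) (z : C) :
  copen D -> is_lim_seq eps 0 -> D z ->
  (forall n w, D w -> (Cmod (g n w - G w) <= eps n)%R) ->
  (forall n, ccont (g n) z) -> ccont G z.
Proof.
  intros Ho He Hz Hg Hc e Pe. apply is_lim_seq_Reals in He.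
  destruct (He (e/3)%R ltac:(lra)) as [N HN]. specialize (HN N (Nat.le_refl N)).
  unfold R_dist in HN. rewrite Rminus_0_r in HN. apply Rabs_def2 in HN.
  generalize (near_and _ _ _ (Ho z Hz) (Hc N (e/3)%R ltac:(lra))). apply near_mono.
  intros w [Dw Hw].
  replace (G w - G z) with ((g N w - g N z) - ((g N w - G w) - (g N z - G z))) by ring.
  assert (A := Hg N w Dw). assert (B := Hg N z Hz).
  generalize (Cmod_minus_le _ _ _ _ (Rlt_le _ _ Hw) (Cmod_minus_le _ _ _ _ A B)). lra.
Qed.

(** Replaces Weierstrass' theorem: here the derivatives are known to converge. *)
Lemma hol_limit (D : C -> Prop) (f g : nat -> C -> C) (F G : C -> C) (eps : nat -> R) :
  copen D -> is_lim_seq eps 0 ->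
  (forall n z, D z -> cder (f n) z (g n z) /\ ccont (g n) z) ->
  (forall n z, D z -> (Cmod (f n z - F z) <= eps n)%R) ->
  (forall n z, D z -> (Cmod (g n z - G z) <= eps n)%R) ->
  forall z, D z -> cder F z (G z) /\ ccont G z.
Proof.
  intros Ho He Hf HF HG z Hz.
  assert (CG : ccont G z).
  { apply (ccont_unif_limit D g G eps z); auto. intros n. now apply Hf. }
  split; auto. apply cder_spec. intros e Pe.
  destruct (near_and _ _ _ (Ho z Hz) (CG (e/2)%R ltac:(lra))) as [d [Hd K]].
  exists d. split; auto. intros w Hw.
  apply is_lim_seq_Reals in He. set (h := w - z) in *. assert (Ph := Cmod_ge_0 h).
  (* The increment [h] is fixed before [n], so the error [eps n] disappears as [n] grows while the
     radius [d] comes from [G] alone. *)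
  assert (A : forall n, (Cmod (f n w - f n z - G z * h) <= (eps n + e/2) * Cmod h)%R).
  { intros n.
    assert (M := mvi (fun y => f n (z + RtoC y * h) - RtoC y * (G z * h))
      (fun y => h * g n (z + RtoC y * h) - G z * h)
      (fun y => (eps n + e/2) * Cmod h * y)%R (fun _ => (eps n + e/2) * Cmod h)%R 0 1).
    simpl in M.
    replace (f n w - f n z - G z * h) with
      (f n (z + 1 * h) - 1 * (G z * h) - (f n (z + 0 * h) - 0 * (G z * h))).
    2: { rewrite Cmult_1_l, Cmult_0_l, Cplus_0_r. replace (z + h) with w by (unfold h; ring). ring. }
    replace ((eps n + e/2) * Cmod h)%R with ((eps n + e/2) * Cmod h * 1 - (eps n + e/2) * Cmod h * 0)%R by ring.
    assert (B : forall y, (0 <= y <= 1)%R -> D (z + RtoC y * h) /\ (Cmod (G (z + RtoC y * h)%C - G z) < e/2)%R).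
    { intros y Hy. apply K. replace (z + RtoC y * h - z) with (RtoC y * h) by ring.
      rewrite Cmod_mult, Cmod_R, Rabs_pos_eq by lra. nra. }
    apply M; [lra| | |].
    - intros y Hy. apply rder_minus; [apply cder_rder; now apply Hf, B|].
      eapply rder_eq; [apply rder_mult; [apply rder_id|apply rder_const]|]. cbv beta; ring.
    - intros y Hy. auto_derive; auto. ring.
    - intros y Hy. replace (h * g n (z + RtoC y * h) - G z * h) with
       (((g n (z + RtoC y * h) - G (z + RtoC y * h)) + (G (z + RtoC y * h) - G z)) * h) by ring.
      rewrite Cmod_mult. apply Rmult_le_compat_r; auto.
      destruct (B y Hy) as [B1 B2]. apply Cmod_triangle_le; [now apply HG|lra]. }
  apply le_epsilon. intros e' Pe'.
  destruct (He (e' / (Cmod h + 2))%R) as [n Hn]; [apply Rdiv_lt_0_compat; lra|].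
  specialize (Hn n (Nat.le_refl n)). unfold R_dist in Hn. rewrite Rminus_0_r in Hn.
  apply Rabs_def2 in Hn.
  assert (Hn' : (eps n * (Cmod h + 2) <= e')%R).
  { replace e' with (e' / (Cmod h + 2) * (Cmod h + 2))%R by (field; lra).
    apply Rmult_le_compat_r; lra. }
  assert (Dw : D w) by now apply K.
  replace (F w - F z - G z * h) with
    ((f n w - f n z - G z * h) - ((f n w - F w) - (f n z - F z))) by ring.
  generalize (Cmod_minus_le _ _ _ _ (A n) (Cmod_minus_le _ _ _ _ (HF n w Dw) (HF n z Hz))). nra.
Qed.

(** * Linear equations solved along a ray *)

(** The second half excludes rays that approach the origin: the modulus grows linearly with no
    cancellation, so powers of [|U|] can be integrated along the ray. *)
Definition ray_closed (D : C -> Prop) (c1 : R) (v : C) :=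
  forall U t, D U -> (0 <= t)%R ->
    D (U + RtoC t * v) /\ (c1 * (Cmod U + t) <= Cmod (U + RtoC t * v))%R.

Section Solve.
Variables (D : C -> Prop) (lam v : C) (c1 K : R) (F F' : C -> C).
Hypothesis Ho : copen D.
Hypothesis Hc1 : (0 < c1)%R.
Hypothesis Hray : ray_closed D c1 v.
Hypothesis H1 : forall U, D U -> (1 <= Cmod U)%R.
Hypothesis Hlam : (0 <= Re (lam * v))%R.
Hypothesis HF : forall U, D U -> cder F U (F' U) /\ ccont F' U.
Hypothesis HK : forall U, D U -> (Cmod (F U) <= K * Rpower (Cmod U) (-4/3))%R.

Let b : C := - (lam * v).
(** Truncation at [T] of the solution [- v] times the integral over [t >= 0] of
    [exp (- lam v t) F (U + t v)]. The function [H] below is its derivative in [U], already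
    integrated by parts: [F'] has disappeared, and as [T] grows [H] tends to [lam g + F], which is
    the differential equation. *)
Let G (T : R) (U : C) : C := prim (fun t => - v * (kexp b t * F (U + RtoC t * v))) T.
Let H (T : R) (U : C) : C := lam * G T U + F U - kexp b T * F (U + RtoC T * v).
Let M : R := (Cmod v * (K * Rpower c1 (-4/3)))%R.

Lemma rder_F_ray (U : C) (t : R) :
  D U -> (0 <= t)%R -> rder (fun x => F (U + RtoC x * v)) t (v * F' (U + RtoC t * v)).
Proof. intros HU Ht. apply cder_rder. apply HF. now apply Hray. Qed.

Lemma rder_G (U : C) (T : R) :
  D U -> (0 <= T)%R -> rder (fun T => G T U) T (- v * (kexp b T * F (U + RtoC T * v))).
Proof.
  intros HU HT. unfold G.
  apply (rder_prim (fun t => - v * (kexp b t * F (U + RtoC t * v)))); auto.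
  intros t Ht. eexists. apply rder_scal. apply rder_mult; [apply rder_kexp|].
  now apply rder_F_ray.
Qed.

Lemma Cmod_kexp_b (t : R) : (0 <= t)%R -> (Cmod (kexp b t) <= 1)%R.
Proof.
  intros Ht. rewrite Cmod_kexp, <- exp_0. unfold b.
  replace (Re (- (lam * v))) with (- Re (lam * v))%R by reflexivity.
  destruct (Req_dec (t * - Re (lam * v)) 0) as [E|N]; [rewrite E; lra|].
  left. apply exp_increasing. nra.
Qed.

Lemma rder_H (U : C) (T : R) :
  D U -> (0 <= T)%R -> rder (fun T => H T U) T (- v * (kexp b T * F' (U + RtoC T * v))).
Proof.
  intros HU HT. unfold H. eapply rder_eq.
  - apply rder_minus.
    + apply rder_plus; [apply rder_scal; now apply rder_G|apply rder_const].
    + apply rder_mult; [apply rder_kexp|now apply rder_F_ray].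
  - cbv beta. unfold b. ring.
Qed.

Lemma G_0 (U : C) : G 0 U = 0.
Proof. apply prim_0. Qed.

(** Differentiation under the integral sign by the mean value inequality in [T]: the derivative in
    [T] of the remainder [G T w - G T U - H T U * h] is a first-order remainder of [F], small
    uniformly on the segment. The tolerance [e'] compensates for the length [T |v|] of the
    segment. *)
Lemma cder_G (T : R) (U : C) : (0 <= T)%R -> D U -> cder (G T) U (H T U).
Proof.
  intros HT HU. apply cder_spec. intros e He. assert (Pv := Cmod_ge_0 v).
  set (e' := (e / (1 + T * Cmod v))%R).
  assert (HTv : (0 <= T * Cmod v)%R) by nra.
  assert (He' : (0 < e')%R) by (apply Rdiv_lt_0_compat; lra).
  destruct (segment_uniform_derivative F F' U v T) with (e := e') as [d [Hd Hu]]; auto.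
  { intros t [Ht _]. split.
    - generalize (Ho _ (proj1 (Hray U t HU Ht))). apply near_mono. intros w Hw. now apply HF.
    - now apply HF, Hray. }
  destruct (near_and _ _ _ (Ho U HU) (ex_intro _ d (conj Hd (fun w Hw => Hw)))) as [d' [Hd' K']].
  exists d'. split; auto. intros w Hw. destruct (K' w Hw) as [Dw Hwd].
  set (h := w - U) in *. assert (Ph := Cmod_ge_0 h).
  assert (Mv := mvi (fun T => G T w - G T U - H T U * h)
    (fun T => - v * (kexp b T * (F (U + RtoC T * v + h) - F (U + RtoC T * v) - F' (U + RtoC T * v) * h)))
    (fun T => Cmod v * (e' * Cmod h) * T)%R (fun _ => Cmod v * (e' * Cmod h))%R 0 T HT).
  cbv beta in Mv. rewrite !G_0 in Mv.
  assert (H00 : H 0 U = 0).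
  { unfold H. rewrite G_0, kexp_0, Cmult_0_l, Cplus_0_r. ring. }
  rewrite H00 in Mv.
  replace (G T w - G T U - H T U * h - (0 - 0 - 0 * h)) with (G T w - G T U - H T U * h) in Mv by ring.
  apply Rle_trans with (Cmod v * (e' * Cmod h) * T - Cmod v * (e' * Cmod h) * 0)%R.
  - apply Mv.
    + intros t Ht. eapply rder_eq.
      * apply rder_minus; [apply rder_minus; apply rder_G; auto; lra|].
        apply rder_mult; [apply rder_H; auto; lra|apply rder_const].
      * cbv beta. replace (w + RtoC t * v) with (U + RtoC t * v + h) by (unfold h; ring). ring.
    + intros t Ht. auto_derive; auto. ring.
    + intros t Ht. apply Cmod_mult_le; [rewrite Cmod_opp; lra|].
      rewrite <- (Rmult_1_l (e' * Cmod h)). apply Cmod_mult_le; [apply Cmod_kexp_b; lra|].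
      now apply Hu.
  - assert (E : (e' * (1 + T * Cmod v) = e)%R) by (unfold e'; field; lra).
    rewrite <- E. nra.
Qed.

Lemma M_nonneg (U : C) : D U -> (0 <= M)%R.
Proof.
  intros HU. unfold M. assert (A := HK U HU). assert (B := Cmod_ge_0 (F U)).
  assert (P := Rpower_pos (Cmod U) (-4/3)). assert (Q := Rpower_pos c1 (-4/3)).
  assert (K0 : (0 <= K)%R) by nra. repeat apply Rmult_le_pos; auto using Cmod_ge_0; lra.
Qed.

Lemma F_ray_bound (U : C) (t : R) : D U -> (0 <= t)%R ->
  (Cmod (F (U + RtoC t * v)) <= K * Rpower c1 (-4/3) * Rpower (Cmod U + t) (-4/3))%R.
Proof.
  intros HU Ht. destruct (Hray U t HU Ht) as [A B].
  assert (K0 : (0 <= K)%R).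
  { generalize (HK U HU) (Cmod_ge_0 (F U)) (Rpower_pos (Cmod U) (-4/3)). nra. }
  eapply Rle_trans; [now apply HK|]. rewrite Rmult_assoc. apply Rmult_le_compat_l; auto.
  assert (P := H1 U HU).
  rewrite Rpower_mult_distr by lra. apply Rpower_anti; [|lra].
  split; [|exact B]. apply Rmult_lt_0_compat; lra.
Qed.

Lemma G_diff (U : C) (S T : R) : D U -> (0 <= S <= T)%R ->
  (Cmod (G T U - G S U) <= 3 * M * Rpower (Cmod U + S) (-1/3))%R.
Proof.
  intros HU HST. assert (P := H1 U HU). assert (M0 := M_nonneg U HU).
  (* The factor 3 appears because [-3 r^(-1/3)] is a primitive of [r^(-4/3)]. *)
  assert (Mv := mvi (fun T => G T U) (fun T => - v * (kexp b T * F (U + RtoC T * v)))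
    (fun t => -3 * M * Rpower (Cmod U + t) (-1/3))%R
    (fun t => M * Rpower (Cmod U + t) (-4/3))%R S T ltac:(lra)).
  cbv beta in Mv.
  eapply Rle_trans; [apply Mv|].
  - intros t Ht. apply rder_G; auto. lra.
  - intros t Ht.
    replace (M * Rpower (Cmod U + t) (-4/3))%R with
      (-3 * M * (-1/3 * Rpower (Cmod U + t) (-1/3 - 1)))%R
      by (replace (-1/3 - 1)%R with (-4/3)%R by lra; field).
    apply (is_derive_scal (fun t => Rpower (Cmod U + t) (-1/3))).
    apply is_derive_Rpower_shift. lra.
  - intros t Ht. unfold M. rewrite Rmult_assoc.
    apply Cmod_mult_le; [rewrite Cmod_opp; lra|].
    rewrite <- (Rmult_1_l (K * _ * _)). apply Cmod_mult_le; [apply Cmod_kexp_b; lra|].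
    apply F_ray_bound; auto. lra.
  - generalize (Rpower_pos (Cmod U + T) (-1/3)). nra.
Qed.

Lemma solve_linear_aux :
  exists g : C -> C,
    (forall U, D U -> cder g U (lam * g U + F U)) /\
    (forall U, D U -> (Cmod (g U) <= 3 * M * Rpower (Cmod U) (-1/3))%R).
Proof.
  (* Limits are taken along integer truncations; outside [D] the value is arbitrary. The rate uses
     [1 + n] in place of [|U| + n] so as to be uniform on [D]. *)
  assert (Hlim : forall U, exists l, D U -> forall n : nat,
    (Cmod (l - G (INR n) U) <= 3 * M * Rpower (1 + INR n) (-1/3))%R).
  { intros U. destruct (excluded_middle_informative (D U)) as [HU|N]; [|exists (RtoC 0); tauto].
    assert (M0 := M_nonneg U HU). assert (P := H1 U HU).
    destruct (complex_cauchy (fun n => G (INR n) U) (fun n => 3 * M * Rpower (1 + INR n) (-1/3))%R) as [l Hl].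
    - replace 0%R with (3 * M * 0)%R by ring.
      apply (is_lim_seq_scal_l (fun n => Rpower (1 + INR n) (-1/3)) (3 * M) 0).
      replace (-1/3)%R with (- (1/3))%R by lra. apply is_lim_seq_power_decay. lra.
    - intros n m Hnm. eapply Rle_trans; [apply G_diff; auto; split; [apply pos_INR|now apply le_INR]|].
      apply Rmult_le_compat_l; [lra|]. apply Rpower_anti; [|lra].
      generalize (pos_INR n). lra.
    - exists l. auto. }
  set (g := fun U => proj1_sig (constructive_indefinite_description _ (Hlim U))).
  assert (Hg : forall U, D U -> forall n, (Cmod (g U - G (INR n) U) <= 3 * M * Rpower (1 + INR n) (-1/3))%R).
  { intros U HU n. unfold g. destruct (constructive_indefinite_description _ (Hlim U)); auto. }
  exists g. split.
  - intros U HU.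
    assert (M0 := M_nonneg U HU).
    assert (K0 : (0 <= K * Rpower c1 (-4/3))%R).
    { generalize (HK U HU) (Cmod_ge_0 (F U)) (Rpower_pos (Cmod U) (-4/3)) (Rpower_pos c1 (-4/3)). nra. }
    (* One rate for both convergences required by [hol_limit]: the first summand serves the
       functions, the other two the two parts of [H - (lam g + F)]. *)
    set (C0 := (3 * M + 3 * M * Cmod lam + K * Rpower c1 (-4/3))%R).
    assert (Pl := Cmod_ge_0 lam).
    assert (Q1 : (0 <= 3 * M * Cmod lam)%R) by (apply Rmult_le_pos; lra).
    apply (hol_limit D (fun n => G (INR n)) (fun n => H (INR n)) g (fun U => lam * g U + F U)
      (fun n => C0 * Rpower (1 + INR n) (-1/3))%R); auto.
    + replace 0%R with (C0 * 0)%R by ring.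
      apply (is_lim_seq_scal_l (fun n => Rpower (1 + INR n) (-1/3)) C0 0).
      replace (-1/3)%R with (- (1/3))%R by lra. apply is_lim_seq_power_decay. lra.
    + intros n z Hz. assert (Hn := pos_INR n). split; [now apply cder_G|].
      unfold H. repeat apply ccont_plus.
      * apply ccont_mult; [apply ccont_const|]. eapply cder_ccont. now apply cder_G.
      * eapply cder_ccont. now apply HF.
      * eapply cder_ccont. apply cder_opp. apply cder_mult; [apply cder_const|].
        apply (cder_comp F (fun w => w + RtoC (INR n) * v)).
        -- apply cder_plus; [apply cder_id|apply cder_const].
        -- apply HF. now apply Hray.
    + intros n z Hz. rewrite Cmod_minus_sym. eapply Rle_trans; [now apply Hg|].
      apply Rmult_le_compat_r; [left; apply Rpower_pos|]. unfold C0. lra.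
    + intros n z Hz. assert (Hn := pos_INR n). assert (Pz := H1 z Hz).
      assert (PR := Rpower_pos (1 + INR n) (-1/3)). unfold H.
      replace (lam * G (INR n) z + F z - kexp b (INR n) * F (z + RtoC (INR n) * v) - (lam * g z + F z))
        with (- (lam * (g z - G (INR n) z)) - kexp b (INR n) * F (z + RtoC (INR n) * v)) by ring.
      apply Rle_trans with (Cmod lam * (3 * M * Rpower (1 + INR n) (-1/3)) +
        1 * (K * Rpower c1 (-4/3) * Rpower (1 + INR n) (-1/3)))%R; [|unfold C0; nra].
      apply Cmod_minus_le.
      * rewrite Cmod_opp. apply Cmod_mult_le; [lra|now apply Hg].
      * apply Cmod_mult_le; [now apply Cmod_kexp_b|].
        eapply Rle_trans; [now apply F_ray_bound|]. apply Rmult_le_compat_l; auto.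
        apply Rle_trans with (Rpower (Cmod z + INR n) (-1/3)).
        -- apply Rpower_1_anti; lra.
        -- apply Rpower_anti; lra.
  - intros U HU. apply (le_of_power_decay _ _ (3 * M)%R 1 (1/3)); try lra.
    intros T HT. destruct (nfloor_ex T HT) as [n [_ Hn]].
    assert (M0 := M_nonneg U HU). assert (Hn' : (T <= INR (S n))%R) by (rewrite S_INR; lra).
    assert (A := Hg U HU (S n)). assert (B := G_diff U 0 (INR (S n)) HU ltac:(lra)).
    rewrite Rplus_0_r, G_0 in B.
    replace (g U) with ((G (INR (S n)) U - 0) + (g U - G (INR (S n)) U)) by ring.
    apply Cmod_triangle_le; [exact B|]. eapply Rle_trans; [exact A|].
    apply Rmult_le_compat_l; [lra|]. replace (-(1/3))%R with (-1/3)%R by lra.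
    apply Rpower_anti; lra.
Qed.

End Solve.

(** The exponent -4/3 makes the source integrable along any admissible ray, even when the
    exponential does not decay. The bound of order -1/3 is crude; it merely identifies [g] as a
    decaying solution, to which the a priori estimates then apply. *)
Lemma solve_linear (D : C -> Prop) (lam v : C) (c1 : R) :
  copen D -> (0 < c1)%R -> ray_closed D c1 v -> (forall U, D U -> (1 <= Cmod U)%R) ->
  (0 <= Re (lam * v))%R ->
  exists Cs : R, forall (F : C -> C) (K : R), hol D F ->
    (forall U, D U -> (Cmod (F U) <= K * Rpower (Cmod U) (-4/3))%R) ->
    exists g : C -> C,
      (forall U, D U -> cder g U (lam * g U + F U)) /\ hol D g /\
      (forall U, D U -> (Cmod (g U) <= Cs * K * Rpower (Cmod U) (-1/3))%R).
Proof.
  intros Ho Hc1 Hray H1 Hlam. exists (3 * Cmod v * Rpower c1 (-4/3))%R.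
  intros F K [F' HF] HK.
  destruct (solve_linear_aux D lam v c1 K F F' Ho Hc1 Hray H1 Hlam HF HK) as [g [Hg Hb]].
  exists g. split; auto. split.
  - exists (fun U => lam * g U + F U). intros U HU. split; auto.
    apply ccont_plus; [|eapply cder_ccont; now apply HF].
    apply ccont_mult; [apply ccont_const|]. eapply cder_ccont. now apply Hg.
  - intros U HU. eapply Rle_trans; [now apply Hb|]. right. ring.
Qed.

(** * Weighted Lipschitz estimates of the vector field *)

(** With [r = |U|^(1/3)] all exponents become integers, and comparing weights becomes a goal for
    [lia]. *)
Definition wt (n : Z) (r : R) : R := Rpower r (- IZR n).

Lemma wt_pos (n : Z) (r : R) : (0 < wt n r)%R.
Proof. apply Rpower_pos. Qed.

Lemma wt_add (n m : Z) (r : R) : wt (n + m) r = (wt n r * wt m r)%R.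
Proof. unfold wt. rewrite <- Rpower_plus, plus_IZR. f_equal. ring. Qed.

Lemma wt_le (n m : Z) (r : R) : (1 <= r)%R -> (m <= n)%Z -> (wt n r <= wt m r)%R.
Proof. intros H E. apply Rpower_1_anti; auto. apply IZR_le in E. lra. Qed.

Lemma wt_0 (r : R) : (0 < r)%R -> wt 0 r = 1%R.
Proof. intros H. unfold wt. rewrite Ropp_0. now apply Rpower_O. Qed.

Lemma wt_nat (n : nat) (r : R) : (0 < r)%R -> wt (Z.of_nat n) r = (/ r ^ n)%R.
Proof. intros H. unfold wt. now rewrite Rpower_Ropp, <- INR_IZR_INZ, Rpower_pow. Qed.

Lemma wt_neg_nat (n : nat) (r : R) : (0 < r)%R -> wt (- Z.of_nat n) r = (r ^ n)%R.
Proof.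
  intros H. unfold wt. now rewrite opp_IZR, Ropp_involutive, <- INR_IZR_INZ, Rpower_pow.
Qed.

Lemma wt_1 (r : R) : (0 < r)%R -> wt 1 r = (/ r)%R.
Proof. intros H. change 1%Z with (Z.of_nat 1). rewrite wt_nat by auto. f_equal. ring. Qed.

Definition dW (z z' : C3) : R := Cmod (Wc z - Wc z').
Definition dXY (z z' : C3) : R := (Cmod (Xc z - Xc z') + Cmod (Yc z - Yc z'))%R.

Lemma dW_pos (z z' : C3) : (0 <= dW z z')%R.
Proof. apply Cmod_ge_0. Qed.

Lemma dXY_pos (z z' : C3) : (0 <= dXY z z')%R.
Proof. unfold dXY. generalize (Cmod_ge_0 (Xc z - Xc z')) (Cmod_ge_0 (Yc z - Yc z')). lra. Qed.

(** Used with [(k, x)] equal to [(6, 3)] for the iteration, [(7, 4)] for the improved fixed point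
    and [(8, 4)] for the final bounds. *)
Definition in_ball (b : R) (k x : Z) (r : R) (z : C3) : Prop :=
  (Cmod (Wc z) <= b * wt k r)%R /\ (Cmod (Xc z) <= b * wt x r)%R /\ (Cmod (Yc z) <= b * wt x r)%R.

(** For [s = U^(1/3)] large and [z] in the weighted ball, [f s z] has size
    [O(|s|^-a)], Lipschitz constant [O(|s|^-l)] in [W] and [O(|s|^-m)] in [X, Y]. *)
Definition weighted_lip (b : R) (k x a l m : Z) (f : C -> C3 -> C) : Prop :=
  exists K rho : R, (0 <= K)%R /\ (1 <= rho)%R /\
  forall s, (rho <= Cmod s)%R -> forall z, in_ball b k x (Cmod s) z ->
    (Cmod (f s z) <= K * wt a (Cmod s))%R /\
    forall z', in_ball b k x (Cmod s) z' ->
      (Cmod (f s z - f s z') <= K * (wt l (Cmod s) * dW z z' + wt m (Cmod s) * dXY z z'))%R.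

Section WeightedLip.
Variables (b : R) (k x : Z).
Hypothesis b_pos : (0 <= b)%R.
Local Notation wlip := (weighted_lip b k x).

Lemma wlip_const (a l m : Z) (c : C) : (a <= 0)%Z -> wlip a l m (fun _ _ => c).
Proof.
  intros Ha. exists (Cmod c), 1%R. split; [apply Cmod_ge_0|]. split; [lra|].
  intros s Hs z Hz. split.
  - rewrite <- (Rmult_1_r (Cmod c)) at 1. apply Rmult_le_compat_l; [apply Cmod_ge_0|].
    rewrite <- (wt_0 (Cmod s)) by lra. now apply wt_le.
  - intros z' _. replace (c - c) with (RtoC 0) by ring. rewrite Cmod_0.
    apply Rmult_le_pos; [apply Cmod_ge_0|].
    generalize (wt_pos l (Cmod s)) (wt_pos m (Cmod s)) (dW_pos z z') (dXY_pos z z'). nra.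
Qed.

(** A function that does not involve [z] has zero variation, so its Lipschitz exponents may be
    chosen at will. *)
Lemma wlip_indep (a l m n : Z) (f : C -> C) :
  (forall s, (1 <= Cmod s)%R -> (Cmod (f s) <= wt n (Cmod s))%R) -> (a <= n)%Z ->
  wlip a l m (fun s _ => f s).
Proof.
  intros Hf Ha. exists 1%R, 1%R. split; [lra|]. split; [lra|].
  intros s Hs z Hz. split.
  - rewrite Rmult_1_l. eapply Rle_trans; [now apply Hf|]. now apply wt_le.
  - intros z' _. replace (f s - f s) with (RtoC 0) by ring. rewrite Cmod_0.
    generalize (wt_pos l (Cmod s)) (wt_pos m (Cmod s)) (dW_pos z z') (dXY_pos z z'). nra.
Qed.

Lemma wlip_sig (a l m : Z) (n : nat) : (a <= Z.of_nat n)%Z -> wlip a l m (fun s _ => (/ s) ^ n).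
Proof.
  intros H. apply (wlip_indep a l m (Z.of_nat n) (fun s => (/ s) ^ n)); auto.
  intros s Hs. assert (N : s <> 0) by (apply Cmod_gt_0; lra).
  rewrite wt_nat by lra. rewrite Cmod_pow, Cmod_inv by auto. right. now rewrite pow_inv.
Qed.

Lemma wlip_s (a l m : Z) (n : nat) : (a <= - Z.of_nat n)%Z -> wlip a l m (fun s _ => s ^ n).
Proof.
  intros H. apply (wlip_indep a l m (- Z.of_nat n) (fun s => s ^ n)); auto.
  intros s Hs. rewrite wt_neg_nat by lra. rewrite Cmod_pow. lra.
Qed.

Lemma wlip_W (a l m : Z) : (a <= k)%Z -> (l <= 0)%Z -> wlip a l m (fun _ z => Wc z).
Proof.
  intros Ha Hl. exists (b + 1)%R, 1%R. split; [lra|]. split; [lra|].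
  intros s Hs z [Hz _]. split.
  - eapply Rle_trans; [exact Hz|]. generalize (wt_pos k (Cmod s)) (wt_le k a (Cmod s) Hs Ha). nra.
  - intros z' _. change (Cmod (Wc z - Wc z')) with (dW z z').
    assert (P := wt_le 0 l (Cmod s) Hs Hl). rewrite wt_0 in P by lra.
    generalize (wt_pos m (Cmod s)) (dW_pos z z') (dXY_pos z z'). intros A B D.
    assert (0 <= wt m (Cmod s) * dXY z z')%R by (apply Rmult_le_pos; lra).
    assert (dW z z' <= wt l (Cmod s) * dW z z')%R by nra. nra.
Qed.

Lemma wlip_coord_XY (a l m : Z) (f : C3 -> C) : (a <= x)%Z -> (m <= 0)%Z ->
  (forall r z, in_ball b k x r z -> (Cmod (f z) <= b * wt x r)%R) ->
  (forall z z', (Cmod (f z - f z') <= dXY z z')%R) -> wlip a l m (fun _ z => f z).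
Proof.
  intros Ha Hl Hf Hd. exists (b + 1)%R, 1%R. split; [lra|]. split; [lra|].
  intros s Hs z Hz. split.
  - eapply Rle_trans; [apply Hf, Hz|].
    generalize (wt_pos x (Cmod s)) (wt_le x a (Cmod s) Hs Ha). nra.
  - intros z' _. assert (D0 := Hd z z').
    assert (P := wt_le 0 m (Cmod s) Hs Hl). rewrite wt_0 in P by lra.
    generalize (wt_pos l (Cmod s)) (dW_pos z z') (dXY_pos z z'). intros A B D.
    assert (0 <= wt l (Cmod s) * dW z z')%R by (apply Rmult_le_pos; lra).
    assert (dXY z z' <= wt m (Cmod s) * dXY z z')%R by nra. nra.
Qed.

Lemma wlip_X (a l m : Z) : (a <= x)%Z -> (m <= 0)%Z -> wlip a l m (fun _ z => Xc z).
Proof.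
  intros Ha Hm. apply wlip_coord_XY; auto; [intros r z Hz; apply Hz|].
  intros z z'. unfold dXY. generalize (Cmod_ge_0 (Yc z - Yc z')). lra.
Qed.

Lemma wlip_Y (a l m : Z) : (a <= x)%Z -> (m <= 0)%Z -> wlip a l m (fun _ z => Yc z).
Proof.
  intros Ha Hm. apply wlip_coord_XY; auto; [intros r z Hz; apply Hz|].
  intros z z'. unfold dXY. generalize (Cmod_ge_0 (Xc z - Xc z')). lra.
Qed.

Lemma wlip_plus (a l m : Z) (f g : C -> C3 -> C) :
  wlip a l m f -> wlip a l m g -> wlip a l m (fun s z => f s z + g s z).
Proof.
  intros [K [r [HK [Hr Hf]]]] [K' [r' [HK' [Hr' Hg]]]].
  exists (K + K')%R, (Rmax r r'). split; [lra|]. split; [eapply Rle_trans; [exact Hr|apply Rmax_l]|].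
  intros s Hs z Hz. generalize (Rmax_l r r') (Rmax_r r r'). intros M1 M2.
  destruct (Hf s ltac:(lra) z Hz) as [F1 F2]. destruct (Hg s ltac:(lra) z Hz) as [G1 G2]. split.
  - rewrite Rmult_plus_distr_r. now apply Cmod_triangle_le.
  - intros z' Hz'. rewrite Rmult_plus_distr_r.
    replace (f s z + g s z - (f s z' + g s z')) with ((f s z - f s z') + (g s z - g s z')) by ring.
    apply Cmod_triangle_le; auto.
Qed.

(** Product rule for weights: sizes add, and each Lipschitz exponent is the smaller of the two sums
    of a size with a Lipschitz exponent. The target exponents are left free below these, so that
    [lia] can check a declared table. *)
Lemma wlip_mult (a1 l1 m1 a2 l2 m2 a l m : Z) (f g : C -> C3 -> C) :
  wlip a1 l1 m1 f -> wlip a2 l2 m2 g ->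
  (a <= a1 + a2)%Z -> (l <= a1 + l2)%Z -> (l <= l1 + a2)%Z -> (m <= a1 + m2)%Z -> (m <= m1 + a2)%Z ->
  wlip a l m (fun s z => f s z * g s z).
Proof.
  intros [K [r [HK [Hr Hf]]]] [K' [r' [HK' [Hr' Hg]]]] E1 E2 E3 E4 E5.
  assert (KK : (0 <= K * K')%R) by now apply Rmult_le_pos.
  exists (2 * (K * K'))%R, (Rmax r r'). split; [lra|]. split; [eapply Rle_trans; [exact Hr|apply Rmax_l]|].
  intros s Hs z Hz. generalize (Rmax_l r r') (Rmax_r r r'). intros M1 M2.
  assert (S1 : (1 <= Cmod s)%R) by lra.
  destruct (Hf s ltac:(lra) z Hz) as [F1 F2]. destruct (Hg s ltac:(lra) z Hz) as [G1 G2].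
  generalize (wt_le _ _ _ S1 E1) (wt_le _ _ _ S1 E2) (wt_le _ _ _ S1 E3) (wt_le _ _ _ S1 E4) (wt_le _ _ _ S1 E5).
  rewrite !wt_add. intros W1 W2 W3 W4 W5.
  assert (Wa := wt_pos a (Cmod s)). split.
  - eapply Rle_trans; [apply Cmod_mult_le; eauto|].
    replace (K * wt a1 (Cmod s) * (K' * wt a2 (Cmod s)))%R with
      (K * K' * (wt a1 (Cmod s) * wt a2 (Cmod s)))%R by ring. nra.
  - intros z' Hz'. destruct (Hg s ltac:(lra) z' Hz') as [G1' _].
    replace (f s z * g s z - f s z' * g s z') with
      (f s z * (g s z - g s z') + (f s z - f s z') * g s z') by ring.
    eapply Rle_trans; [apply Cmod_triangle_le; apply Cmod_mult_le; eauto|].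
    assert (D1 := dW_pos z z'). assert (D2 := dXY_pos z z').
    set (A := Cmod s) in *.
    replace (K * wt a1 A * (K' * (wt l2 A * dW z z' + wt m2 A * dXY z z')) +
      K * (wt l1 A * dW z z' + wt m1 A * dXY z z') * (K' * wt a2 A))%R with
      (K * K' * ((wt a1 A * wt l2 A + wt l1 A * wt a2 A) * dW z z' +
        (wt a1 A * wt m2 A + wt m1 A * wt a2 A) * dXY z z'))%R by ring.
    replace (2 * (K * K') * (wt l A * dW z z' + wt m A * dXY z z'))%R with
      (K * K' * ((wt l A + wt l A) * dW z z' + (wt m A + wt m A) * dXY z z'))%R by ring.
    apply Rmult_le_compat_l; auto. apply Rplus_le_compat; apply Rmult_le_compat_r; lra.
Qed.

Lemma wlip_weaken (a1 l1 m1 a l m : Z) (f : C -> C3 -> C) :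
  wlip a1 l1 m1 f -> (a <= a1)%Z -> (l <= l1)%Z -> (m <= m1)%Z -> wlip a l m f.
Proof.
  intros [K [r [HK [Hr Hf]]]] E1 E2 E3. exists K, r. repeat split; auto; destruct (Hf s H z H0) as [A B].
  - eapply Rle_trans; [exact A|]. apply Rmult_le_compat_l; auto. apply wt_le; auto; lra.
  - intros z' Hz'. eapply Rle_trans; [now apply B|]. apply Rmult_le_compat_l; auto.
    apply Rplus_le_compat; apply Rmult_le_compat_r; auto using dW_pos, dXY_pos; apply wt_le; auto; lra.
Qed.

Lemma wlip_scal (a l m : Z) (c : C) (f : C -> C3 -> C) :
  wlip a l m f -> wlip a l m (fun s z => c * f s z).
Proof.
  intros [K [r [HK [Hr Hf]]]]. exists (Cmod c * K)%R, r. split; [apply Rmult_le_pos; auto using Cmod_ge_0|].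
  split; auto. intros s Hs z Hz. destruct (Hf s Hs z Hz) as [A B]. split.
  - rewrite Rmult_assoc. apply Cmod_mult_le; auto. lra.
  - intros z' Hz'. replace (c * f s z - c * f s z') with (c * (f s z - f s z')) by ring.
    rewrite Rmult_assoc. apply Cmod_mult_le; auto. lra.
Qed.

Lemma wlip_opp (a l m : Z) (f : C -> C3 -> C) : wlip a l m f -> wlip a l m (fun s z => - f s z).
Proof.
  intros [K [r [HK [Hr Hf]]]]. exists K, r. repeat split; auto; destruct (Hf s H z H0) as [A B].
  - now rewrite Cmod_opp.
  - intros z' Hz'. replace (- f s z - - f s z') with (- (f s z - f s z')) by ring.
    rewrite Cmod_opp. auto.
Qed.

Lemma wlip_minus (a l m : Z) (f g : C -> C3 -> C) :
  wlip a l m f -> wlip a l m g -> wlip a l m (fun s z => f s z - g s z).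
Proof. intros. apply wlip_plus; [|apply wlip_opp]; auto. Qed.

Lemma wlip_sig_mult (n : nat) (a1 l1 m1 a l m : Z) (f : C -> C3 -> C) :
  wlip a1 l1 m1 f -> (a <= a1 + Z.of_nat n)%Z -> (l <= l1 + Z.of_nat n)%Z -> (m <= m1 + Z.of_nat n)%Z ->
  wlip a l m (fun s z => (/ s) ^ n * f s z).
Proof.
  intros Hf E1 E2 E3.
  (* The exponents [l - a1] and [m - a1] given to the pure power of [s] are exactly those that make
     the product conditions trivial. *)
  apply (wlip_mult (Z.of_nat n) (l - a1) (m - a1) a1 l1 m1); auto; try lia.
  apply wlip_sig. lia.
Qed.

(** A positive decay exponent turns into smallness once [rho >= 2 K]; the bound 1/2 is what inverses
    and square roots of [1 + f] require. *)
Lemma wlip_small (a l m : Z) (f : C -> C3 -> C) : (1 <= a)%Z -> wlip a l m f ->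
  exists K rho : R, (0 <= K)%R /\ (1 <= rho)%R /\
  forall s, (rho <= Cmod s)%R -> forall z, in_ball b k x (Cmod s) z ->
    (Cmod (f s z) <= 1/2)%R /\ (Cmod (f s z) <= K * wt a (Cmod s))%R /\
    forall z', in_ball b k x (Cmod s) z' ->
      (Cmod (f s z - f s z') <= K * (wt l (Cmod s) * dW z z' + wt m (Cmod s) * dXY z z'))%R.
Proof.
  intros Ha [K [r [HK [Hr Hf]]]]. exists K, (Rmax r (2 * K)). split; auto.
  split; [eapply Rle_trans; [exact Hr|apply Rmax_l]|].
  intros s Hs z Hz. generalize (Rmax_l r (2 * K)) (Rmax_r r (2 * K)). intros M1 M2.
  destruct (Hf s ltac:(lra) z Hz) as [A B]. split; [|split; auto].
  eapply Rle_trans; [exact A|].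
  assert (L := wt_le a 1 (Cmod s) ltac:(lra) Ha). rewrite wt_1 in L by lra.
  apply Rle_trans with (K * / Cmod s)%R; [now apply Rmult_le_compat_l|].
  apply Rmult_le_reg_r with (Cmod s); [lra|]. rewrite Rmult_assoc, Rinv_l by lra. lra.
Qed.

Lemma half_le_1p (c : C) : (Cmod c <= 1/2)%R -> (1/2 <= Re (1 + c))%R.
Proof.
  intros H. generalize (re_le_Cmod c). intros A. assert (B := Rle_abs (- Re c)).
  rewrite Rabs_Ropp in B. change (Re (1 + c)) with (1 + Re c)%R. lra.
Qed.

Lemma inv_le_2 (c : C) : (1/2 <= Re c)%R -> c <> 0 /\ (Cmod (/ c) <= 2)%R.
Proof.
  intros H. assert (N : c <> 0) by (apply C_neq_Re; lra). split; auto.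
  rewrite Cmod_inv by auto. replace 2%R with (/ (1/2))%R by lra.
  apply Rinv_le_contravar; [lra|]. generalize (Re_le_Cmod' c). lra.
Qed.

Lemma inv_diff_le (c c' : C) : (1/2 <= Re c)%R -> (1/2 <= Re c')%R ->
  (Cmod (/ c - / c') <= 4 * Cmod (c - c'))%R.
Proof.
  intros H H'. destruct (inv_le_2 c H) as [N A]. destruct (inv_le_2 c' H') as [N' A'].
  replace (/ c - / c') with (/ c * / c' * - (c - c')) by (field; auto).
  rewrite Cmod_mult, Cmod_opp. apply Rmult_le_compat_r; [apply Cmod_ge_0|].
  replace 4%R with (2 * 2)%R by ring. now apply Cmod_mult_le.
Qed.

Lemma wlip_inv (a l m : Z) (g : C -> C3 -> C) :
  (1 <= a)%Z -> wlip a l m g -> wlip 0 l m (fun s z => / (1 + g s z)).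
Proof.
  intros Ha Hg. destruct (wlip_small a l m g Ha Hg) as [K [r [HK [Hr H]]]].
  exists (2 + 4 * K)%R, r. split; [lra|]. split; auto. intros s Hs z Hz.
  destruct (H s Hs z Hz) as [A [_ B]]. split.
  - rewrite wt_0 by lra. destruct (inv_le_2 _ (half_le_1p _ A)) as [_ L]. lra.
  - intros z' Hz'. destruct (H s Hs z' Hz') as [A' _]. specialize (B z' Hz').
    eapply Rle_trans; [apply inv_diff_le; now apply half_le_1p|].
    replace (1 + g s z - (1 + g s z')) with (g s z - g s z') by ring.
    generalize (wt_pos l (Cmod s)) (wt_pos m (Cmod s)) (dW_pos z z') (dXY_pos z z').
    intros. assert (0 <= wt l (Cmod s) * dW z z' + wt m (Cmod s) * dXY z z')%R by nra. nra.
Qed.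

(** For [q] the root, [(Re q)^2 >= Re (q^2) = Re (1 + c) >= 1/2] and [Re q > 0], whence
    [Re q >= 1/2]. *)
Lemma csqrt_1p (c : C) : (Cmod c <= 1/2)%R ->
  csqrt (1 + c) * csqrt (1 + c) = 1 + c /\ (1/2 <= Re (csqrt (1 + c)))%R.
Proof.
  intros H. assert (A := half_le_1p c H).
  assert (E := csqrt_sq (1 + c) ltac:(apply C_neq_Re; lra)). split; auto.
  assert (P := Re_csqrt_pos (1 + c) ltac:(lra)).
  assert (E' : (Re (csqrt (1 + c)) * Re (csqrt (1 + c)) - Im (csqrt (1 + c)) * Im (csqrt (1 + c)) = Re (1 + c))%R).
  { rewrite <- E at 5. reflexivity. }
  nra.
Qed.

(** Factor [q^2 - q'^2]; the sum [q + q'] has real part at least 1. *)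
Lemma csqrt_diff_le (c c' : C) : (Cmod c <= 1/2)%R -> (Cmod c' <= 1/2)%R ->
  (Cmod (csqrt (1 + c) - csqrt (1 + c')) <= Cmod (c - c'))%R.
Proof.
  intros H H'. destruct (csqrt_1p c H) as [E P]. destruct (csqrt_1p c' H') as [E' P'].
  set (q := csqrt (1 + c)) in *. set (q' := csqrt (1 + c')) in *.
  assert (L : (1 <= Cmod (q + q'))%R).
  { generalize (Re_le_Cmod' (q + q')). change (Re (q + q')) with (Re q + Re q')%R. lra. }
  replace (c - c') with ((q - q') * (q + q')).
  - rewrite Cmod_mult. generalize (Cmod_ge_0 (q - q')). nra.
  - transitivity (q * q - q' * q'); [ring|]. rewrite E, E'. ring.
Qed.

(** Subtracting 1 preserves the decay of [j]; the first component of the vector field depends on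
    it. *)
Lemma wlip_isqrt_m1 (a l m : Z) (j : C -> C3 -> C) :
  (1 <= a)%Z -> wlip a l m j -> wlip a l m (fun s z => / csqrt (1 + j s z) - 1).
Proof.
  intros Ha Hj. destruct (wlip_small a l m j Ha Hj) as [K [r [HK [Hr H]]]].
  exists (4 * K)%R, r. split; [lra|]. split; auto. intros s Hs z Hz.
  destruct (H s Hs z Hz) as [A [A' B]]. destruct (csqrt_1p _ A) as [E P]. split.
  - destruct (inv_le_2 _ P) as [N L].
    assert (D0 := csqrt_diff_le (j s z) 0 A ltac:(rewrite Cmod_0; lra)).
    (* The value follows from the square being 1 and the real part being positive, without
       evaluating [Arg]. *)
    assert (S1 : csqrt (1 + 0) = 1).
    { destruct (csqrt_1p 0 ltac:(rewrite Cmod_0; lra)) as [E1 P1].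
      assert (F : (csqrt (1 + 0) + 1) * (csqrt (1 + 0) - 1) = 0).
      { transitivity (csqrt (1 + 0) * csqrt (1 + 0) - 1); [ring|]. rewrite E1. ring. }
      apply (Cmult_eq_reg_l (csqrt (1 + 0) + 1)).
      - apply C_neq_Re. change (0 < Re (csqrt (1 + 0)) + 1)%R. lra.
      - transitivity ((csqrt (1 + 0) + 1) * (csqrt (1 + 0) - 1) + (csqrt (1 + 0) + 1) * 1); [ring|].
        rewrite F. ring. }
    rewrite S1 in D0. replace (j s z - 0) with (j s z) in D0 by ring.
    replace (/ csqrt (1 + j s z) - 1) with (/ csqrt (1 + j s z) * - (csqrt (1 + j s z) - 1)) by (field; auto).
    eapply Rle_trans; [apply Cmod_mult_le; [exact L|rewrite Cmod_opp; exact D0]|].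
    generalize (wt_pos a (Cmod s)). nra.
  - intros z' Hz'. destruct (H s Hs z' Hz') as [C' _]. specialize (B z' Hz').
    destruct (csqrt_1p _ C') as [E' P'].
    replace (/ csqrt (1 + j s z) - 1 - (/ csqrt (1 + j s z') - 1)) with
      (/ csqrt (1 + j s z) - / csqrt (1 + j s z')) by ring.
    eapply Rle_trans; [now apply inv_diff_le|].
    generalize (csqrt_diff_le _ _ A C'). lra.
Qed.

Lemma wlip_isqrt (a l m : Z) (j : C -> C3 -> C) :
  (1 <= a)%Z -> wlip a l m j -> wlip 0 l m (fun s z => / csqrt (1 + j s z)).
Proof.
  intros Ha Hj.
  destruct (wlip_plus 0 l m (fun _ _ => 1) (fun s z => / csqrt (1 + j s z) - 1)) as [K [r [HK [Hr H]]]].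
  - apply wlip_const. lia.
  - eapply wlip_weaken; [exact (wlip_isqrt_m1 a l m j Ha Hj)|lia..].
  - exists K, r. split; auto. split; auto. intros s Hs z Hz. destruct (H s Hs z Hz) as [A B].
    replace (1 + (/ csqrt (1 + j s z) - 1)) with (/ csqrt (1 + j s z)) in * by ring. split; auto.
    intros z' Hz'. specialize (B z' Hz').
    now replace (1 + (/ csqrt (1 + j s z') - 1)) with (/ csqrt (1 + j s z')) in B by ring.
Qed.

End WeightedLip.

(** With [U = s^3]: [Jh] is the paper's [J], [Jh_U] its derivative in [U] (not in [s]),
    [gh] and [fh1, fh2, fh3] the paper's [g] and [f], and [Rh1, Rh2, Rh3] the operator [R]. *)
Definition Jh (s : C) (z : C3) : C :=
  4/9 * ((/s)^2 * (Wc z * Wc z)) - 16/27 * ((/s)^4 * Wc z) + 16/81 * (/s)^6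
  + 4/9 * ((/s)^3 * ((Xc z + Yc z) * Wc z)) - 8/27 * ((/s)^5 * (Xc z + Yc z))
  - 4/3 * Ci * ((/s)^2 * (Xc z - Yc z)) - 1/3 * ((/s)^4 * (Xc z * Xc z + Yc z * Yc z))
  + 10/9 * ((/s)^4 * (Xc z * Yc z)).

Definition Jh_U (s : C) (z : C3) : C :=
  - (8/27) * ((/s)^5 * (Wc z * Wc z)) + 64/81 * ((/s)^7 * Wc z) - 32/81 * (/s)^9
  - 4/9 * ((/s)^6 * ((Xc z + Yc z) * Wc z)) + 40/81 * ((/s)^8 * (Xc z + Yc z))
  + 8/9 * Ci * ((/s)^5 * (Xc z - Yc z)) + 4/9 * ((/s)^7 * (Xc z * Xc z + Yc z * Yc z))
  - 40/27 * ((/s)^7 * (Xc z * Yc z)).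

Definition Jh_W (s : C) (z : C3) : C :=
  8/9 * ((/s)^2 * Wc z) - 16/27 * (/s)^4 + 4/9 * ((/s)^3 * (Xc z + Yc z)).

Definition Jh_X (s : C) (z : C3) : C :=
  4/9 * ((/s)^3 * Wc z) - 8/27 * (/s)^5 - 4/3 * Ci * (/s)^2
  - 2/3 * ((/s)^4 * Xc z) + 10/9 * ((/s)^4 * Yc z).

Definition Jh_Y (s : C) (z : C3) : C :=
  4/9 * ((/s)^3 * Wc z) - 8/27 * (/s)^5 + 4/3 * Ci * (/s)^2
  - 2/3 * ((/s)^4 * Yc z) + 10/9 * ((/s)^4 * Xc z).

Definition iqh (s : C) (z : C3) : C := / csqrt (1 + Jh s z).
Definition iq3h (s : C) (z : C3) : C := iqh s z * (iqh s z * iqh s z).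

Definition gh (s : C) (z : C3) : C :=
  - (3/2) * (s^2 * Wc z) + 1/6 * ((/s)^2 * (Jh_W s z * iq3h s z)).
Definition fh1 (s : C) (z : C3) : C :=
  1/2 * ((/s)^1 * (Wc z * Wc z)) - 2/9 * ((/s)^5 * (/ csqrt (1 + Jh s z) - 1))
  - 1/6 * ((/s)^2 * (Jh_U s z * iq3h s z)).
Definition fh2 (s : C) (z : C3) : C := Ci * (1/6 * ((/s)^2 * (Jh_Y s z * iq3h s z))).
Definition fh3 (s : C) (z : C3) : C := - Ci * (1/6 * ((/s)^2 * (Jh_X s z * iq3h s z))).

Definition Rh1 (s : C) (z : C3) : C := / (1 + gh s z) * fh1 s z.
Definition Rh2 (s : C) (z : C3) : C := / (1 + gh s z) * (fh2 s z - Ci * (gh s z * Xc z)).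
Definition Rh3 (s : C) (z : C3) : C := / (1 + gh s z) * (fh3 s z + Ci * (gh s z * Yc z)).

Section Estimates.
Variables (b : R) (k x : Z).
Hypothesis b_pos : (0 <= b)%R.
Hypothesis Hk : (6 <= k <= 8)%Z.
Hypothesis Hx : (3 <= x <= 4)%Z.
Hypothesis Hkx : (k <= x + 4)%Z.
Local Notation wlip := (weighted_lip b k x).

(** Here and below 50 plays the role of an infinite exponent, for a group of variables on which the
    function does not depend. *)
Lemma wlip_WW : wlip (2 * k) k 50 (fun _ z => Wc z * Wc z).
Proof. apply (wlip_mult b k x k 0 50 k 0 50); try apply wlip_W; auto; lia. Qed.
Lemma wlip_XpY : wlip x 50 0 (fun _ z => Xc z + Yc z).
Proof. apply wlip_plus; [apply wlip_X|apply wlip_Y]; auto; lia. Qed.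
Lemma wlip_XmY : wlip x 50 0 (fun _ z => Xc z - Yc z).
Proof. apply wlip_minus; [apply wlip_X|apply wlip_Y]; auto; lia. Qed.
Lemma wlip_XpYW : wlip (x + k) x k (fun _ z => (Xc z + Yc z) * Wc z).
Proof. apply (wlip_mult b k x x 50 0 k 0 50); [apply wlip_XpY|apply wlip_W; auto; lia|lia..]. Qed.
Lemma wlip_XX : wlip (2 * x) 50 x (fun _ z => Xc z * Xc z + Yc z * Yc z).
Proof.
  apply wlip_plus.
  - apply (wlip_mult b k x x 50 0 x 50 0); try apply wlip_X; auto; lia.
  - apply (wlip_mult b k x x 50 0 x 50 0); try apply wlip_Y; auto; lia.
Qed.
Lemma wlip_XY : wlip (2 * x) 50 x (fun _ z => Xc z * Yc z).
Proof. apply (wlip_mult b k x x 50 0 x 50 0); [apply wlip_X|apply wlip_Y|..]; auto; lia. Qed.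

(** Each summand is a constant times a power of [1/s] times at most one of the products treated
    above; [lia] compares its exponents with the declared ones. *)
Ltac wlip_tac :=
  repeat (apply wlip_minus || apply wlip_plus);
  repeat apply wlip_scal;
  try (apply wlip_sig; lia);
  (eapply wlip_sig_mult;
    [ first [ apply wlip_WW | apply wlip_XpYW | apply wlip_XpY | apply wlip_XmY | apply wlip_XX | apply wlip_XY
            | apply (wlip_W b k x b_pos k 0 50); lia | apply (wlip_X b k x b_pos x 50 0); lia
            | apply (wlip_Y b k x b_pos x 50 0); lia ]
    | lia .. ]).

(** The size [x + 2] is that of the term in [s^(-2) (X - Y)]. The term [s^(-6)], free of [z], caps
    [x] at 4. *)
Lemma wlip_Jh : wlip (x + 2) 4 2 Jh.
Proof. unfold Jh. wlip_tac. Qed.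
Lemma wlip_Jh_U : wlip (x + 5) 7 5 Jh_U.
Proof. unfold Jh_U. wlip_tac. Qed.
Lemma wlip_Jh_W : wlip 4 2 3 Jh_W.
Proof. unfold Jh_W. wlip_tac. Qed.
Lemma wlip_Jh_X : wlip 2 3 4 Jh_X.
Proof. unfold Jh_X. wlip_tac. Qed.
Lemma wlip_Jh_Y : wlip 2 3 4 Jh_Y.
Proof. unfold Jh_Y. wlip_tac. Qed.

Lemma wlip_iq3h : wlip 0 4 2 iq3h.
Proof.
  assert (H : wlip 0 4 2 iqh) by (eapply wlip_isqrt; [|apply wlip_Jh]; lia).
  unfold iq3h. apply (wlip_mult b k x 0 4 2 0 4 2); auto; try lia.
  apply (wlip_mult b k x 0 4 2 0 4 2); auto; lia.
Qed.

(** Dominated by [s^2 W]: small on the ball because [k >= 6], yet with a Lipschitz constant in [W]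
    that grows like [|s|^2]. The other part, of size 6, forces [k <= 8]. *)
Lemma wlip_gh : wlip (k - 2) (-2) 5 gh.
Proof.
  unfold gh. apply wlip_plus; apply wlip_scal.
  - apply (wlip_mult b k x (-2) 0 50 k 0 50); [apply wlip_s; lia|apply wlip_W; auto; lia|lia..].
  - apply (wlip_sig_mult b k x 2 4 2 3); [|lia..].
    apply (wlip_mult b k x 4 2 3 0 4 2); [apply wlip_Jh_W|apply wlip_iq3h|lia..].
Qed.

(** The size [x + 7] comes from the two terms involving [J]; [W^2 / s] is smaller in size but gives
    the Lipschitz exponent [k + 1] in [W]. *)
Lemma wlip_fh1 : wlip (x + 7) (k + 1) 7 fh1.
Proof.
  unfold fh1. apply wlip_minus; [apply wlip_minus|]; apply wlip_scal.
  - apply (wlip_sig_mult b k x 1 (2 * k) k 50); [apply wlip_WW|lia..].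
  - apply (wlip_sig_mult b k x 5 (x + 2) 4 2); [|lia..].
    apply wlip_isqrt_m1; [lia|apply wlip_Jh].
  - apply (wlip_sig_mult b k x 2 (x + 5) 7 5); [|lia..].
    apply (wlip_mult b k x (x + 5) 7 5 0 4 2); [apply wlip_Jh_U|apply wlip_iq3h|lia..].
Qed.

Lemma wlip_fh2 : wlip 4 5 6 fh2.
Proof.
  unfold fh2. do 2 apply wlip_scal. apply (wlip_sig_mult b k x 2 2 3 4); [|lia..].
  apply (wlip_mult b k x 2 3 4 0 4 2); [apply wlip_Jh_Y|apply wlip_iq3h|lia..].
Qed.

Lemma wlip_fh3 : wlip 4 5 6 fh3.
Proof.
  unfold fh3. do 2 apply wlip_scal. apply (wlip_sig_mult b k x 2 2 3 4); [|lia..].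
  apply (wlip_mult b k x 2 3 4 0 4 2); [apply wlip_Jh_X|apply wlip_iq3h|lia..].
Qed.

Lemma wlip_ig : wlip 0 (-2) 5 (fun s z => / (1 + gh s z)).
Proof. apply (wlip_inv b k x (k - 2)); [lia|apply wlip_gh]. Qed.

(** The growing Lipschitz constant of [1 / (1 + g)] meets the size [x + 7], leaving [x + 5]; this is
    at least [k + 1] thanks to [k <= x + 4]. *)
Lemma wlip_Rh1 : wlip (x + 7) (k + 1) 7 Rh1.
Proof.
  unfold Rh1. apply (wlip_mult b k x 0 (-2) 5 (x + 7) (k + 1) 7); [apply wlip_ig|apply wlip_fh1|lia..].
Qed.

(** The weak exponent [x - 2] in [W] comes from the variation of [s^2 W] multiplied by [X]. At
    [x = 4] it is the coefficient [U^(-2/3)] of the difference equation. *)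
Lemma wlip_Rh2 : wlip 4 (x - 2) (k - 2) Rh2.
Proof.
  unfold Rh2. apply (wlip_mult b k x 0 (-2) 5 4 (x - 2) (k - 2)); [apply wlip_ig| |lia..].
  apply wlip_minus; [eapply wlip_weaken; [apply wlip_fh2|lia..]|]. apply wlip_scal.
  apply (wlip_mult b k x (k - 2) (-2) 5 x 50 0); [apply wlip_gh|apply wlip_X; auto; lia|lia..].
Qed.

Lemma wlip_Rh3 : wlip 4 (x - 2) (k - 2) Rh3.
Proof.
  unfold Rh3. apply (wlip_mult b k x 0 (-2) 5 4 (x - 2) (k - 2)); [apply wlip_ig| |lia..].
  apply wlip_plus; [eapply wlip_weaken; [apply wlip_fh3|lia..]|]. apply wlip_scal.
  apply (wlip_mult b k x (k - 2) (-2) 5 x 50 0); [apply wlip_gh|apply wlip_Y; auto; lia|lia..].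
Qed.

Definition regular (s : C) (z : C3) : Prop := (Cmod (Jh s z) <= 1/2)%R /\ (Cmod (gh s z) <= 1/2)%R.

Definition Rh_bounds (K r : R) (s : C) (z : C3) : Prop :=
  regular s z /\
  (Cmod (Rh1 s z) <= K * wt (x + 7) r)%R /\
  (Cmod (Rh2 s z) <= K * wt 4 r)%R /\
  (Cmod (Rh3 s z) <= K * wt 4 r)%R /\
  forall z', in_ball b k x r z' ->
    (Cmod (Rh1 s z - Rh1 s z') <= K * (wt (k + 1) r * dW z z' + wt 7 r * dXY z z'))%R /\
    (Cmod (Rh2 s z - Rh2 s z') <= K * (wt (x - 2) r * dW z z' + wt (k - 2) r * dXY z z'))%R /\
    (Cmod (Rh3 s z - Rh3 s z') <= K * (wt (x - 2) r * dW z z' + wt (k - 2) r * dXY z z'))%R.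

Lemma Rh_estimates :
  exists K rho : R, (0 < K)%R /\ (1 <= rho)%R /\
  forall s, (rho <= Cmod s)%R -> forall z, in_ball b k x (Cmod s) z -> Rh_bounds K (Cmod s) s z.
Proof.
  destruct wlip_Rh1 as [K1 [r1 [P1 [Q1 H1]]]]. destruct wlip_Rh2 as [K2 [r2 [P2 [Q2 H2]]]].
  destruct wlip_Rh3 as [K3 [r3 [P3 [Q3 H3]]]].
  destruct (wlip_small b k x (x + 2) _ _ _ ltac:(lia) wlip_Jh) as [K4 [r4 [P4 [Q4 H4]]]].
  destruct (wlip_small b k x (k - 2) _ _ _ ltac:(lia) wlip_gh) as [K5 [r5 [P5 [Q5 H5]]]].
  exists (K1 + K2 + K3 + 1)%R, (r1 + r2 + r3 + r4 + r5)%R. split; [lra|]. split; [lra|].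
  intros s Hs z Hz. unfold Rh_bounds.
  destruct (H1 s ltac:(lra) z Hz) as [A1 B1]. destruct (H2 s ltac:(lra) z Hz) as [A2 B2].
  destruct (H3 s ltac:(lra) z Hz) as [A3 B3].

  split; [split; [apply (H4 s ltac:(lra) z Hz)|apply (H5 s ltac:(lra) z Hz)]|].
  assert (Hb : forall c t y, (c = K1 \/ c = K2 \/ c = K3) -> (0 <= t)%R -> (y <= c * t)%R ->
    (y <= (K1 + K2 + K3 + 1) * t)%R) by (intros c t y [->|[->| ->]]; intros; nra).
  split; [eapply Hb; [|left; apply wt_pos|exact A1]; auto|].
  split; [eapply Hb; [|left; apply wt_pos|exact A2]; auto|].
  split; [eapply Hb; [|left; apply wt_pos|exact A3]; auto|].
  intros z' Hz'.
  assert (N : forall p q, (0 <= wt p (Cmod s) * dW z z' + wt q (Cmod s) * dXY z z')%R).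
  { intros p q. generalize (wt_pos p (Cmod s)) (wt_pos q (Cmod s)) (dW_pos z z') (dXY_pos z z'). nra. }
  split; [eapply Hb; [|apply N|apply B1; auto]; auto|].
  split; [eapply Hb; [|apply N|apply B2; auto]; auto|].
  eapply Hb; [|apply N|apply B3; auto]; auto.
Qed.
End Estimates.

(** * The vector field as a function of the cube root *)

(** The choice operator returns some derivative, and uniqueness identifies it. *)
Lemma CDeriv_cder (f : C -> C) (z l : C) : cder f z l -> CDeriv f z = l.
Proof.
  intros H. apply (cder_unique f z); auto. apply cder_is_derive. unfold CDeriv.
  apply epsilon_spec. exists l. now apply cder_is_derive.
Qed.

Lemma cder_isqrt (j : C -> C) (t l : C) : cder j t l -> (Cmod (j t) <= 1/2)%R ->
  cder (fun w => / csqrt (1 + j w)) t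
    (- (1/2) * (l * (/ csqrt (1 + j t) * (/ csqrt (1 + j t) * / csqrt (1 + j t))))).
Proof.
  intros H Hj. destruct (csqrt_1p _ Hj) as [E P]. assert (A := half_le_1p _ Hj).
  assert (N : csqrt (1 + j t) <> 0) by (apply C_neq_Re; lra).
  eapply cder_eq.
  - apply cder_inv; [|exact N]. apply (cder_comp csqrt (fun w => 1 + j w)).
    + apply cder_plus; [apply cder_const|exact H].
    + apply cder_csqrt. lra.
  - cbv beta. field. auto.
Qed.

Definition Kh (s : C) (z : C3) : C :=
  - (3/4) * (s^2 * (Wc z * Wc z)) - 1/3 * ((/s)^2 * (/ csqrt (1 + Jh s z) - 1)).

Section Link.
Variables (argf : C -> R) (U : C).
Let s (u : C) : C := cpow argf (1/3) u.

Lemma s_cube (u : C) : u <> 0 -> polar argf u -> s u * s u * s u = u.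
Proof.
  intros N H. unfold s. rewrite <- !cpow_add. replace (1/3 + 1/3 + 1/3)%R with 1%R by lra.
  now apply cpow_1.
Qed.

Lemma Cmod_s (u : C) : Cmod (s u) = Rpower (Cmod u) (1/3).
Proof. apply Cmod_cpow. Qed.

Lemma s_neq0 (u : C) : s u <> 0.
Proof. apply Cmod_gt_0. rewrite Cmod_s. apply Rpower_pos. Qed.

Lemma cpow_23 (u : C) : cpow argf (2/3) u = s u * s u.
Proof. unfold s. rewrite <- cpow_add. f_equal. lra. Qed.

Lemma cpow_43 (u : C) : cpow argf (4/3) u = s u * s u * (s u * s u).
Proof. rewrite <- cpow_23, <- cpow_add. f_equal. lra. Qed.

Lemma C_nat_neq0 (x : R) : x <> 0%R -> RtoC x <> 0.
Proof. intros H E. apply RtoC_inj in E. auto. Qed.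

Lemma Jcal_Jh (u W X Y : C) : u <> 0 -> polar argf u ->
  Jcal argf u W X Y = Jh (s u) (mk3 W X Y).
Proof.
  intros N H. unfold Jcal. rewrite cpow_23, cpow_43.
  assert (Ns := s_neq0 u). assert (E := s_cube u N H). set (S := s u) in *. clearbody S.
  (* Replacing [u] by [s^3] leaves an identity of rational functions in [s]. *)
  rewrite <- E. unfold Jh, Wc, Xc, Yc, mk3; cbn [fst snd].
  field. repeat split; auto; apply C_nat_neq0; lra.
Qed.

Lemma Kcal_Kh (u W X Y : C) : u <> 0 -> polar argf u ->
  Kcal argf u W X Y = Kh (s u) (mk3 W X Y).
Proof.
  intros N H. unfold Kcal. rewrite (Jcal_Jh u W X Y N H), cpow_23.
  assert (Ns := s_neq0 u). unfold Kh.
  replace (1 / csqrt (1 + Jh (s u) (mk3 W X Y))) with (/ csqrt (1 + Jh (s u) (mk3 W X Y)))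
    by (unfold Cdiv; ring).
  set (q := / csqrt _). unfold Wc, mk3; cbn [fst snd].
  field. repeat split; auto; apply C_nat_neq0; lra.
Qed.

Hypothesis HU : U <> 0.
Hypothesis Hpol : near U (polar argf).
Hypothesis Harg : ccont (fun w => RtoC (argf w)) U.

Lemma near_good : near U (fun u => u <> 0 /\ polar argf u).
Proof.
  apply near_and; auto. apply (ccont_neq0 (fun u => u)); auto. apply ccont_id.
Qed.

Lemma cder_s : cder s U (1/3 * (/ s U)^2).
Proof.
  assert (N := s_neq0 U).
  eapply cder_eq.
  - apply cder_cbrt; auto.
    + generalize near_good. apply near_mono. intros w [A B]. now apply s_cube.
    + now apply ccont_cpow.
  - field. repeat split; auto; apply C_nat_neq0; lra.
Qed.

Lemma cder_sig (n : nat) :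
  cder (fun u => (/ s u)^n) U (- (1/3) * (RtoC (INR n) * (/ s U)^(n + 3))).
Proof.
  assert (N := s_neq0 U).
  induction n as [|n IH].
  - simpl. eapply cder_eq; [apply cder_const|]. ring.
  - apply cder_near with (fun u => / s u * (/ s u)^n); [now apply near_all|].
    eapply cder_eq; [apply cder_mult; [apply cder_inv; [apply cder_s|auto]|exact IH]|].
    rewrite S_INR, RtoC_plus. cbv beta. simpl Nat.add. rewrite !Cpow_add_r, !Cpow_S.
    rewrite Cpow_add_r.
    field. repeat split; auto; apply C_nat_neq0; lra.
Qed.

Lemma cder_s2 : cder (fun u => s u ^ 2) U (2/3 * (/ s U) ^ 1).
Proof.
  assert (N := s_neq0 U).
  apply cder_near with (fun u => s u * s u); [apply near_all; intros; cbv beta; ring|].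
  eapply cder_eq; [apply cder_mult; apply cder_s|]. field.
  repeat split; auto; apply C_nat_neq0; lra.
Qed.

Ltac cder_tac :=
  first [ eassumption | apply cder_const | apply cder_id | apply cder_sig | apply cder_s2
        | eapply cder_minus; cder_tac | eapply cder_plus; cder_tac | eapply cder_mult; cder_tac | eapply cder_opp; cder_tac ].
Ltac cder_ring := cbv beta; cbn [INR Nat.add]; rewrite ?RtoC_plus; field;
  repeat split; auto using s_neq0; apply C_nat_neq0; lra.

Variables (W X Y : C).
Let z : C3 := mk3 W X Y.
Hypothesis HJ : (Cmod (Jh (s U) z) <= 1/2)%R.

Lemma cder_Jh_U : cder (fun u => Jh (s u) z) U (Jh_U (s U) z).
Proof.
  unfold Jh, Jh_U, z, Wc, Xc, Yc, mk3; cbn [fst snd]. eapply cder_eq; [cder_tac|]. cder_ring.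
Qed.

Lemma cder_Jh_W : cder (fun w => Jh (s U) (mk3 w X Y)) W (Jh_W (s U) z).
Proof.
  unfold Jh, Jh_W, z, Wc, Xc, Yc, mk3; cbn [fst snd]. eapply cder_eq; [cder_tac|]. cder_ring.
Qed.

Lemma cder_Jh_X : cder (fun w => Jh (s U) (mk3 W w Y)) X (Jh_X (s U) z).
Proof.
  unfold Jh, Jh_X, z, Wc, Xc, Yc, mk3; cbn [fst snd]. eapply cder_eq; [cder_tac|]. cder_ring.
Qed.

Lemma cder_Jh_Y : cder (fun w => Jh (s U) (mk3 W X w)) Y (Jh_Y (s U) z).
Proof.
  unfold Jh, Jh_Y, z, Wc, Xc, Yc, mk3; cbn [fst snd]. eapply cder_eq; [cder_tac|]. cder_ring.
Qed.

Lemma cder_Kh_U : cder (fun u => Kh (s u) z) U (- fh1 (s U) z).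
Proof.
  assert (H := cder_isqrt _ _ _ cder_Jh_U HJ). cbv beta in H.
  unfold Kh, fh1, iq3h, iqh. unfold z at 1 2, Wc, mk3; cbn [fst snd].
  eapply cder_eq; [cder_tac|]. unfold z, Wc, mk3; cbn [fst snd].
  (* With the inverse root as an atom the identity is rational in [s], [W], [X], [Y] and [q]. *)
  set (q := / csqrt _). cder_ring.
Qed.

Lemma cder_Kh_W : cder (fun w => Kh (s U) (mk3 w X Y)) W (gh (s U) z).
Proof.
  assert (H := cder_isqrt (fun w => Jh (s U) (mk3 w X Y)) _ _ cder_Jh_W HJ). cbv beta in H.
  unfold Kh, gh, iq3h, iqh. unfold Wc at 1 2, mk3 at 1 2; cbn [fst snd].
  eapply cder_eq; [cder_tac|]. unfold z, Wc, mk3; cbn [fst snd].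
  set (q := / csqrt _). cder_ring.
Qed.

Lemma cder_Kh_X : cder (fun w => Kh (s U) (mk3 W w Y)) X (1/6 * ((/ s U)^2 * (Jh_X (s U) z * iq3h (s U) z))).
Proof.
  assert (H := cder_isqrt (fun w => Jh (s U) (mk3 W w Y)) _ _ cder_Jh_X HJ). cbv beta in H.
  unfold Kh, iq3h, iqh. unfold Wc at 1 2, mk3 at 1 2; cbn [fst snd].
  eapply cder_eq; [cder_tac|]. unfold z, Wc, mk3; cbn [fst snd].
  set (q := / csqrt _). cder_ring.
Qed.

Lemma cder_Kh_Y : cder (fun w => Kh (s U) (mk3 W X w)) Y (1/6 * ((/ s U)^2 * (Jh_Y (s U) z * iq3h (s U) z))).
Proof.
  assert (H := cder_isqrt (fun w => Jh (s U) (mk3 W X w)) _ _ cder_Jh_Y HJ). cbv beta in H.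
  unfold Kh, iq3h, iqh. unfold Wc at 1 2, mk3 at 1 2; cbn [fst snd].
  eapply cder_eq; [cder_tac|]. unfold z, Wc, mk3; cbn [fst snd].
  set (q := / csqrt _). cder_ring.
Qed.

(** Differentiating in [U] moves the base point of the branch, so [Kcal] and [Kh] have to agree on a
    neighbourhood of [U]; for the other three derivatives agreement at the fixed [U] suffices. *)
Lemma dU_K_eq : dU_K argf U W X Y = - fh1 (s U) z.
Proof.
  apply CDeriv_cder. eapply cder_near; [|apply cder_Kh_U].
  generalize near_good. apply near_mono. intros u [A B]. now apply Kcal_Kh.
Qed.

Let good_U := near_self _ _ near_good.

Lemma dW_K_eq : dW_K argf U W X Y = gh (s U) z.
Proof.
  apply CDeriv_cder. eapply cder_near; [|apply cder_Kh_W].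
  apply near_all. intros u. now apply Kcal_Kh; apply good_U.
Qed.

Lemma dX_K_eq : dX_K argf U W X Y = 1/6 * ((/ s U)^2 * (Jh_X (s U) z * iq3h (s U) z)).
Proof.
  apply CDeriv_cder. eapply cder_near; [|apply cder_Kh_X].
  apply near_all. intros u. now apply Kcal_Kh; apply good_U.
Qed.

Lemma dY_K_eq : dY_K argf U W X Y = 1/6 * ((/ s U)^2 * (Jh_Y (s U) z * iq3h (s U) z)).
Proof.
  apply CDeriv_cder. eapply cder_near; [|apply cder_Kh_Y].
  apply near_all. intros u. now apply Kcal_Kh; apply good_U.
Qed.
End Link.

Lemma Rcal_Rh (argf : C -> R) (U : C) (phi : C -> C3) :
  U <> 0 -> near U (polar argf) -> ccont (fun w => RtoC (argf w)) U ->
  (Cmod (Jh (cpow argf (1/3) U) (phi U)) <= 1/2)%R ->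
  let s := cpow argf (1/3) U in
  Rcal argf phi U = mk3 (Rh1 s (phi U)) (Rh2 s (phi U)) (Rh3 s (phi U)).
Proof.
  intros N Hp Ha HJ s. unfold Rcal, fvec, gfun.
  destruct (phi U) as [[W X] Y] eqn:E. cbn [Wc Xc Yc fst snd].
  change (W, X, Y) with (mk3 W X Y) in *.
  unfold Wc, Xc, Yc, mk3; cbn [fst snd]; fold (mk3 W X Y).
  rewrite dU_K_eq, dW_K_eq, dX_K_eq, dY_K_eq by auto. fold s.
  unfold scal3, sub3, Acal, Rh1, Rh2, Rh3, fh2, fh3, mk3, Wc, Xc, Yc. cbn [fst snd].
  change (W, X, Y) with (mk3 W X Y). f_equal; [f_equal|]; ring.
Qed.

(** * Closure properties of holomorphy, applied to the vector field *)

Lemma hol_const (D : C -> Prop) (c : C) : hol D (fun _ => c).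
Proof. exists (fun _ => 0). intros z _. split; [apply cder_const|apply ccont_const]. Qed.

Lemma hol_plus (D : C -> Prop) (f g : C -> C) : hol D f -> hol D g -> hol D (fun w => f w + g w).
Proof.
  intros [f' Hf] [g' Hg]. exists (fun w => f' w + g' w). intros z Hz.
  destruct (Hf z Hz), (Hg z Hz). split; [now apply cder_plus|now apply ccont_plus].
Qed.

Lemma hol_mult (D : C -> Prop) (f g : C -> C) : hol D f -> hol D g -> hol D (fun w => f w * g w).
Proof.
  intros [f' Hf] [g' Hg]. exists (fun w => f' w * g w + f w * g' w). intros z Hz.
  destruct (Hf z Hz) as [A B], (Hg z Hz) as [A' B']. split; [now apply cder_mult|].
  apply ccont_plus; apply ccont_mult; auto; eapply cder_ccont; eauto.
Qed.

Lemma hol_opp (D : C -> Prop) (f : C -> C) : hol D f -> hol D (fun w => - f w).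
Proof.
  intros [f' Hf]. exists (fun w => - f' w). intros z Hz. destruct (Hf z Hz) as [A B].
  split; [now apply cder_opp|]. apply ccont_near with (fun w => - (1) * f' w).
  - apply near_all. intros. cbv beta. ring.
  - apply ccont_mult; auto. apply ccont_const.
Qed.

Lemma hol_minus (D : C -> Prop) (f g : C -> C) : hol D f -> hol D g -> hol D (fun w => f w - g w).
Proof. intros. apply hol_plus; [|apply hol_opp]; auto. Qed.

Lemma hol_pow (D : C -> Prop) (f : C -> C) (n : nat) : hol D f -> hol D (fun w => f w ^ n).
Proof. intros H. induction n; simpl; [apply hol_const|now apply hol_mult]. Qed.

Lemma hol_inv (D : C -> Prop) (f : C -> C) :
  hol D f -> (forall z, D z -> f z <> 0) -> hol D (fun w => / f w).
Proof.
  intros [f' Hf] N. exists (fun w => - f' w / (f w * f w)). intros z Hz.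
  destruct (Hf z Hz) as [A B]. split; [apply cder_inv; auto|].
  apply ccont_mult.
  - apply ccont_near with (fun w => - (1) * f' w).
    + apply near_all. intros. cbv beta. ring.
    + apply ccont_mult; auto. apply ccont_const.
  - apply ccont_inv; [apply ccont_mult; eapply cder_ccont; eauto|].
    apply Cmult_neq_0; auto.
Qed.

Lemma hol_isqrt (D : C -> Prop) (j : C -> C) :
  hol D j -> (forall z, D z -> (Cmod (j z) <= 1/2)%R) -> hol D (fun w => / csqrt (1 + j w)).
Proof.
  intros [j' Hj] N.
  exists (fun w => - (1/2) * (j' w * (/ csqrt (1 + j w) * (/ csqrt (1 + j w) * / csqrt (1 + j w))))).
  intros z Hz. destruct (Hj z Hz) as [A B]. assert (I := cder_isqrt j z _ A (N z Hz)).
  split; auto. assert (Ci := cder_ccont _ _ _ I).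
  repeat (apply ccont_mult || apply ccont_const || assumption).
Qed.

Ltac hol_tac := repeat (apply hol_minus || apply hol_plus || apply hol_const || apply hol_mult
  || apply hol_opp || apply hol_pow || assumption).

Lemma hol_Rh (D : C -> Prop) (s : C -> C) (phi : C -> C3) :
  hol D s -> (forall U, D U -> s U <> 0) -> hol D (fun U => Wc (phi U)) ->
  hol D (fun U => Xc (phi U)) -> hol D (fun U => Yc (phi U)) ->
  (forall U, D U -> regular (s U) (phi U)) ->
  hol D (fun U => Rh1 (s U) (phi U)) /\ hol D (fun U => Rh2 (s U) (phi U)) /\
  hol D (fun U => Rh3 (s U) (phi U)).
Proof.
  intros Hs Ns HW HX HY Hr.
  assert (Hi : hol D (fun U => / s U)) by now apply hol_inv.
  assert (HJ : hol D (fun U => Jh (s U) (phi U))) by (unfold Jh; hol_tac).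
  assert (Hq : hol D (fun U => / csqrt (1 + Jh (s U) (phi U)))).
  { apply hol_isqrt; auto. intros z Hz. now apply Hr. }
  assert (Hq3 : hol D (fun U => iq3h (s U) (phi U))) by (unfold iq3h, iqh; hol_tac).
  assert (Hg : hol D (fun U => gh (s U) (phi U))) by (unfold gh, Jh_W; hol_tac).
  assert (Hig : hol D (fun U => / (1 + gh (s U) (phi U)))).
  { apply hol_inv.
    - apply hol_plus; [apply hol_const|exact Hg].
    - intros z Hz. apply inv_le_2. apply half_le_1p. now apply Hr. }
  unfold Rh1, Rh2, Rh3, fh1, fh2, fh3, Jh_U, Jh_X, Jh_Y. split; [|split]; hol_tac.
Qed.

(** * Picard iteration *)

Definition rad (U : C) : R := Rpower (Cmod U) (1/3).

Lemma wt_rad (n : Z) (U : C) : wt n (rad U) = Rpower (Cmod U) (- IZR n / 3).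
Proof. unfold wt, rad. rewrite Rpower_mult. f_equal. field. Qed.

Lemma rad_ge (rho : R) (U : C) : (1 <= rho)%R -> (rho * rho * rho <= Cmod U)%R -> (rho <= rad U)%R.
Proof.
  intros H HU. unfold rad.
  replace rho with (Rpower (rho * rho * rho) (1/3)).
  - apply Rle_Rpower_l; [lra|]. split; [|exact HU]. repeat apply Rmult_lt_0_compat; lra.
  - replace (rho * rho * rho)%R with (rho ^ 3)%R by ring.
    rewrite <- Rpower_pow by lra. rewrite Rpower_mult. simpl.
    replace ((1 + 1 + 1) * (1 / 3))%R with 1%R by field. apply Rpower_1. lra.
Qed.

Lemma wt_ray (D : C -> Prop) (c1 : R) (v : C) (n : Z) (U : C) (t : R) :
  (0 < c1)%R -> ray_closed D c1 v -> (0 <= n)%Z -> D U -> (1 <= Cmod U)%R -> (0 <= t)%R ->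
  (wt n (rad (U + RtoC t * v)) <= Rpower c1 (- IZR n / 3) * Rpower (Cmod U + t) (- IZR n / 3))%R.
Proof.
  intros Hc H Hn HU H1 Ht. rewrite wt_rad. destruct (H U t HU Ht) as [_ L].
  rewrite Rpower_mult_distr by lra. apply IZR_le in Hn. apply Rpower_anti; [|lra].
  split; auto. apply Rmult_lt_0_compat; lra.
Qed.

Lemma cder_ray (D : C -> Prop) (c1 : R) (v : C) (g h : C -> C) (U : C) :
  ray_closed D c1 v -> D U -> (forall U, D U -> cder g U (h U)) ->
  forall t, (0 <= t)%R -> rder (fun t => g (U + RtoC t * v)) t (v * h (U + RtoC t * v)).
Proof. intros H HU Hg t Ht. apply cder_rder. apply Hg. now apply H. Qed.

(** On a tilted ray the kernel has integral [1 / Re (lam v)], so [g] inherits the weight [n] of the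
    source. The bound [B] serves only as boundary condition at infinity. *)
Lemma linear_bound_exp (D : C -> Prop) (lam v : C) (c1 K B : R) (n : Z) (g F : C -> C) :
  (0 < c1)%R -> ray_closed D c1 v -> (forall U, D U -> (1 <= Cmod U)%R) ->
  (0 < Re (lam * v))%R -> (0 <= n)%Z ->
  (forall U, D U -> cder g U (lam * g U + F U)) ->
  (forall U, D U -> (Cmod (g U) <= B)%R) ->
  (forall U, D U -> (Cmod (F U) <= K * wt n (rad U))%R) ->
  forall U, D U ->
    (Cmod (g U) <= Cmod v * Rpower c1 (- IZR n / 3) / Re (lam * v) * K * wt n (rad U))%R.
Proof.
  intros Hc Hray H1 Hl Hn Hg HB HF U HU. assert (P := H1 U HU).
  assert (K0 : (0 <= K)%R).
  { generalize (HF U HU) (Cmod_ge_0 (F U)) (wt_pos n (rad U)). nra. }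
  assert (A := apriori_exp (fun t => g (U + RtoC t * v)) (fun t => v * F (U + RtoC t * v)) (lam * v)
    (Re (lam * v)) (Cmod v * (K * (Rpower c1 (- IZR n / 3) * wt n (rad U)))) B).
  cbv beta in A. rewrite Cmult_0_l, Cplus_0_r in A.
  eapply Rle_trans; [apply A|right; field; lra].
  - lra.
  - intros t Ht. eapply rder_eq; [now apply (cder_ray D c1 v g (fun U => lam * g U + F U))|].
    cbv beta. ring.
  - intros t Ht. apply Cmod_mult_le; [lra|].
    eapply Rle_trans; [apply HF; now apply Hray|]. apply Rmult_le_compat_l; auto.
    eapply Rle_trans; [now apply (wt_ray D c1 v)|]. apply Rmult_le_compat_l; [left; apply Rpower_pos|].
    rewrite wt_rad. apply IZR_le in Hn. apply Rpower_anti; lra.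
  - intros t Ht. apply HB. now apply Hray.
Qed.

(** For the neutral component the integration costs one power of [U], that is 3 in the weight. *)
Lemma linear_bound_power (D : C -> Prop) (v : C) (c1 K B : R) (n : Z) (g F : C -> C) :
  (0 < c1)%R -> ray_closed D c1 v -> (forall U, D U -> (1 <= Cmod U)%R) -> (1 <= n)%Z ->
  (forall U, D U -> cder g U (F U)) ->
  (forall U, D U -> (Cmod (g U) <= B * wt 1 (rad U))%R) ->
  (forall U, D U -> (Cmod (F U) <= K * wt (n + 3) (rad U))%R) ->
  forall U, D U ->
    (Cmod (g U) <= Cmod v * Rpower c1 (- IZR (n + 3) / 3) * 3 * K * wt n (rad U))%R.
Proof.
  intros Hc Hray H1 Hn Hg HB HF U HU. assert (P := H1 U HU).
  assert (K0 : (0 <= K)%R).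
  { generalize (HF U HU) (Cmod_ge_0 (F U)) (wt_pos (n + 3) (rad U)). nra. }
  assert (B0 : (0 <= B)%R).
  { generalize (HB U HU) (Cmod_ge_0 (g U)) (wt_pos 1 (rad U)). nra. }
  assert (Hn' := Hn). apply IZR_le in Hn'.
  assert (A := apriori_power (fun t => g (U + RtoC t * v)) (fun t => v * F (U + RtoC t * v))
    (Cmod U) (IZR n / 3) (1/3) (Cmod v * (K * Rpower c1 (- IZR (n + 3) / 3)))
    (B * Rpower c1 (- 1 / 3))).
  cbv beta in A. rewrite Cmult_0_l, Cplus_0_r in A.
  assert (Q : (0 <= Cmod v * (K * Rpower c1 (- IZR (n + 3) / 3)))%R).
  { apply Rmult_le_pos; [apply Cmod_ge_0|]. apply Rmult_le_pos; auto. left. apply Rpower_pos. }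
  eapply Rle_trans; [apply A|]; try lra.
  - intros t Ht. eapply rder_eq; [now apply (cder_ray D c1 v g F)|reflexivity].
  - intros t Ht. rewrite Rmult_assoc. apply Cmod_mult_le; [lra|].
    eapply Rle_trans; [apply HF; now apply Hray|]. rewrite Rmult_assoc. apply Rmult_le_compat_l; auto.
    eapply Rle_trans; [apply (wt_ray D c1 v); auto; lia|]. right. f_equal. f_equal.
    rewrite plus_IZR. field.
  - intros t Ht. eapply Rle_trans; [apply HB; now apply Hray|]. rewrite Rmult_assoc.
    apply Rmult_le_compat_l; auto. eapply Rle_trans; [apply (wt_ray D c1 v); auto; lia|].
    right. f_equal. f_equal. field.
  - rewrite wt_rad. replace (- (IZR n / 3))%R with (- IZR n / 3)%R by field.
    replace (Cmod v * Rpower c1 (- IZR (n + 3) / 3) * 3 * K)%R with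
      (Cmod v * (K * Rpower c1 (- IZR (n + 3) / 3)) * 3)%R by ring.
    (* The division by [n / 3] is bounded by the factor 3 because [n >= 1]. *)
    apply Rmult_le_compat_r; [left; apply Rpower_pos|]. unfold Rdiv at 1.
    apply Rmult_le_compat_l; auto. apply Rmult_le_reg_r with (IZR n / 3)%R; [lra|].
    rewrite Rinv_l by lra. lra.
Qed.

Definition cbrt (argf : C -> R) (U : C) : C := cpow argf (1/3) U.

Lemma Cmod_cbrt (argf : C -> R) (U : C) : Cmod (cbrt argf U) = rad U.
Proof. apply Cmod_cpow. Qed.

Definition good_domain (argf : C -> R) (D : C -> Prop) (rho : R) (c1 : R) (vW vX vY : C) :=
  copen D /\ ray_closed D c1 vW /\ ray_closed D c1 vX /\ ray_closed D c1 vY /\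
  forall U, D U -> (rho <= rad U)%R /\ (1 <= Cmod U)%R /\ polar argf U /\ ccont (fun w => RtoC (argf w)) U.

Definition inner_solution (argf : C -> R) (D : C -> Prop) (phi : C -> C3) :=
  forall U, D U ->
    cder (fun u => Wc (phi u)) U (Rh1 (cbrt argf U) (phi U)) /\
    cder (fun u => Xc (phi u)) U (Ci * Xc (phi U) + Rh2 (cbrt argf U) (phi U)) /\
    cder (fun u => Yc (phi u)) U (- Ci * Yc (phi U) + Rh3 (cbrt argf U) (phi U)).

Section Picard.
Variables (argf : C -> R) (D : C -> Prop) (rho c1 : R) (vW vX vY : C).
Variables (K C0 : R).
Hypothesis Hc1 : (0 < c1)%R.
Hypothesis HvX : (0 < Re (Ci * vX))%R.
Hypothesis HvY : (0 < Re (- Ci * vY))%R.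
Hypothesis HD : good_domain argf D rho c1 vW vX vY.
Hypothesis HK : (0 < K)%R.
Hypothesis HC0 : (0 < C0)%R.
Hypothesis Hrho : (1 <= rho /\ 6 * (C0 * K) <= rho)%R.
Let s := cbrt argf.
Hypothesis HR : forall U, D U -> forall z, in_ball 1 6 3 (rad U) z ->
  Rh_bounds 1 6 3 K (rad U) (s U) z.
Hypothesis HCW : (Cmod vW * Rpower c1 (- IZR (7 + 3) / 3) * 3 <= C0)%R.
Hypothesis HCX4 : (Cmod vX * Rpower c1 (- IZR 4 / 3) / Re (Ci * vX) <= C0)%R.
Hypothesis HCX7 : (Cmod vX * Rpower c1 (- IZR 7 / 3) / Re (Ci * vX) <= C0)%R.
Hypothesis HCY4 : (Cmod vY * Rpower c1 (- IZR 4 / 3) / Re (- Ci * vY) <= C0)%R.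
Hypothesis HCY7 : (Cmod vY * Rpower c1 (- IZR 7 / 3) / Re (- Ci * vY) <= C0)%R.

Lemma D_ge1 : forall U, D U -> (1 <= Cmod U)%R.
Proof. intros U HU. now apply HD. Qed.

Lemma D_rad : forall U, D U -> (rho <= rad U)%R.
Proof. intros U HU. now apply HD. Qed.

Definition admissible (phi : C -> C3) :=
  hol D (fun u => Wc (phi u)) /\ hol D (fun u => Xc (phi u)) /\ hol D (fun u => Yc (phi u)) /\
  forall U, D U -> in_ball 1 6 3 (rad U) (phi U).

(** The term [0 * Wc (psi U)] gives all three components the common form [lam g + F] expected by the
    linear solver. *)
Definition step_of (phi psi : C -> C3) :=
  (forall U, D U -> cder (fun u => Wc (psi u)) U (0 * Wc (psi U) + Rh1 (s U) (phi U))) /\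
  (forall U, D U -> cder (fun u => Xc (psi u)) U (Ci * Xc (psi U) + Rh2 (s U) (phi U))) /\
  (forall U, D U -> cder (fun u => Yc (psi u)) U (- Ci * Yc (psi U) + Rh3 (s U) (phi U))).

Lemma hol_s : hol D s.
Proof.
  exists (fun U => 1/3 * (/ s U)^2). intros U HU.
  assert (H1 := D_ge1 U HU).
  assert (N : U <> 0) by (apply Cmod_gt_0; lra).
  assert (Hs : cder s U (1/3 * (/ s U)^2)).
  { apply cder_s; auto.
    - generalize (proj1 HD U HU). apply near_mono. intros w Hw. now apply HD.
    - now apply HD. }
  split; auto. assert (Cs := cder_ccont _ _ _ Hs).
  apply ccont_mult; [apply ccont_const|].
  assert (Cis : ccont (fun U => / s U) U) by (apply ccont_inv; auto; apply s_neq0).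
  simpl. repeat (apply ccont_mult || apply ccont_const || exact Cis).
Qed.

Lemma hol_R (phi : C -> C3) : admissible phi ->
  hol D (fun U => Rh1 (s U) (phi U)) /\ hol D (fun U => Rh2 (s U) (phi U)) /\
  hol D (fun U => Rh3 (s U) (phi U)).
Proof.
  intros [HW [HX [HY HB]]]. apply hol_Rh; auto using hol_s.
  - intros U _. apply s_neq0.
  - intros U HU. now apply HR, HB.
Qed.

(** One spare unit of weight pays for all constants. The 6 is 2 times 3: contraction rate 1/2, and
    Lipschitz sum 3, one from [dW] and two from [dXY]. *)
Lemma wt_small (n m : Z) (U : C) : D U -> (m < n)%Z -> (6 * (C0 * K) * wt n (rad U) <= wt m (rad U))%R.
Proof.
  intros HU H. assert (Hr := D_rad U HU). assert (Hr1 : (1 <= rad U)%R) by lra.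
  assert (L := wt_le n (m + 1) (rad U) Hr1 ltac:(lia)). rewrite wt_add, wt_1 in L by lra.
  assert (P := wt_pos m (rad U)). assert (CK : (0 < C0 * K)%R) by (apply Rmult_lt_0_compat; lra).
  apply Rle_trans with (rad U * (wt m (rad U) * / rad U))%R.
  - apply Rmult_le_compat; auto; try lra. left. apply wt_pos.
  - right. field. lra.
Qed.

Lemma wt_le1 (n : Z) (U : C) : D U -> (0 <= n)%Z -> (wt n (rad U) <= 1)%R.
Proof.
  intros HU H. assert (Hr := D_rad U HU). rewrite <- (wt_0 (rad U)) by lra.
  apply wt_le; auto. lra.
Qed.

Lemma bound_W (F g : C -> C) (Q : R) :
  (forall U, D U -> cder g U (0 * g U + F U)) ->
  (exists B, forall U, D U -> (Cmod (g U) <= B * wt 1 (rad U))%R) -> (0 <= Q)%R ->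
  (forall U, D U -> (Cmod (F U) <= Q * wt (7 + 3) (rad U))%R) ->
  forall U, D U -> (Cmod (g U) <= C0 * Q * wt 7 (rad U))%R.
Proof.
  intros Hg [B HB] HQ HF U HU. destruct HD as [_ [HrW _]].
  eapply Rle_trans; [eapply (linear_bound_power D vW c1 Q B 7 g F); eauto using D_ge1; try lia|].
  - intros V HV. eapply cder_eq; [now apply Hg|]. ring.
  - apply Rmult_le_compat_r; [left; apply wt_pos|]. now apply Rmult_le_compat_r.
Qed.

Lemma bound_oscillating (lam v : C) (F g : C -> C) (Q : R) (n : Z) :
  ray_closed D c1 v -> (0 < Re (lam * v))%R ->
  (Cmod v * Rpower c1 (- IZR n / 3) / Re (lam * v) <= C0)%R ->
  (forall U, D U -> cder g U (lam * g U + F U)) ->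
  (exists B, forall U, D U -> (Cmod (g U) <= B * wt 1 (rad U))%R) -> (0 <= Q)%R -> (0 <= n)%Z ->
  (forall U, D U -> (Cmod (F U) <= Q * wt n (rad U))%R) ->
  forall U, D U -> (Cmod (g U) <= C0 * Q * wt n (rad U))%R.
Proof.
  intros Hv Hl HC Hg [B HB] HQ Hn HF U HU.
  eapply Rle_trans; [eapply (linear_bound_exp D lam v c1 Q B n g F); eauto using D_ge1|].
  - intros V HV. eapply Rle_trans; [now apply HB|].
    assert (B0 : (0 <= B)%R) by (generalize (HB V HV) (Cmod_ge_0 (g V)) (wt_pos 1 (rad V)); nra).
    generalize (wt_le1 1 V HV ltac:(lia)) (wt_pos 1 (rad V)). nra.
  - apply Rmult_le_compat_r; [left; apply wt_pos|]. now apply Rmult_le_compat_r.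
Qed.

Lemma bound_X (F g : C -> C) (Q : R) (n : Z) :
  (forall U, D U -> cder g U (Ci * g U + F U)) ->
  (exists B, forall U, D U -> (Cmod (g U) <= B * wt 1 (rad U))%R) -> (0 <= Q)%R ->
  (n = 4%Z \/ n = 7%Z) ->
  (forall U, D U -> (Cmod (F U) <= Q * wt n (rad U))%R) ->
  forall U, D U -> (Cmod (g U) <= C0 * Q * wt n (rad U))%R.
Proof.
  intros Hg HB HQ Hn HF. assert (0 <= n)%Z by lia.
  apply (bound_oscillating Ci vX F g Q n); auto; [apply HD|]. destruct Hn as [-> | ->]; auto.
Qed.

Lemma bound_Y (F g : C -> C) (Q : R) (n : Z) :
  (forall U, D U -> cder g U (- Ci * g U + F U)) ->
  (exists B, forall U, D U -> (Cmod (g U) <= B * wt 1 (rad U))%R) -> (0 <= Q)%R ->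
  (n = 4%Z \/ n = 7%Z) ->
  (forall U, D U -> (Cmod (F U) <= Q * wt n (rad U))%R) ->
  forall U, D U -> (Cmod (g U) <= C0 * Q * wt n (rad U))%R.
Proof.
  intros Hg HB HQ Hn HF. assert (0 <= n)%Z by lia.
  apply (bound_oscillating (- Ci) vY F g Q n); auto; [apply HD|]. destruct Hn as [-> | ->]; auto.
Qed.

(** In terms of [|U|], [wt 4] and [wt 1] are the exponents -4/3 and -1/3 of [solve_linear]. *)
Lemma solve_comp (lam v : C) (F : C -> C) :
  ray_closed D c1 v -> (0 <= Re (lam * v))%R -> hol D F ->
  (forall U, D U -> (Cmod (F U) <= K * wt 4 (rad U))%R) ->
  exists g, (forall U, D U -> cder g U (lam * g U + F U)) /\ hol D g /\
    exists B, forall U, D U -> (Cmod (g U) <= B * wt 1 (rad U))%R.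
Proof.
  intros Hv Hl HF HB. destruct (solve_linear D lam v c1 (proj1 HD) Hc1 Hv D_ge1 Hl) as [Cs HCs].
  destruct (HCs F K HF) as [g [A [B C']]].
  - intros U HU. generalize (HB U HU). rewrite wt_rad. auto.
  - exists g. split; auto. split; auto. exists (Cs * K)%R. intros U HU.
    generalize (C' U HU). rewrite wt_rad. auto.
Qed.

Lemma ball_decay (phi : C -> C3) : admissible phi ->
  (forall U, D U -> (Cmod (Wc (phi U)) <= 1 * wt 1 (rad U))%R) /\
  (forall U, D U -> (Cmod (Xc (phi U)) <= 1 * wt 1 (rad U))%R) /\
  (forall U, D U -> (Cmod (Yc (phi U)) <= 1 * wt 1 (rad U))%R).
Proof.
  intros [_ [_ [_ HB]]].
  split; [|split]; intros U HU; destruct (HB U HU) as [A [B C']]; (eapply Rle_trans; [eassumption|]);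
    apply Rmult_le_compat_l; try lra; apply wt_le; try lia; generalize (D_rad U HU); lra.
Qed.

(** On the ball [(6, 3)] the sources have weights 10, 4 and 4, so the new iterate has weights 7, 4
    and 4: one better than the ball in every component, and [wt_small] brings it back to radius
    1. *)
Lemma step_exists (phi : C -> C3) : admissible phi ->
  exists psi, admissible psi /\ step_of phi psi.
Proof.
  intros Ha. destruct (hol_R phi Ha) as [H1 [H2 H3]].
  destruct HD as [Ho [HrW [HrX [HrY _]]]].
  assert (CK : (0 < C0 * K)%R) by (apply Rmult_lt_0_compat; lra).
  destruct (solve_comp 0 vW (fun U => Rh1 (s U) (phi U)) HrW) as [gW [W1 [W2 W3]]]; auto.
  { rewrite Cmult_0_l. simpl. lra. }
  { intros U HU. destruct (HR U HU (phi U)) as [_ [B _]]; [now apply Ha|].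
    eapply Rle_trans; [exact B|]. apply Rmult_le_compat_l; [lra|].
    apply wt_le; [generalize (D_rad U HU); lra|lia]. }
  destruct (solve_comp Ci vX (fun U => Rh2 (s U) (phi U)) HrX) as [gX [X1 [X2 X3]]]; auto; try lra.
  { intros U HU. now apply HR, Ha. }
  destruct (solve_comp (- Ci) vY (fun U => Rh3 (s U) (phi U)) HrY) as [gY [Y1 [Y2 Y3]]]; auto; try lra.
  { intros U HU. now apply HR, Ha. }
  exists (fun U => mk3 (gW U) (gX U) (gY U)). split; [|split; [|split]]; auto.
  split; [|split; [|split]]; auto. intros U HU. unfold in_ball. cbn [Wc Xc Yc mk3 fst snd].
  assert (Bd : forall n m y, (m < n)%Z -> (y <= C0 * K * wt n (rad U))%R -> (y <= 1 * wt m (rad U))%R).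
  { intros n m y Hnm Hy. generalize (wt_small n m U HU Hnm). generalize (wt_pos n (rad U)). nra. }
  split; [|split].
  - apply (Bd 7%Z); [lia|].
    apply (bound_W (fun U => Rh1 (s U) (phi U))); auto; try lra.
    intros V HV. now apply HR, Ha.
  - apply (Bd 4%Z); [lia|].
    apply (bound_X (fun U => Rh2 (s U) (phi U))); auto; try lra.
    intros V HV. now apply HR, Ha.
  - apply (Bd 4%Z); [lia|].
    apply (bound_Y (fun U => Rh3 (s U) (phi U))); auto; try lra.
    intros V HV. now apply HR, Ha.
Qed.

Definition close (m : R) (phi psi : C -> C3) := forall U, D U ->
  (Cmod (Wc (phi U) - Wc (psi U)) <= m * wt 6 (rad U))%R /\
  (Cmod (Xc (phi U) - Xc (psi U)) <= m * wt 3 (rad U))%R /\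
  (Cmod (Yc (phi U) - Yc (psi U)) <= m * wt 3 (rad U))%R.

(** The source differences have weights [min (7 + 6) (7 + 3) = 10] for [W] and
    [min (1 + 6) (4 + 3) = 7] for [X] and [Y]. Solving gives weight 7 throughout, strictly above 6
    and 3, and the gain yields the factor 1/2. *)
Lemma step_contracts (m : R) (phi phi' psi psi' : C -> C3) :
  (0 <= m)%R -> admissible phi -> admissible phi' -> admissible psi -> admissible psi' ->
  step_of phi psi -> step_of phi' psi' -> close m phi phi' -> close (m / 2) psi psi'.
Proof.
  intros Hm Ha Ha' Hb Hb' [S1 [S2 S3]] [T1 [T2 T3]] Hc.
  destruct (ball_decay psi Hb) as [D1 [D2 D3]]. destruct (ball_decay psi' Hb') as [E1 [E2 E3]].
  assert (CK : (0 < C0 * K)%R) by (apply Rmult_lt_0_compat; lra).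
  assert (Km : (0 <= 3 * K * m)%R) by nra.
  assert (dist : forall U, D U -> (dW (phi U) (phi' U) <= m * wt 6 (rad U))%R /\
    (dXY (phi U) (phi' U) <= 2 * (m * wt 3 (rad U)))%R).
  { intros U HU. destruct (Hc U HU) as [A [B C']]. unfold dW, dXY. split; lra. }
  assert (Lp : forall U, D U -> forall p q n y, (n <= p + 6)%Z -> (n <= q + 3)%Z ->
     (y <= K * (wt p (rad U) * dW (phi U) (phi' U) + wt q (rad U) * dXY (phi U) (phi' U)))%R ->
     (y <= 3 * K * m * wt n (rad U))%R).
  { intros U HU p q n y Hp Hq Hy. eapply Rle_trans; [exact Hy|].
    destruct (dist U HU) as [d1 d2]. assert (Hr := D_rad U HU).
    assert (L1 := wt_le _ _ (rad U) ltac:(lra) Hp). assert (L2 := wt_le _ _ (rad U) ltac:(lra) Hq).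
    rewrite wt_add in L1, L2.
    assert (Pp := wt_pos p (rad U)). assert (Pq := wt_pos q (rad U)).
    assert (A1 : (wt p (rad U) * dW (phi U) (phi' U) <= m * wt n (rad U))%R).
    { apply Rle_trans with (wt p (rad U) * (m * wt 6 (rad U)))%R; [apply Rmult_le_compat_l; lra|].
      replace (wt p (rad U) * (m * wt 6 (rad U)))%R with (m * (wt p (rad U) * wt 6 (rad U)))%R by ring.
      now apply Rmult_le_compat_l. }
    assert (A2 : (wt q (rad U) * dXY (phi U) (phi' U) <= 2 * (m * wt n (rad U)))%R).
    { apply Rle_trans with (wt q (rad U) * (2 * (m * wt 3 (rad U))))%R; [apply Rmult_le_compat_l; lra|].
      replace (wt q (rad U) * (2 * (m * wt 3 (rad U))))%R with (2 * (m * (wt q (rad U) * wt 3 (rad U))))%R by ring.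
      apply Rmult_le_compat_l; [lra|]. now apply Rmult_le_compat_l. }
    replace (3 * K * m * wt n (rad U))%R with (K * (m * wt n (rad U) + 2 * (m * wt n (rad U))))%R by ring.
    apply Rmult_le_compat_l; lra. }
  assert (Bd : forall U, D U -> forall n p y, (p < n)%Z -> (y <= C0 * (3 * K * m) * wt n (rad U))%R -> (y <= m / 2 * wt p (rad U))%R).
  { intros U HU n p y Hnp Hy. eapply Rle_trans; [exact Hy|].
    replace (C0 * (3 * K * m) * wt n (rad U))%R with (m / 2 * (6 * (C0 * K) * wt n (rad U)))%R by field.
    apply Rmult_le_compat_l; [lra|]. now apply wt_small. }
  intros U HU.
  assert (sum_decay : forall f g : C -> C, (forall U, D U -> (Cmod (f U) <= 1 * wt 1 (rad U))%R) ->
    (forall U, D U -> (Cmod (g U) <= 1 * wt 1 (rad U))%R) ->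
    exists B, forall U, D U -> (Cmod (f U - g U) <= B * wt 1 (rad U))%R).
  { intros f g Hf Hg. exists (1 + 1)%R. intros V HV. rewrite Rmult_plus_distr_r.
    apply Cmod_minus_le; auto. }
  split; [|split].
  - apply (Bd U HU 7%Z); [lia|].
    apply (bound_W (fun U => Rh1 (s U) (phi U) - Rh1 (s U) (phi' U)) (fun U => Wc (psi U) - Wc (psi' U))); auto.
    + intros V HV. eapply cder_eq; [apply cder_minus; [now apply S1|now apply T1]|]. cbv beta; ring.
    + intros V HV. apply (Lp V HV (6 + 1)%Z 7%Z); try lia. apply HR; auto; [apply Ha|apply Ha']; auto.
  - apply (Bd U HU 7%Z); [lia|].
    apply (bound_X (fun U => Rh2 (s U) (phi U) - Rh2 (s U) (phi' U)) (fun U => Xc (psi U) - Xc (psi' U))); auto.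
    + intros V HV. eapply cder_eq; [apply cder_minus; [now apply S2|now apply T2]|]. cbv beta; ring.
    + intros V HV. apply (Lp V HV (3 - 2)%Z (6 - 2)%Z); try lia. apply HR; auto; [apply Ha|apply Ha']; auto.
  - apply (Bd U HU 7%Z); [lia|].
    apply (bound_Y (fun U => Rh3 (s U) (phi U) - Rh3 (s U) (phi' U)) (fun U => Yc (psi U) - Yc (psi' U))); auto.
    + intros V HV. eapply cder_eq; [apply cder_minus; [now apply S3|now apply T3]|]. cbv beta; ring.
    + intros V HV. apply (Lp V HV (3 - 2)%Z (6 - 2)%Z); try lia. apply HR; auto; [apply Ha|apply Ha']; auto.
Qed.

Lemma zero_admissible : admissible (fun _ => mk3 0 0 0).
Proof.
  split; [|split; [|split]]; try apply hol_const.
  intros U HU. unfold in_ball, Wc, Xc, Yc, mk3; cbn [fst snd]. rewrite Cmod_0.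
  split; [|split]; rewrite Rmult_1_l; left; apply wt_pos.
Qed.

(** The next iterate exists only for an admissible one, so the recursion runs on iterates bundled
    with their admissibility. *)
Lemma picard_sequence : exists phi : nat -> C -> C3,
  (forall n, admissible (phi n)) /\ (forall n, step_of (phi n) (phi (S n))).
Proof.
  set (A := {phi | admissible phi}).
  assert (St : forall a : A, exists b : A, step_of (proj1_sig a) (proj1_sig b)).
  { intros [phi Ha]. destruct (step_exists phi Ha) as [psi [Hp Hs]]. now exists (exist _ psi Hp). }
  set (nxt := fun a => proj1_sig (constructive_indefinite_description _ (St a))).
  assert (Hn : forall a, step_of (proj1_sig a) (proj1_sig (nxt a))).
  { intros a. unfold nxt. now destruct (constructive_indefinite_description _ (St a)). }
  set (seq := fix seq n : A := match n with O => exist _ _ zero_admissible | S n => nxt (seq n) end).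
  exists (fun n => proj1_sig (seq n)). split.
  - intros n. apply proj2_sig.
  - intros n. apply Hn.
Qed.

Lemma picard_fixpoint : exists phi : C -> C3,
  inner_solution argf D phi /\ forall U, D U -> in_ball 1 6 3 (rad U) (phi U).
Proof.
  destruct picard_sequence as [phi [Ha Hs]].
  (* The initial 2 is the diameter of the unit ball. *)
  assert (Hc : forall n, close (2 * (1/2)^n) (phi n) (phi (S n))).
  { induction n as [|n IH].
    - intros U HU. destruct (proj2 (proj2 (proj2 (Ha 0%nat))) U HU) as [A [B E]].
      destruct (proj2 (proj2 (proj2 (Ha 1%nat))) U HU) as [A' [B' E']]. simpl.
      replace (2 * 1)%R with (1 + 1)%R by ring. rewrite !Rmult_plus_distr_r.
      split; [|split]; now apply Cmod_minus_le.
    - replace (2 * (1/2)^(S n))%R with (2 * (1/2)^n / 2)%R by (simpl; field).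
      apply (step_contracts _ (phi n) (phi (S n))); auto.
      generalize (pow_lt (1/2) n ltac:(lra)). lra. }
  assert (Hc1' : forall n U, D U -> (Cmod (Wc (phi (S n) U) - Wc (phi n U)) <= 2 * (1/2)^n)%R /\
    (Cmod (Xc (phi (S n) U) - Xc (phi n U)) <= 2 * (1/2)^n)%R /\
    (Cmod (Yc (phi (S n) U) - Yc (phi n U)) <= 2 * (1/2)^n)%R).
  { intros n U HU. destruct (Hc n U HU) as [A [B E]].
    assert (P := pow_lt (1/2) n ltac:(lra)).
    generalize (wt_le1 6 U HU ltac:(lia)) (wt_le1 3 U HU ltac:(lia)). intros L6 L3.
    rewrite (Cmod_minus_sym (Wc (phi (S n) U))), (Cmod_minus_sym (Xc (phi (S n) U))), (Cmod_minus_sym (Yc (phi (S n) U))).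
    split; [|split]; (eapply Rle_trans; [eassumption|]); nra. }
  assert (Lim0 : is_lim_seq (fun n => (1/2)^n)%R 0).
  { apply is_lim_seq_geom. rewrite Rabs_pos_eq; lra. }
  assert (Lim : forall c, is_lim_seq (fun n => c * (1/2)^n)%R 0).
  { intros c. replace 0%R with (c * 0)%R by ring. apply (is_lim_seq_scal_l _ c 0). exact Lim0. }
  assert (tele : forall u : nat -> C, (forall n, (Cmod (u (S n) - u n) <= 2 * (1/2)^n)%R) ->
    exists l, forall n, (Cmod (l - u n) <= 4 * (1/2)^n)%R).
  { intros u Hu. apply complex_cauchy; [apply Lim|].
    intros n m Hnm.
    (* The geometric tail is kept exactly, so that the induction on [m] closes. *)
    assert (T : (Cmod (u m - u n) <= 4 * (1/2)^n - 4 * (1/2)^m)%R).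
    { induction Hnm as [|m Hnm IH].
      - replace (u n - u n) with (RtoC 0) by ring. rewrite Cmod_0. lra.
      - replace (u (S m) - u n) with ((u (S m) - u m) + (u m - u n)) by ring.
        generalize (Cmod_triangle_le _ _ _ _ (Hu m) IH). simpl. lra. }
    generalize (pow_lt (1/2) m ltac:(lra)). lra. }
  assert (Hl : forall U, exists z, D U -> forall n, (Cmod (Wc z - Wc (phi n U)) <= 4 * (1/2)^n)%R /\
    (Cmod (Xc z - Xc (phi n U)) <= 4 * (1/2)^n)%R /\ (Cmod (Yc z - Yc (phi n U)) <= 4 * (1/2)^n)%R).
  { intros U. destruct (excluded_middle_informative (D U)) as [HU|N]; [|exists (mk3 0 0 0); tauto].
    destruct (tele (fun n => Wc (phi n U))) as [w Hw]; [intros; now apply Hc1'|].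
    destruct (tele (fun n => Xc (phi n U))) as [x Hx]; [intros; now apply Hc1'|].
    destruct (tele (fun n => Yc (phi n U))) as [y Hy]; [intros; now apply Hc1'|].
    exists (mk3 w x y). intros _ n. repeat split; auto. }
  set (p := fun U => proj1_sig (constructive_indefinite_description _ (Hl U))).
  assert (Hp : forall U, D U -> forall n, (Cmod (Wc (p U) - Wc (phi n U)) <= 4 * (1/2)^n)%R /\
    (Cmod (Xc (p U) - Xc (phi n U)) <= 4 * (1/2)^n)%R /\ (Cmod (Yc (p U) - Yc (phi n U)) <= 4 * (1/2)^n)%R).
  { intros U. unfold p. now destruct (constructive_indefinite_description _ (Hl U)). }
  clearbody p.
  assert (lim_le : forall (l : C) (u : nat -> C) (M : R), (forall n, (Cmod (l - u n) <= 4 * (1/2)^n)%R) ->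
    (forall n, (Cmod (u n) <= M)%R) -> (Cmod l <= M)%R).
  { intros l u M H1 H2. apply le_epsilon. intros e He.
    destruct (proj1 (is_lim_seq_Reals _ _) (Lim 4%R) e He) as [N HN].
    specialize (HN N (Nat.le_refl N)). unfold R_dist in HN. rewrite Rminus_0_r in HN.
    apply Rabs_def2 in HN. replace l with (u N + (l - u N)) by ring.
    apply Cmod_triangle_le; auto. generalize (H1 N). lra. }
  assert (Bp : forall U, D U -> in_ball 1 6 3 (rad U) (p U)).
  { intros U HU. split; [|split].
    - apply (lim_le _ (fun n => Wc (phi n U))); intros n; [now apply Hp|now apply Ha].
    - apply (lim_le _ (fun n => Xc (phi n U))); intros n; [now apply Hp|now apply Ha].
    - apply (lim_le _ (fun n => Yc (phi n U))); intros n; [now apply Hp|now apply Ha]. }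
  exists p. split; auto.
  set (Q := (4 + 12 * K)%R).
  (* The constant is 12 = 4 + 8: one coordinate in [dW], two in [dXY], with all weights bounded by
     1. *)
  assert (LR : forall n U, D U ->
    (Cmod (Rh1 (s U) (phi n U) - Rh1 (s U) (p U)) <= 12 * K * (1/2)^n)%R /\
    (Cmod (Rh2 (s U) (phi n U) - Rh2 (s U) (p U)) <= 12 * K * (1/2)^n)%R /\
    (Cmod (Rh3 (s U) (phi n U) - Rh3 (s U) (p U)) <= 12 * K * (1/2)^n)%R).
  { intros n U HU. destruct (HR U HU (phi n U)) as [_ [_ [_ [_ L]]]]; [now apply Ha|].
    destruct (L (p U) (Bp U HU)) as [L1 [L2 L3]]. destruct (Hp U HU n) as [P1 [P2 P3]].
    assert (d1 : (dW (phi n U) (p U) <= 4 * (1/2)^n)%R).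
    { unfold dW. now rewrite Cmod_minus_sym. }
    assert (d2 : (dXY (phi n U) (p U) <= 8 * (1/2)^n)%R).
    { unfold dXY. rewrite (Cmod_minus_sym (Xc _)), (Cmod_minus_sym (Yc _)). lra. }
    assert (G : forall i j y, (0 <= i)%Z -> (0 <= j)%Z ->
      (y <= K * (wt i (rad U) * dW (phi n U) (p U) + wt j (rad U) * dXY (phi n U) (p U)))%R ->
      (y <= 12 * K * (1/2)^n)%R).
    { intros i j y Hi Hj Hy. eapply Rle_trans; [exact Hy|].
      generalize (wt_le1 i U HU Hi) (wt_le1 j U HU Hj) (wt_pos i (rad U)) (wt_pos j (rad U))
        (dW_pos (phi n U) (p U)) (dXY_pos (phi n U) (p U)). intros.
      replace (12 * K * (1/2)^n)%R with (K * (4 * (1/2)^n + 8 * (1/2)^n))%R by ring.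
      apply Rmult_le_compat_l; [lra|]. apply Rplus_le_compat; nra. }
    split; [|split]; (eapply G; [| |eassumption]); lia. }
  (* The index shift matches the iteration: iterate [S n] solves the equation whose source is
     evaluated at iterate [n]. Functions and derivatives converge at a common geometric rate, so
     [hol_limit] applies. *)
  assert (key : forall (lam : C) (f : nat -> C -> C) (F : C -> C) (Rn : nat -> C -> C) (Rl : C -> C),
    (Cmod lam <= 1)%R ->
    (forall n U, D U -> cder (f (S n)) U (lam * f (S n) U + Rn n U)) ->
    (forall n, hol D (Rn n)) ->
    (forall n U, D U -> (Cmod (F U - f n U) <= 4 * (1/2)^n)%R) ->
    (forall n U, D U -> (Cmod (Rn n U - Rl U) <= 12 * K * (1/2)^n)%R) ->
    forall U, D U -> cder F U (lam * F U + Rl U)).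
  { intros lam f F Rn Rl Hlam Hf HRn HF HRl U HU.
    assert (pw : forall n, ((1/2)^(S n) <= (1/2)^n)%R).
    { intros n. simpl. generalize (pow_lt (1/2) n ltac:(lra)). lra. }
    apply (hol_limit D (fun n => f (S n)) (fun n U => lam * f (S n) U + Rn n U) F (fun U => lam * F U + Rl U)
      (fun n => Q * (1/2)^n)%R); auto.
    - apply HD.
    - intros n z Hz. split; auto. apply ccont_plus.
      + apply ccont_mult; [apply ccont_const|]. eapply cder_ccont. now apply Hf.
      + destruct (HRn n) as [R' HR']. eapply cder_ccont. now apply HR'.
    - intros n z Hz. rewrite Cmod_minus_sym. eapply Rle_trans; [now apply HF|].
      generalize (pw n) (pow_lt (1/2) n ltac:(lra)). unfold Q. nra.
    - intros n z Hz.
      replace (lam * f (S n) z + Rn n z - (lam * F z + Rl z)) with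
        (lam * - (F z - f (S n) z) + (Rn n z - Rl z)) by ring.
      apply Rle_trans with (1 * (4 * (1/2)^(S n)) + 12 * K * (1/2)^n)%R.
      + apply Cmod_triangle_le; auto. apply Cmod_mult_le; auto. rewrite Cmod_opp. auto.
      + generalize (pw n). unfold Q. lra. }
  intros U HU. split; [|split].
  - eapply cder_eq; [apply (key 0 (fun n u => Wc (phi n u)) (fun u => Wc (p u))
      (fun n u => Rh1 (s u) (phi n u)) (fun u => Rh1 (s u) (p u))); auto|cbv beta; unfold s; ring].
    + rewrite Cmod_0. lra.
    + intros n V HV. now apply (Hs n).
    + intros n. exact (proj1 (hol_R _ (Ha n))).
    + intros n V HV. now apply Hp.
    + intros n V HV. apply (LR n V HV).
  - apply (key Ci (fun n u => Xc (phi n u)) (fun u => Xc (p u))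
      (fun n u => Rh2 (s u) (phi n u)) (fun u => Rh2 (s u) (p u))); auto.
    + rewrite Cmod_Ci. lra.
    + intros n V HV. now apply (Hs n).
    + intros n. exact (proj1 (proj2 (hol_R _ (Ha n)))).
    + intros n V HV. now apply Hp.
    + intros n V HV. apply (LR n V HV).
  - apply (key (- Ci) (fun n u => Yc (phi n u)) (fun u => Yc (p u))
      (fun n u => Rh3 (s u) (phi n u)) (fun u => Rh3 (s u) (p u))); auto.
    + rewrite Cmod_opp, Cmod_Ci. lra.
    + intros n V HV. now apply (Hs n).
    + intros n. exact (proj2 (proj2 (hol_R _ (Ha n)))).
    + intros n V HV. now apply Hp.
    + intros n V HV. apply (LR n V HV).
Qed.

(** A fixed point is its own next iterate, so the gain of one weight can be kept instead of being
    spent on the radius. *)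
Lemma picard_bounds : exists phi : C -> C3,
  inner_solution argf D phi /\ forall U, D U -> in_ball (C0 * K) 7 4 (rad U) (phi U).
Proof.
  destruct picard_fixpoint as [phi [Hs HB]]. exists phi. split; auto.
  assert (Dc : forall n y U, (1 <= n)%Z -> D U -> (y <= 1 * wt n (rad U))%R -> (y <= 1 * wt 1 (rad U))%R).
  { intros n y U Hn HU Hy. eapply Rle_trans; [exact Hy|]. apply Rmult_le_compat_l; [lra|].
    apply wt_le; auto. generalize (D_rad U HU). lra. }
  intros U HU. split; [|split].
  - apply (bound_W (fun U => Rh1 (s U) (phi U)) (fun u => Wc (phi u))); [ | |lra| |auto].
    + intros V HV. eapply cder_eq; [apply (Hs V HV)|]. unfold s. ring.
    + exists 1%R. intros V HV. apply (Dc 6%Z); [lia|auto|]. now apply HB.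
    + intros V HV. apply (HR V HV _ (HB V HV)).
  - apply (bound_X (fun U => Rh2 (s U) (phi U)) (fun u => Xc (phi u))); [ | |lra|auto| |auto].
    + intros V HV. apply (Hs V HV).
    + exists 1%R. intros V HV. apply (Dc 3%Z); [lia|auto|]. now apply HB.
    + intros V HV. apply (HR V HV _ (HB V HV)).
  - apply (bound_Y (fun U => Rh3 (s U) (phi U)) (fun u => Yc (phi u))); [ | |lra|auto| |auto].
    + intros V HV. apply (Hs V HV).
    + exists 1%R. intros V HV. apply (Dc 3%Z); [lia|auto|]. now apply HB.
    + intros V HV. apply (HR V HV _ (HB V HV)).
Qed.

End Picard.

(** The constants are fixed before the branch and the domain are chosen: they depend only on the ray
    directions and on [c1]. *)
Lemma inner_existence (c1 : R) (vW vX vY : C) :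
  (0 < c1)%R -> (0 < Re (Ci * vX))%R -> (0 < Re (- Ci * vY))%R ->
  exists b rho : R, (0 < b)%R /\ (1 <= rho)%R /\
  forall argf D, good_domain argf D rho c1 vW vX vY ->
  exists phi, inner_solution argf D phi /\ forall U, D U -> in_ball b 8 4 (rad U) (phi U).
Proof.
  intros Hc HvX HvY.
  destruct (Rh_estimates 1 6 3) as [K [r1 [HK [Hr1 HR]]]]; try lia; try lra.
  set (a1 := (Cmod vW * Rpower c1 (- IZR (7 + 3) / 3) * 3)%R).
  set (a2 := (Cmod vX * Rpower c1 (- IZR 4 / 3) / Re (Ci * vX))%R).
  set (a3 := (Cmod vX * Rpower c1 (- IZR 7 / 3) / Re (Ci * vX))%R).
  set (a4 := (Cmod vY * Rpower c1 (- IZR 4 / 3) / Re (- Ci * vY))%R).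
  set (a5 := (Cmod vY * Rpower c1 (- IZR 7 / 3) / Re (- Ci * vY))%R).
  assert (P : forall v e, (0 <= Cmod v * Rpower c1 e)%R).
  { intros v e. apply Rmult_le_pos; [apply Cmod_ge_0|left; apply Rpower_pos]. }
  assert (H1 : (0 <= a1)%R) by (unfold a1; generalize (P vW (- IZR (7 + 3) / 3)%R); lra).
  assert (H2 : (0 <= a2)%R) by (now apply Rcomplements.Rdiv_le_0_compat).
  assert (H3 : (0 <= a3)%R) by (now apply Rcomplements.Rdiv_le_0_compat).
  assert (H4 : (0 <= a4)%R) by (now apply Rcomplements.Rdiv_le_0_compat).
  assert (H5 : (0 <= a5)%R) by (now apply Rcomplements.Rdiv_le_0_compat).
  set (C0 := (a1 + a2 + a3 + a4 + a5 + 1)%R). assert (HC0 : (0 < C0)%R) by (unfold C0; lra).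
  assert (CK : (0 < C0 * K)%R) by (apply Rmult_lt_0_compat; lra).
  (* On the improved ball [x = 4], so the first component of the field has weight 11 = 8 + 3, and
     one more integration gives [W] its final weight 8. *)
  destruct (Rh_estimates (C0 * K) 7 4) as [K2 [r2 [HK2 [Hr2 HR2]]]]; try lia; try lra.
  set (C2 := (Cmod vW * Rpower c1 (- IZR (8 + 3) / 3) * 3)%R).
  assert (HC2 : (0 <= C2)%R) by (unfold C2; generalize (P vW (- IZR (8 + 3) / 3)%R); lra).
  exists (C2 * K2 + C0 * K)%R, (r1 + r2 + 6 * (C0 * K))%R.
  assert (Q : (0 <= C2 * K2)%R) by (apply Rmult_le_pos; lra).
  split; [lra|]. split; [lra|]. intros argf D HD.
  assert (Hrad : forall U, D U -> (r1 + r2 + 6 * (C0 * K) <= rad U)%R) by (intros U HU; now apply HD).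
  destruct (picard_bounds argf D (r1 + r2 + 6 * (C0 * K)) c1 vW vX vY K C0) as [phi [Hs HB]];
    auto; try (change C0 with (a1 + a2 + a3 + a4 + a5 + 1)%R; fold a1 a2 a3 a4 a5; lra).
  { split; lra. }
  { intros U HU z Hz. specialize (Hrad U HU).
    assert (E := HR (cbrt argf U)). rewrite Cmod_cbrt in E. apply E; auto. lra. }
  exists phi. split; auto. intros U HU. destruct (HB U HU) as [B1 [B2 B3]].
  assert (Hw : forall y, (y <= C0 * K * wt 4 (rad U))%R -> (y <= (C2 * K2 + C0 * K) * wt 4 (rad U))%R).
  { intros y Hy. generalize (wt_pos 4 (rad U)). nra. }
  split; [|split; auto].
  apply Rle_trans with (C2 * K2 * wt 8 (rad U))%R; [|generalize (wt_pos 8 (rad U)); nra].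
  apply (linear_bound_power D vW c1 K2 (C0 * K) 8 (fun u => Wc (phi u)) (fun u => Rh1 (cbrt argf u) (phi u))); auto; try lia.
  - apply HD.
  - intros V HV. now apply HD.
  - intros V HV. apply (Hs V HV).
  - intros V HV. destruct (HB V HV) as [B _]. eapply Rle_trans; [exact B|].
    apply Rmult_le_compat_l; [lra|]. apply wt_le; [generalize (Hrad V HV); lra|lia].
  - intros V HV. assert (E := HR2 (cbrt argf V)). rewrite Cmod_cbrt in E.
    destruct (E ltac:(generalize (Hrad V HV); lra) (phi V) (HB V HV)) as [_ [E1 _]]. exact E1.
Qed.

(** * The difference of two solutions *)

Lemma rder_Cmod_sq (f : R -> C) (t : R) (l : C) :
  rder f t l -> is_derive (fun x => Cmod (f x) * Cmod (f x))%R t (2 * Re (Cconj (f t) * l))%R.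
Proof.
  intros [F1 F2]. apply is_derive_ext with (fun x => Re (f x) * Re (f x) + Im (f x) * Im (f x))%R.
  - intros x. now rewrite Cmod_sq.
  - rewrite is_derive_Reals in *.
    replace (2 * Re (Cconj (f t) * l))%R with
      ((Re l * Re (f t) + Re (f t) * Re l) + (Im l * Im (f t) + Im (f t) * Im l))%R
      by (unfold Re, Im; simpl; ring).
    apply (derivable_pt_lim_plus (fun x => Re (f x) * Re (f x))%R (fun x => Im (f x) * Im (f x))%R).
    + apply (derivable_pt_lim_mult (fun x => Re (f x)) (fun x => Re (f x))); auto.
    + apply (derivable_pt_lim_mult (fun x => Im (f x)) (fun x => Im (f x))); auto.
Qed.

(** The squared modulus is used because the modulus need not be differentiable at zeros of [f]:
    [|f|^2 exp (-2 k)] is nonincreasing. *)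
Lemma gronwall (f f' : R -> C) (k k' : R -> R) (a b : R) : (a <= b)%R ->
  (forall t, (a <= t <= b)%R -> rder f t (f' t)) ->
  (forall t, (a <= t <= b)%R -> is_derive k t (k' t)) ->
  (forall t, (a <= t <= b)%R -> (Cmod (f' t) <= k' t * Cmod (f t))%R) ->
  (Cmod (f b) <= Cmod (f a) * exp (k b - k a))%R.
Proof.
  intros Hab Hf Hk Hle.
  set (N := fun t => (- (Cmod (f t) * Cmod (f t)) * exp (- 2 * k t))%R).
  assert (HN : (N a <= N b)%R).
  { apply (nonneg_derive_le N (fun t => (- (2 * Re (Cconj (f t) * f' t)) + 2 * k' t * (Cmod (f t) * Cmod (f t)))
      * exp (- 2 * k t))%R); auto.
    - intros t Ht. unfold N. assert (A := rder_Cmod_sq f t _ (Hf t Ht)). assert (B := Hk t Ht).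
      rewrite is_derive_Reals in *.
      replace ((- (2 * Re (Cconj (f t) * f' t)) + 2 * k' t * (Cmod (f t) * Cmod (f t))) * exp (- 2 * k t))%R
       with ((- (2 * Re (Cconj (f t) * f' t))) * exp (- 2 * k t) +
         (- (Cmod (f t) * Cmod (f t))) * (exp (- 2 * k t) * (- 2 * k' t)))%R by ring.
      apply (derivable_pt_lim_mult (fun x => - (Cmod (f x) * Cmod (f x)))%R (fun x => exp (- 2 * k x))).
      + now apply (derivable_pt_lim_opp (fun x => Cmod (f x) * Cmod (f x))%R).
      + apply (derivable_pt_lim_comp (fun x => - 2 * k x)%R exp).
        * now apply (derivable_pt_lim_scal k).
        * apply derivable_pt_lim_exp.
    - intros t Ht. apply Rmult_le_pos; [|left; apply exp_pos].
      assert (A : (Re (Cconj (f t) * f' t) <= Cmod (f t) * (k' t * Cmod (f t)))%R).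
      { eapply Rle_trans; [apply Re_le_Cmod'|]. rewrite Cmod_mult, Cmod_conj.
        apply Rmult_le_compat_l; [apply Cmod_ge_0|auto]. }
      lra. }
  unfold N in HN.
  assert (Pa := Cmod_ge_0 (f a)). assert (Pb := Cmod_ge_0 (f b)).
  set (E := exp (k b - k a)) in *. assert (PE : (0 < E)%R) by apply exp_pos.
  assert (Eq : exp (- 2 * k a) = (E * E * exp (- 2 * k b))%R).
  { unfold E. rewrite <- !exp_plus. f_equal. ring. }
  rewrite Eq in HN. assert (Pk := exp_pos (- 2 * k b)).
  assert (S : (Cmod (f b) * Cmod (f b) <= (Cmod (f a) * E) * (Cmod (f a) * E))%R).
  { apply Rmult_le_reg_r with (exp (- 2 * k b)); auto. lra. }
  assert (Q : (0 <= Cmod (f a) * E)%R) by nra.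
  apply Rnot_lt_le. intros L. nra.
Qed.

(** By [gronwall] the speed is at most [k' |f a| exp (k - k a)], an exact derivative, and the mean
    value inequality integrates it. *)
Lemma gronwall_diff (f f' : R -> C) (k k' : R -> R) (a b : R) : (a <= b)%R ->
  (forall t, (a <= t <= b)%R -> rder f t (f' t)) ->
  (forall t, (a <= t <= b)%R -> is_derive k t (k' t)) ->
  (forall t, (a <= t <= b)%R -> (0 <= k' t)%R) ->
  (forall t, (a <= t <= b)%R -> (Cmod (f' t) <= k' t * Cmod (f t))%R) ->
  (Cmod (f b - f a) <= Cmod (f a) * (exp (k b - k a) - 1))%R.
Proof.
  intros Hab Hf Hk Hk0 Hle.
  assert (M := mvi f f' (fun t => Cmod (f a) * exp (k t - k a))%R
    (fun t => Cmod (f a) * (exp (k t - k a) * k' t))%R a b Hab Hf).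
  cbv beta in M. rewrite Rminus_diag, exp_0 in M.
  replace (Cmod (f a) * (exp (k b - k a) - 1))%R with (Cmod (f a) * exp (k b - k a) - Cmod (f a) * 1)%R by ring.
  apply M.
  - intros t Ht. assert (B := Hk t Ht). rewrite is_derive_Reals in *.
    apply (derivable_pt_lim_scal (fun x => exp (k x - k a))).
    apply (derivable_pt_lim_comp (fun x => k x - k a)%R exp).
    + replace (k' t) with (k' t - 0)%R by ring.
      apply (derivable_pt_lim_minus k (fun _ => k a)); auto. apply derivable_pt_lim_const.
    + apply derivable_pt_lim_exp.
  - intros t Ht. eapply Rle_trans; [now apply Hle|].
    assert (G := gronwall f f' k k' a t ltac:(lra)
      ltac:(intros; apply Hf; lra) ltac:(intros; apply Hk; lra) ltac:(intros; apply Hle; lra)).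
    specialize (Hk0 t Ht). nra.
Qed.

Lemma pow6_lt (a b : R) : (0 < a < b)%R -> (a ^ 6 < b ^ 6)%R.
Proof.
  intros H. assert (H2 : (0 < a * a < b * b)%R) by (split; nra).
  assert (H4 : (0 < (a * a) * (a * a) < (b * b) * (b * b))%R) by (split; nra).
  replace (a ^ 6)%R with ((a * a) * (a * a) * (a * a))%R by ring.
  replace (b ^ 6)%R with ((b * b) * (b * b) * (b * b))%R by ring. nra.
Qed.

(** From [exp (- x) >= 1 - x], which bounds [exp x] by [1 / (1 - x)]. *)
Lemma exp_m1_le (x : R) : (0 <= x <= 1/2)%R -> (exp x - 1 <= 2 * x)%R.
Proof.
  intros H. assert (E := exp_ineq1_le (- x)). assert (P := exp_pos x).
  assert (Q : (exp x * exp (- x) = 1)%R) by (rewrite <- exp_plus, Rplus_opp_r; apply exp_0).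
  assert (L : (exp x * (1 - x) <= 1)%R) by (rewrite <- Q; apply Rmult_le_compat_l; lra).
  nra.
Qed.

(** The part below the real axis that is common to the neighbourhoods of both outer domains. *)
Definition sector (T m : R) (U : C) : Prop := (T * Rabs (Re U) + m < - Im U)%R.

(** Comparable with [|U|] on a sector, but increasing at exactly unit speed along downward rays. *)
Definition depth (U : C) : R := (- Im U)%R.

Lemma depth_le_Cmod (U : C) : (depth U <= Cmod U)%R.
Proof.
  unfold depth. generalize (im_le_Cmod U) (Rle_abs (- Im U)). rewrite Rabs_Ropp. lra.
Qed.

Lemma depth_down (U : C) (t : R) : depth (U + RtoC t * - Ci) = (depth U + t)%R.
Proof. unfold depth, Im. simpl. ring. Qed.

Section Difference.
Variables (T m K b : R) (w x y hW hX hY : C -> C).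
Hypothesis HT : (0 < T)%R.
Hypothesis HK : (1 <= K)%R.
Let E := sector T m.
Hypothesis Hw : forall U, E U -> cder w U (hW U).
Hypothesis Hx : forall U, E U -> cder x U (Ci * x U + hX U).
Hypothesis Hy : forall U, E U -> cder y U (- Ci * y U + hY U).
Local Notation tw n U := (Rpower (depth U) (n / 3)).
Hypothesis HhW : forall U, E U ->
  (Cmod (hW U) <= K * (tw (-9) U * Cmod (w U) + tw (-7) U * (Cmod (x U) + Cmod (y U))))%R.
Hypothesis HhX : forall U, E U ->
  (Cmod (hX U) <= K * (tw (-2) U * Cmod (w U) + tw (-6) U * (Cmod (x U) + Cmod (y U))))%R.
Hypothesis HhY : forall U, E U ->
  (Cmod (hY U) <= K * (tw (-2) U * Cmod (w U) + tw (-6) U * (Cmod (x U) + Cmod (y U))))%R.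
Hypothesis Hbw : forall U, E U -> (Cmod (w U) <= b * tw (-8) U)%R.
Hypothesis Hbx : forall U, E U -> (Cmod (x U) <= b * tw (-4) U)%R.
Let K3 : R := (6 * K * K + 2 * K)%R.
Hypothesis Hm : ((3 * K) ^ 6 <= m /\ 9 * K <= Rpower m (2/3) /\ 4 * K3 <= m)%R.

Lemma m_ge1 : (1 <= m)%R.
Proof. unfold K3 in Hm. nra. Qed.

Lemma depth_ge (U : C) : E U -> (m <= depth U)%R.
Proof.
  intros H. unfold E, sector in H. unfold depth.
  assert (0 <= T * Rabs (Re U))%R by (apply Rmult_le_pos; [lra|apply Rabs_pos]). lra.
Qed.

Lemma E_down (U : C) (t : R) : E U -> (0 <= t)%R -> E (U + RtoC t * - Ci).
Proof.
  unfold E, sector. intros H Ht.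
  replace (Re (U + RtoC t * - Ci)) with (Re U) by (unfold Re; simpl; ring).
  replace (- Im (U + RtoC t * - Ci))%R with (- Im U + t)%R by (unfold Im; simpl; ring). lra.
Qed.

Lemma rder_down (g h : C -> C) (U : C) : E U -> (forall U, E U -> cder g U (h U)) ->
  forall t, (0 <= t)%R -> rder (fun t => g (U + RtoC t * - Ci)) t (- Ci * h (U + RtoC t * - Ci)).
Proof. intros HU Hg t Ht. apply cder_rder. apply Hg. now apply E_down. Qed.

(** Lyapunov function: it increases downwards and tends to [0], hence is nonpositive. *)
Let V (U : C) : R := (Cmod (x U) * Cmod (x U) + depth U * depth U * (Cmod (w U) * Cmod (w U))
  - Cmod (y U) * Cmod (y U))%R.

(** The equations involve thirds of powers of the depth, while the derivative [2 depth |w|^2] of the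
    weighted term calls for its square root; both are integer powers of [p]. *)
Lemma sixth_root (U : C) : E U -> let p := Rpower (depth U) (1/6) in
  (3 * K <= p)%R /\ depth U = (p ^ 6)%R /\ forall n : nat, tw (- INR n) U = (/ p ^ (2 * n))%R.
Proof.
  intros HU p. assert (Hd := depth_ge U HU). assert (M1 := m_ge1).
  assert (Pp : (0 < p)%R) by apply Rpower_pos.
  assert (E6 : depth U = (p ^ 6)%R).
  { unfold p. rewrite <- Rpower_pow, Rpower_mult by apply Rpower_pos.
    replace (1 / 6 * INR 6)%R with 1%R by (simpl; field). now rewrite Rpower_1 by lra. }
  split; [|split; auto].
  - apply Rnot_lt_le. intros L. assert (p ^ 6 < (3 * K) ^ 6)%R by (apply pow6_lt; lra).
    lra.
  - intros n. rewrite E6 at 1. rewrite <- (Rpower_pow 6) by auto. rewrite Rpower_mult.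
    rewrite <- Rpower_pow by auto. rewrite <- Rpower_Ropp. f_equal.
    rewrite mult_INR. simpl (INR 6). simpl (INR 2). field.
Qed.

Lemma Re_pair_le (a h : C) : (- (Cmod a * Cmod h) <= Re (Cconj a * (- Ci * h)))%R.
Proof.
  assert (H := re_le_Cmod (Cconj a * (- Ci * h))).
  rewrite !Cmod_mult, Cmod_conj, Cmod_opp, Cmod_Ci, Rmult_1_l in H.
  generalize (Rle_abs (- Re (Cconj a * (- Ci * h)))). rewrite Rabs_Ropp. lra.
Qed.

(** The source terms contribute at most [(1/3) (a + c + n)^2], which is at most [a^2 + c^2 + n^2].
    This is where the constant 1/3, hence the condition [p >= 3 K], comes from. *)
Lemma form_increasing (a c n hx hy hw : R) : (0 <= a)%R -> (0 <= c)%R -> (0 <= n)%R ->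
  (hx <= 1/3 * (n + (a + c)))%R -> (hy <= 1/3 * (n + (a + c)))%R -> (hw <= 1/3 * (n + (a + c)))%R ->
  (0 <= 2 * (a * a - a * hx) + 2 * (n * n - n * hw) + 2 * (c * c - c * hy))%R.
Proof.
  intros Ha Hc Hn Hx' Hy' Hw'.
  assert (a * hx <= a * (1/3 * (n + (a + c))))%R by (apply Rmult_le_compat_l; lra).
  assert (c * hy <= c * (1/3 * (n + (a + c))))%R by (apply Rmult_le_compat_l; lra).
  assert (n * hw <= n * (1/3 * (n + (a + c))))%R by (apply Rmult_le_compat_l; lra).
  assert (0 <= (a - c) * (a - c))%R by apply Rle_0_sqr.
  assert (0 <= (a - n) * (a - n))%R by apply Rle_0_sqr.
  assert (0 <= (c - n) * (c - n))%R by apply Rle_0_sqr. nra.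
Qed.

(** In the direction [-i] the linear parts all push [V] upwards: [x] expands, [-|y|^2] increases
    because [y] contracts, and the neutral [w] contributes through its weight, whose derivative
    gives [2 depth |w|^2]. *)
Lemma V_derive (U : C) (t : R) : E U -> (0 <= t)%R ->
  exists l, is_derive (fun t => V (U + RtoC t * - Ci)) t l /\ (0 <= l)%R.
Proof.
  intros HU Ht. set (Ut := U + RtoC t * - Ci). assert (HUt : E Ut) by now apply E_down.
  assert (A := rder_Cmod_sq _ _ _ (rder_down x _ U HU Hx t Ht)).
  assert (B := rder_Cmod_sq _ _ _ (rder_down w _ U HU Hw t Ht)).
  assert (D := rder_Cmod_sq _ _ _ (rder_down y _ U HU Hy t Ht)).
  cbv beta in A, B, D. fold Ut in A, B, D.
  eexists. split.
  - apply is_derive_ext with (fun t => Cmod (x (U + RtoC t * - Ci)) * Cmod (x (U + RtoC t * - Ci)) +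
      ((depth U + t) * (depth U + t)) * (Cmod (w (U + RtoC t * - Ci)) * Cmod (w (U + RtoC t * - Ci)))
      - Cmod (y (U + RtoC t * - Ci)) * Cmod (y (U + RtoC t * - Ci)))%R.
    { intros r. unfold V. now rewrite depth_down. }
    rewrite is_derive_Reals in *.
    apply (derivable_pt_lim_minus (fun t => Cmod (x (U + RtoC t * - Ci)%C) * Cmod (x (U + RtoC t * - Ci)%C) +
      ((depth U + t) * (depth U + t)) * (Cmod (w (U + RtoC t * - Ci)%C) * Cmod (w (U + RtoC t * - Ci)%C)))%R
      (fun t => Cmod (y (U + RtoC t * - Ci)%C) * Cmod (y (U + RtoC t * - Ci)%C))%R); [|exact D].
    apply (derivable_pt_lim_plus (fun t => Cmod (x (U + RtoC t * - Ci)%C) * Cmod (x (U + RtoC t * - Ci)%C))%R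
      (fun t => ((depth U + t) * (depth U + t)) * (Cmod (w (U + RtoC t * - Ci)%C) * Cmod (w (U + RtoC t * - Ci)%C)))%R);
      [exact A|].
    apply (derivable_pt_lim_mult (fun t => (depth U + t) * (depth U + t))%R
      (fun t => Cmod (w (U + RtoC t * - Ci)%C) * Cmod (w (U + RtoC t * - Ci)%C))%R); [|exact B].
    apply (is_derive_Reals (fun t => (depth U + t) * (depth U + t))%R t (2 * (depth U + t))%R).
    auto_derive; auto. ring.
  - fold Ut. replace (depth U + t)%R with (depth Ut) by apply depth_down.
    destruct (sixth_root Ut HUt) as [P3 [E6 Ep]]. set (p := Rpower (depth Ut) (1/6)) in *.
    assert (HK' := HK).
    assert (F1 := HhX Ut HUt). assert (F2 := HhY Ut HUt). assert (F3 := HhW Ut HUt).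
    assert (T2' : Rpower (depth Ut) (-2 / 3) = (/ p ^ 4)%R).
    { rewrite <- (Ep 2%nat : _ = / p ^ 4)%R. f_equal.  }
    assert (T6' : Rpower (depth Ut) (-6 / 3) = (/ p ^ 12)%R).
    { rewrite <- (Ep 6%nat : _ = / p ^ 12)%R. f_equal. simpl. field. }
    assert (T7' : Rpower (depth Ut) (-7 / 3) = (/ p ^ 14)%R).
    { rewrite <- (Ep 7%nat : _ = / p ^ 14)%R. f_equal. simpl. field. }
    assert (T9' : Rpower (depth Ut) (-9 / 3) = (/ p ^ 18)%R).
    { rewrite <- (Ep 9%nat : _ = / p ^ 18)%R. f_equal. simpl. field. }
    clear Ep. rewrite T2', T6' in F1, F2. rewrite T9', T7' in F3. clear T2' T6' T7' T9'.
    assert (R1 := Re_pair_le (x Ut) (hX Ut)). assert (R2 := Re_pair_le (w Ut) (hW Ut)).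
    assert (R3 := Re_pair_le (- y Ut) (hY Ut)). rewrite Cmod_opp in R3.
    assert (Ex : Re (Cconj (x Ut) * (- Ci * (Ci * x Ut + hX Ut))) =
      (Cmod (x Ut) * Cmod (x Ut) + Re (Cconj (x Ut) * (- Ci * hX Ut)))%R).
    { rewrite Cmod_sq. unfold Re, Im. simpl. ring. }
    assert (Ey : Re (Cconj (y Ut) * (- Ci * (- Ci * y Ut + hY Ut))) =
      (- (Cmod (y Ut) * Cmod (y Ut)) - Re (Cconj (- y Ut) * (- Ci * hY Ut)))%R).
    { rewrite Cmod_sq. unfold Re, Im. simpl. ring. }
    rewrite Ex, Ey. clear Ex Ey A B D.
    assert (a0 := Cmod_ge_0 (x Ut)). assert (c0 := Cmod_ge_0 (y Ut)). assert (o0 := Cmod_ge_0 (w Ut)).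
    set (a := Cmod (x Ut)) in *. set (c := Cmod (y Ut)) in *. set (o := Cmod (w Ut)) in *.
    set (hx := Cmod (hX Ut)) in *. set (hy := Cmod (hY Ut)) in *. set (hw := Cmod (hW Ut)) in *.
    rewrite E6.
    set (u := (/ p)%R). assert (Pp : (0 < p)%R) by lra.
    assert (Pu : (0 < u)%R) by (apply Rinv_0_lt_compat; lra).
    assert (Ku : (K * u <= 1/3)%R).
    { apply Rmult_le_reg_r with p; auto. unfold u. rewrite Rmult_assoc, Rinv_l by lra. lra. }
    assert (u1 : (u <= 1)%R) by nra.
    assert (Hpow : forall n, (K * u ^ (S n) <= 1/3)%R).
    { intros n. simpl. assert (un : (u ^ n <= 1)%R) by (rewrite <- (pow1 n); apply pow_incr; lra).
      assert (un0 : (0 < u ^ n)%R) by now apply pow_lt. nra. }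
    (* [n] is the square root of the depth times [|w|], the quantity whose square appears in the
       derivative of [V]. In these variables all source coefficients are [K] times positive powers
       of [u], hence at most 1/3. *)
    set (n := (p ^ 3 * o)%R). assert (n0 : (0 <= n)%R) by (apply Rmult_le_pos; auto; left; now apply pow_lt).
    assert (Eo : o = (u ^ 3 * n)%R) by (unfold n, u; field; lra).
    assert (hx1 : (hx <= 1/3 * (n + (a + c)))%R).
    { eapply Rle_trans; [exact F1|].
      replace (K * (/ p ^ 4 * o + / p ^ 12 * (a + c)))%R with (K * u ^ 7 * n + K * u ^ 12 * (a + c))%R
        by (rewrite Eo; unfold u; field; lra).
      generalize (Hpow 6%nat) (Hpow 11%nat). nra. }
    assert (hy1 : (hy <= 1/3 * (n + (a + c)))%R).
    { eapply Rle_trans; [exact F2|].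
      replace (K * (/ p ^ 4 * o + / p ^ 12 * (a + c)))%R with (K * u ^ 7 * n + K * u ^ 12 * (a + c))%R
        by (rewrite Eo; unfold u; field; lra).
      generalize (Hpow 6%nat) (Hpow 11%nat). nra. }
    assert (hw1 : (p ^ 9 * hw <= 1/3 * (n + (a + c)))%R).
    { apply Rle_trans with (p ^ 9 * (K * (/ p ^ 18 * o + / p ^ 14 * (a + c))))%R.
      - apply Rmult_le_compat_l; auto. left. now apply pow_lt.
      - replace (p ^ 9 * (K * (/ p ^ 18 * o + / p ^ 14 * (a + c))))%R with (K * u ^ 12 * n + K * u ^ 5 * (a + c))%R
          by (rewrite Eo; unfold u; field; lra).
        generalize (Hpow 11%nat) (Hpow 4%nat). nra. }
    eapply Rle_trans; [apply (form_increasing a c n hx hy (p ^ 9 * hw)); auto|].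
    assert (En : (2 * (n * n) = 2 * p ^ 6 * (o * o))%R) by (unfold n; ring).
    assert (Enw : (n * (p ^ 9 * hw) = p ^ 6 * p ^ 6 * (o * hw))%R) by (unfold n; ring).
    assert (P12 : (0 < p ^ 6 * p ^ 6)%R) by (apply Rmult_lt_0_compat; now apply pow_lt).
    assert (R2' : (p ^ 6 * p ^ 6 * - (o * hw) <= p ^ 6 * p ^ 6 * Re (Cconj (w Ut) * (- Ci * hW Ut)))%R)
      by (apply Rmult_le_compat_l; lra).
    lra.
Qed.

Lemma V_le0 (U : C) : E U -> (V U <= 0)%R.
Proof.
  intros HU. assert (Hd := depth_ge U HU). assert (M1 := m_ge1).
  (* At the bottom of the ray [|x|^2] is [O(depth^(-8/3))] and [depth^2 |w|^2] is
     [O(depth^(-10/3))], while [-|y|^2] has the favourable sign. *)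
  apply (le_of_power_decay _ 0 (2 * (b * b)) (depth U) (8/3)); try lra.
  intros t Ht. set (Ut := U + RtoC t * - Ci). assert (HUt : E Ut) by now apply E_down.
  assert (M : (V U <= V Ut)%R).
  { assert (Hd' : forall r, exists l, (0 <= r)%R -> is_derive (fun t => V (U + RtoC t * - Ci)) r l /\ (0 <= l)%R).
    { intros r. destruct (Rle_or_lt 0 r) as [P|P].
      - destruct (V_derive U r HU P) as [l Hl]. now exists l.
      - exists 0%R. lra. }
    set (g' := fun r => proj1_sig (constructive_indefinite_description _ (Hd' r))).
    assert (Hg : forall r, (0 <= r)%R -> is_derive (fun t => V (U + RtoC t * - Ci)) r (g' r) /\ (0 <= g' r)%R).
    { intros r. unfold g'. now destruct (constructive_indefinite_description _ (Hd' r)). }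
    generalize (nonneg_derive_le (fun t => V (U + RtoC t * - Ci)) g' 0 t Ht
      ltac:(intros r Hr; apply Hg; lra) ltac:(intros r Hr; apply Hg; lra)).
    cbv beta. now rewrite Cmult_0_l, Cplus_0_r. }
  eapply Rle_trans; [exact M|]. unfold V. rewrite <- (depth_down U t). fold Ut.
  assert (Hdt := depth_ge Ut HUt).
  assert (A := Hbw Ut HUt). assert (B := Hbx Ut HUt).
  assert (a0 := Cmod_ge_0 (x Ut)). assert (o0 := Cmod_ge_0 (w Ut)). assert (c0 := Cmod_ge_0 (y Ut)).
  assert (A2 : (Cmod (w Ut) * Cmod (w Ut) <= b * b * Rpower (depth Ut) (-16/3))%R).
  { replace (-16/3)%R with (-8/3 + -8/3)%R by lra. rewrite Rpower_plus.
    replace (b * b * (Rpower (depth Ut) (-8/3) * Rpower (depth Ut) (-8/3)))%R with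
      ((b * Rpower (depth Ut) (-8/3)) * (b * Rpower (depth Ut) (-8/3)))%R by ring.
    now apply Rmult_le_compat. }
  assert (B2 : (Cmod (x Ut) * Cmod (x Ut) <= b * b * Rpower (depth Ut) (-8/3))%R).
  { replace (-8/3)%R with (-4/3 + -4/3)%R by lra. rewrite Rpower_plus.
    replace (b * b * (Rpower (depth Ut) (-4/3) * Rpower (depth Ut) (-4/3)))%R with
      ((b * Rpower (depth Ut) (-4/3)) * (b * Rpower (depth Ut) (-4/3)))%R by ring.
    now apply Rmult_le_compat. }
  assert (D2 : (depth Ut * depth Ut * Rpower (depth Ut) (-16/3) <= Rpower (depth Ut) (-8/3))%R).
  { replace (depth Ut * depth Ut)%R with (Rpower (depth Ut) 2).
    - rewrite <- Rpower_plus. apply Rpower_1_anti; lra.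
    - replace 2%R with (1 + 1)%R by ring. rewrite Rpower_plus, Rpower_1; lra. }
  assert (C2 : (depth Ut * depth Ut * (Cmod (w Ut) * Cmod (w Ut)) <= b * b * Rpower (depth Ut) (-8/3))%R).
  { apply Rle_trans with (depth Ut * depth Ut * (b * b * Rpower (depth Ut) (-16/3)))%R.
    - apply Rmult_le_compat_l; auto. nra.
    - replace (depth Ut * depth Ut * (b * b * Rpower (depth Ut) (-16/3)))%R with
       (b * b * (depth Ut * depth Ut * Rpower (depth Ut) (-16/3)))%R by ring.
      apply Rmult_le_compat_l; auto. nra. }
  replace (-(8/3))%R with (-8/3)%R by lra. nra.
Qed.

(** * Asymptotics of the contracting component along vertical rays *)

Lemma cone (U : C) : E U -> (Cmod (x U) <= Cmod (y U))%R /\ (depth U * Cmod (w U) <= Cmod (y U))%R.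
Proof.
  intros HU. assert (H := V_le0 U HU). unfold V in H.
  assert (Hd := depth_ge U HU). assert (M1 := m_ge1).
  assert (a0 := Cmod_ge_0 (x U)). assert (o0 := Cmod_ge_0 (w U)). assert (c0 := Cmod_ge_0 (y U)).
  assert (d0 : (0 <= depth U * Cmod (w U))%R) by nra.
  split; apply Rnot_lt_le; intros L; nra.
Qed.

Lemma tw_le (p q : R) (U : C) : E U -> (p <= q)%R -> (tw p U <= tw q U)%R.
Proof.
  intros HU H. assert (Hd := depth_ge U HU). assert (M1 := m_ge1). apply Rpower_1_anti; lra.
Qed.

Lemma tw_down (p : R) (U : C) (t : R) : E U -> (0 <= t)%R -> (p <= 0)%R ->
  (tw p (U + RtoC t * - Ci) <= tw p U)%R.
Proof.
  intros HU Ht Hp. assert (Hd := depth_ge U HU). assert (M1 := m_ge1).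
  rewrite depth_down. apply Rpower_anti; lra.
Qed.

Lemma K3_pos : (0 < K3)%R.
Proof. unfold K3. nra. Qed.

Lemma w_le_y (U : C) : E U -> (Cmod (w U) <= Cmod (y U))%R.
Proof.
  intros HU. destruct (cone U HU) as [_ H]. assert (Hd := depth_ge U HU). assert (M1 := m_ge1).
  generalize (Cmod_ge_0 (w U)). nra.
Qed.

Lemma w_le_y_div (U : C) : E U -> (Cmod (w U) <= tw (-3) U * Cmod (y U))%R.
Proof.
  intros HU. destruct (cone U HU) as [_ H]. assert (Hd := depth_ge U HU). assert (M1 := m_ge1).
  replace (-3/3)%R with (- (1))%R by lra. rewrite Rpower_Ropp, Rpower_1 by lra.
  apply Rmult_le_reg_l with (depth U); [lra|]. rewrite <- Rmult_assoc, Rinv_r by lra. lra.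
Qed.

Lemma tw_mult (p q r : R) (U : C) : (p + q = r)%R -> (tw p U * tw q U = tw r U)%R.
Proof. intros <-. rewrite <- Rpower_plus. f_equal. field. Qed.

(** First, coarse round: the cone bounds [w] by [|y| / depth], so the coefficient -2/3 becomes -5/3,
    just integrable. This suffices for the decay of [y], which in turn yields sharper bounds on [w]
    and on the source. *)
Lemma hY_bound1 (U : C) : E U -> (Cmod (hY U) <= 3 * K * tw (-5) U * Cmod (y U))%R.
Proof.
  intros HU. eapply Rle_trans; [now apply HhY|]. rewrite (Rmult_assoc (3 * K)), (Rmult_comm 3), Rmult_assoc.
  apply Rmult_le_compat_l; [lra|]. destruct (cone U HU) as [Cx _]. assert (Cw := w_le_y_div U HU).
  assert (P2 := Rpower_pos (depth U) (-2/3)). assert (P6 := Rpower_pos (depth U) (-6/3)).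
  assert (L := tw_le (-6) (-5) U HU ltac:(lra)). assert (y0 := Cmod_ge_0 (y U)).
  assert (A : (tw (-2) U * Cmod (w U) <= tw (-5) U * Cmod (y U))%R).
  { rewrite <- (tw_mult (-2) (-3) (-5) U) by lra. rewrite Rmult_assoc. apply Rmult_le_compat_l; lra. }
  assert (B : (tw (-6) U * (Cmod (x U) + Cmod (y U)) <= tw (-5) U * (2 * Cmod (y U)))%R)
    by (apply Rmult_le_compat; lra || (generalize (Cmod_ge_0 (x U)); lra)).
  lra.
Qed.

(** Removing the factor [exp (- i U)] leaves only the source in the derivative. *)
Definition eta (U : C) : C := cexp (Ci * U) * y U.

Lemma Cmod_cexp_depth (U : C) : Cmod (cexp (Ci * U)) = exp (depth U).
Proof. rewrite Cmod_cexp. f_equal. unfold depth, Re, Im. simpl. ring. Qed.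

Lemma rder_eta (U v : C) (t : R) : E (U + RtoC t * v) ->
  rder (fun t => eta (U + RtoC t * v)) t (v * (cexp (Ci * (U + RtoC t * v)) * hY (U + RtoC t * v))).
Proof.
  intros HU. unfold eta. eapply rder_eq.
  - apply rder_mult.
    + apply rder_ext with (fun t => cexp (Ci * U + RtoC t * (Ci * v))).
      * intros r. f_equal. ring.
      * apply rder_cexp.
    + apply cder_rder. now apply Hy.
  - cbv beta. replace (Ci * U + RtoC t * (Ci * v)) with (Ci * (U + RtoC t * v)) by ring.
    replace (cexp (Ci * (U + RtoC t * v)) * (v * (- Ci * y (U + RtoC t * v) + hY (U + RtoC t * v)))) with
      (v * (cexp (Ci * (U + RtoC t * v)) * hY (U + RtoC t * v)) -
       Ci * v * cexp (Ci * (U + RtoC t * v)) * y (U + RtoC t * v)) by ring.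
    ring.
Qed.

Lemma Cmod_deta (U v : C) (c : R) : (Cmod (hY U) <= c * Cmod (y U))%R ->
  (Cmod (v * (cexp (Ci * U) * hY U)) <= Cmod v * c * Cmod (eta U))%R.
Proof.
  intros H. unfold eta. rewrite !Cmod_mult, Rmult_assoc.
  apply Rmult_le_compat_l; [apply Cmod_ge_0|].
  generalize (Cmod_ge_0 (cexp (Ci * U))). nra.
Qed.

Lemma eta_down_le (U : C) (t : R) : E U -> (0 <= t)%R ->
  (Cmod (eta (U + RtoC t * - Ci)) <= 2 * Cmod (eta U))%R.
Proof.
  intros HU Ht. assert (Hd := depth_ge U HU). assert (M1 := m_ge1).
  (* A primitive of [3 K (depth + s)^(-5/3)]. Its total increase is at most [(9/2) K depth^(-2/3)],
     hence at most 1/2 because [9 K <= m^(2/3)]; the exponential is then at most 2. *)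
  set (k := fun s => (- (9/2) * K * Rpower (depth U + s) (-2/3))%R).
  assert (G := gronwall (fun t => eta (U + RtoC t * - Ci)) _ k
    (fun s => (3 * K * Rpower (depth U + s) (-5/3))%R) 0 t Ht
    (fun s Hs => rder_eta U (- Ci) s (E_down U s HU (proj1 Hs)))).
  cbv beta in G. rewrite Cmult_0_l, Cplus_0_r in G.
  eapply Rle_trans; [apply G|].
  - intros s Hs. unfold k.
    replace (3 * K * Rpower (depth U + s) (-5/3))%R with
      (- (9/2) * K * (-2/3 * Rpower (depth U + s) (-2/3 - 1)))%R
      by (replace (-2/3 - 1)%R with (-5/3)%R by lra; field).
    apply (is_derive_scal (fun s => Rpower (depth U + s) (-2/3))). apply is_derive_Rpower_shift. lra.
  - intros s Hs. assert (HUs := E_down U s HU (proj1 Hs)).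
    eapply Rle_trans; [apply Cmod_deta; now apply hY_bound1|].
    rewrite Cmod_opp, Cmod_Ci, Rmult_1_l, depth_down. lra.
  - rewrite Rmult_comm. apply Rmult_le_compat_r; [apply Cmod_ge_0|].
    assert (Pt := Rpower_pos (depth U + t) (-2/3)).
    assert (P0 := Rpower_pos (depth U) (-2/3)).
    assert (Q : (K * Rpower (depth U) (-2/3) <= 1/9)%R).
    { assert (L : (9 * K <= Rpower (depth U) (2/3))%R).
      { eapply Rle_trans; [apply Hm|]. apply Rle_Rpower_l; lra. }
      assert (I : (Rpower (depth U) (2/3) * Rpower (depth U) (-2/3) = 1)%R).
      { rewrite <- Rpower_plus. replace (2/3 + -2/3)%R with 0%R by lra. apply Rpower_O. lra. }
      nra. }
    assert (A : (Rpower (depth U + t) (-2/3) <= Rpower (depth U) (-2/3))%R) by (apply Rpower_anti; lra).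
    unfold k. rewrite Rplus_0_r.
    assert (B : (0 <= - (9/2) * K * Rpower (depth U + t) (-2/3) - - (9/2) * K * Rpower (depth U) (-2/3) <= 1/2)%R).
    { split; nra. }
    generalize (exp_m1_le _ B). lra.
Qed.

Lemma y_down (U : C) (t : R) : E U -> (0 <= t)%R ->
  (Cmod (y (U + RtoC t * - Ci)) <= 2 * exp (- t) * Cmod (y U))%R.
Proof.
  intros HU Ht. assert (H := eta_down_le U t HU Ht). unfold eta in H.
  rewrite !Cmod_mult, !Cmod_cexp_depth, depth_down, exp_plus in H.
  assert (P := exp_pos (depth U)). assert (Pt := exp_pos t). assert (Pt' := exp_pos (- t)).
  assert (I : (exp t * exp (- t) = 1)%R) by (rewrite <- exp_plus, Rplus_opp_r; apply exp_0).
  set (a := Cmod (y (U + RtoC t * - Ci))) in *. set (c := Cmod (y U)) in *.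
  assert (H' : (exp t * a <= 2 * c)%R).
  { apply Rmult_le_reg_l with (exp (depth U)); auto. lra. }
  replace a with (exp (- t) * (exp t * a))%R by (rewrite <- Rmult_assoc, (Rmult_comm (exp (- t))), I; ring).
  rewrite (Rmult_comm 2), Rmult_assoc. apply Rmult_le_compat_l; lra.
Qed.

(** Multiplication by [exp t] cancels the decay of [y]: the source becomes bounded and the linear
    rate becomes [1 - i lam], equal to 1 for [w] and to 2 for [x], so [apriori_exp] applies to
    both. *)
Lemma kexp_ray (g h : C -> C) (lam : C) (U : C) : E U -> (forall U, E U -> cder g U (lam * g U + h U)) ->
  forall t, (0 <= t)%R ->
  rder (fun t => kexp 1 t * g (U + RtoC t * - Ci)) t
    ((1 - Ci * lam) * (kexp 1 t * g (U + RtoC t * - Ci)) + kexp 1 t * (- Ci * h (U + RtoC t * - Ci))).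
Proof.
  intros HU Hg t Ht. eapply rder_eq.
  - apply rder_mult; [apply rder_kexp|]. now apply (rder_down g (fun U => lam * g U + h U)).
  - cbv beta. ring.
Qed.

(** Since [y] decays like [exp (-t)] along the vertical ray [U - i t], so does the
    source, and [w], [x] are recovered by integrating from the bottom of the ray. *)
Lemma component_bound (g h : C -> C) (lam : C) (c p : R) (U : C) :
  E U -> (forall U, E U -> cder g U (lam * g U + h U)) -> (1 <= Re (1 - Ci * lam))%R -> (0 <= c)%R -> (p <= 0)%R ->
  (forall U, E U -> (Cmod (g U) <= Cmod (y U))%R) ->
  (forall U, E U -> (Cmod (h U) <= c * tw p U * Cmod (y U))%R) ->
  (Cmod (g U) <= 2 * c * tw p U * Cmod (y U))%R.
Proof.
  intros HU Hg Hl Hc Hp Hgy Hh.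
  assert (A := apriori_exp _ _ (1 - Ci * lam) 1 (2 * c * tw p U * Cmod (y U)) (2 * Cmod (y U))
    ltac:(lra) (kexp_ray g h lam U HU Hg)).
  cbv beta in A. rewrite kexp_0, Cmult_0_l, Cmult_1_l, Cplus_0_r, Rdiv_1_r in A.
  assert (I : forall t, (exp t * exp (- t) = 1)%R) by (intros t; rewrite <- exp_plus, Rplus_opp_r; apply exp_0).
  apply A; intros t Ht; assert (HUt := E_down U t HU Ht); assert (Y := y_down U t HU Ht);
    assert (y0 := Cmod_ge_0 (y U)); assert (Pt := exp_pos t).
  - rewrite Cmod_mult, Cmod_kexp, Cmod_mult, Cmod_opp, Cmod_Ci, Rmult_1_l. simpl Re. rewrite Rmult_1_r.
    eapply Rle_trans; [apply Rmult_le_compat_l; [lra|now apply Hh]|].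
    assert (L := tw_down p U t HU Ht Hp).
    assert (P := Rpower_pos (depth (U + RtoC t * - Ci)) (p/3)).
    apply Rle_trans with (exp t * (c * tw p U * (2 * exp (- t) * Cmod (y U))))%R.
    + apply Rmult_le_compat_l; [lra|]. apply Rmult_le_compat; auto using Cmod_ge_0.
      * apply Rmult_le_pos; lra.
      * apply Rmult_le_compat_l; lra.
    + right. replace (exp t * (c * tw p U * (2 * exp (- t) * Cmod (y U))))%R with
        ((exp t * exp (- t)) * (2 * c * tw p U * Cmod (y U)))%R by ring. rewrite I. ring.
  - rewrite Cmod_mult, Cmod_kexp. simpl Re. rewrite Rmult_1_r.
    apply Rle_trans with (exp t * (2 * exp (- t) * Cmod (y U)))%R.
    + apply Rmult_le_compat_l; [lra|]. eapply Rle_trans; [now apply Hgy|exact Y].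
    + right. replace (exp t * (2 * exp (- t) * Cmod (y U)))%R with
        ((exp t * exp (- t)) * (2 * Cmod (y U)))%R by ring. rewrite I. ring.
Qed.

(** Within the cone [|w|] and [|x|] are at most [|y|], which gives the source of [w] the constant
    [3 K] and the exponent -7/3; that exponent passes to [chi_1]. *)
Lemma w_bound (U : C) : E U -> (Cmod (w U) <= 6 * K * tw (-7) U * Cmod (y U))%R.
Proof.
  intros HU. replace (6 * K)%R with (2 * (3 * K))%R by ring.
  apply (component_bound w hW 0 (3 * K) (-7) U); auto; try lra.
  - intros V' HV. eapply cder_eq; [now apply Hw|]. ring.
  - rewrite Cmult_0_r. simpl. lra.
  - apply w_le_y.
  - intros V' HV. eapply Rle_trans; [now apply HhW|].
    rewrite (Rmult_assoc (3 * K)), (Rmult_comm 3), Rmult_assoc. apply Rmult_le_compat_l; [lra|].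
    destruct (cone V' HV) as [Cx _]. assert (Cw := w_le_y V' HV).
    assert (L := tw_le (-9) (-7) V' HV ltac:(lra)).
    assert (P9 := Rpower_pos (depth V') (-9/3)). assert (P7 := Rpower_pos (depth V') (-7/3)).
    assert (tw (-9) V' * Cmod (w V') <= tw (-7) V' * Cmod (y V'))%R
      by (apply Rmult_le_compat; lra || apply Cmod_ge_0).
    assert (tw (-7) V' * (Cmod (x V') + Cmod (y V')) <= tw (-7) V' * (2 * Cmod (y V')))%R
      by (apply Rmult_le_compat_l; lra).
    lra.
Qed.

(** Second round: with [w_bound] the weak coefficient -2/3 becomes -9/3 and is dominated by -6/3.
    [K3] collects [K] times [6 K] from [w] and [K] times 2 from [x] and [y]. *)
Lemma h_bound (h : C -> C) (U : C) : E U ->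
  (Cmod (h U) <= K * (tw (-2) U * Cmod (w U) + tw (-6) U * (Cmod (x U) + Cmod (y U))))%R ->
  (Cmod (h U) <= K3 * tw (-6) U * Cmod (y U))%R.
Proof.
  intros HU H. eapply Rle_trans; [exact H|]. unfold K3.
  destruct (cone U HU) as [Cx _]. assert (Cw := w_bound U HU). assert (y0 := Cmod_ge_0 (y U)).
  assert (P2 := Rpower_pos (depth U) (-2/3)). assert (P6 := Rpower_pos (depth U) (-6/3)).
  assert (L := tw_le (-9) (-6) U HU ltac:(lra)).
  assert (A : (tw (-2) U * Cmod (w U) <= 6 * K * tw (-6) U * Cmod (y U))%R).
  { apply Rle_trans with (tw (-2) U * (6 * K * tw (-7) U * Cmod (y U)))%R; [apply Rmult_le_compat_l; lra|].
    replace (tw (-2) U * (6 * K * tw (-7) U * Cmod (y U)))%R with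
      (6 * K * (tw (-2) U * tw (-7) U) * Cmod (y U))%R by ring.
    rewrite (tw_mult (-2) (-7) (-9)) by lra. apply Rmult_le_compat_r; auto. apply Rmult_le_compat_l; lra. }
  assert (B : (tw (-6) U * (Cmod (x U) + Cmod (y U)) <= tw (-6) U * (2 * Cmod (y U)))%R)
    by (apply Rmult_le_compat_l; lra).
  replace ((6 * K * K + 2 * K) * tw (-6) U * Cmod (y U))%R with
    (K * (6 * K * tw (-6) U * Cmod (y U) + tw (-6) U * (2 * Cmod (y U))))%R by ring.
  apply Rmult_le_compat_l; lra.
Qed.

Lemma x_bound (U : C) : E U -> (Cmod (x U) <= 2 * K3 * tw (-6) U * Cmod (y U))%R.
Proof.
  intros HU. assert (P := K3_pos).
  apply (component_bound x hX Ci K3 (-6) U); auto; try lra.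
  - simpl. lra.
  - intros V' HV. now apply cone.
  - intros V' HV. apply h_bound; auto.
Qed.

Lemma depth_small (U : C) : E U -> (0 < K3 * tw (-3) U <= 1/4)%R.
Proof.
  intros HU. assert (Hd := depth_ge U HU). assert (M1 := m_ge1). assert (P := K3_pos).
  assert (P3 := Rpower_pos (depth U) (-3/3)). split; [now apply Rmult_lt_0_compat|].
  replace (-3/3)%R with (- (1))%R by lra. rewrite Rpower_Ropp, Rpower_1 by lra.
  apply Rmult_le_reg_r with (depth U); [lra|]. rewrite Rmult_assoc, Rinv_l by lra. lra.
Qed.

Lemma eta_down_diff (U : C) (t : R) : E U -> (0 <= t)%R ->
  (Cmod (eta (U + RtoC t * - Ci) - eta U) <= 2 * (K3 * tw (-3) U) * Cmod (eta U))%R.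
Proof.
  intros HU Ht. assert (Hd := depth_ge U HU). assert (M1 := m_ge1). assert (PK := K3_pos).
  set (k := fun s => (- K3 * Rpower (depth U + s) (-3/3))%R).
  assert (G := gronwall_diff (fun t => eta (U + RtoC t * - Ci)) _ k
    (fun s => (K3 * Rpower (depth U + s) (-6/3))%R) 0 t Ht
    (fun s Hs => rder_eta U (- Ci) s (E_down U s HU (proj1 Hs)))).
  cbv beta in G. rewrite Cmult_0_l, Cplus_0_r in G.
  eapply Rle_trans; [apply G|].
  - intros s Hs. unfold k.
    replace (K3 * Rpower (depth U + s) (-6/3))%R with
      (- K3 * (-3/3 * Rpower (depth U + s) (-3/3 - 1)))%R
      by (replace (-3/3 - 1)%R with (-6/3)%R by lra; field).
    apply (is_derive_scal (fun s => Rpower (depth U + s) (-3/3))). apply is_derive_Rpower_shift. lra.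
  - intros s Hs. apply Rmult_le_pos; [lra|left; apply Rpower_pos].
  - intros s Hs. assert (HUs := E_down U s HU (proj1 Hs)).
    eapply Rle_trans; [apply Cmod_deta; apply h_bound; auto|].
    rewrite Cmod_opp, Cmod_Ci, Rmult_1_l, depth_down. lra.
  - rewrite Rmult_comm. apply Rmult_le_compat_r; [apply Cmod_ge_0|].
    assert (Pt := Rpower_pos (depth U + t) (-3/3)).
    assert (A : (Rpower (depth U + t) (-3/3) <= Rpower (depth U) (-3/3))%R) by (apply Rpower_anti; lra).
    destruct (depth_small U HU) as [S1 S2].
    unfold k. rewrite Rplus_0_r.
    assert (B : (0 <= - K3 * Rpower (depth U + t) (-3/3) - - K3 * Rpower (depth U) (-3/3) <= 1/2)%R).
    { split; nra. }
    generalize (exp_m1_le _ B). nra.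
Qed.

(** Needed only to show that the limit is the same on all vertical rays, so the source exponent -6/3
    is relaxed to -3/3. The sign condition makes the segment move away from the imaginary axis, so
    membership of its far end in the sector implies that of every point. *)
Lemma eta_horizontal_diff (P : C) (r : R) : E P -> E (P + RtoC r) -> (0 <= Re P * r)%R ->
  (Rabs r * K3 * tw (-3) P <= 1/2)%R ->
  (Cmod (eta (P + RtoC r) - eta P) <= 2 * (Rabs r * K3 * tw (-3) P) * Cmod (eta P))%R.
Proof.
  intros HP HQ Hr Hk. assert (PK := K3_pos). assert (Pr := Rabs_pos r).
  assert (Hd := depth_ge P HP). assert (M1 := m_ge1).
  assert (HE : forall s, (0 <= s <= 1)%R -> E (P + RtoC s * RtoC r) /\ depth (P + RtoC s * RtoC r) = depth P).
  { intros s Hs. rewrite <- RtoC_mult. split; [|unfold depth, Im; simpl; ring].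
    unfold E, sector in *.
    replace (Im (P + RtoC (s * r))) with (Im P) by (unfold Im; simpl; ring).
    replace (Im (P + RtoC r)) with (Im P) in HQ by (unfold Im; simpl; ring).
    replace (Re (P + RtoC (s * r))) with (Re P + s * r)%R by (unfold Re; simpl; ring).
    replace (Re (P + RtoC r)) with (Re P + r)%R in HQ by (unfold Re; simpl; ring).
    assert (B : (Rabs (Re P + s * r) <= Rabs (Re P + r))%R).
    { destruct (Rle_or_lt 0 (Re P)) as [A|A].
      - destruct (Rle_or_lt 0 r) as [A'|A'].
        + rewrite !Rabs_pos_eq by nra. nra.
        + assert (E0 : Re P = 0%R) by nra. rewrite E0, !Rplus_0_l, Rabs_mult, (Rabs_pos_eq s) by lra.
          generalize (Rabs_pos r). nra.
      - assert (A' : (r <= 0)%R) by nra. rewrite !Rabs_left1 by nra. nra. }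
    assert (T * Rabs (Re P + s * r) <= T * Rabs (Re P + r))%R by (apply Rmult_le_compat_l; lra). lra. }
  set (k := fun s => (Rabs r * K3 * tw (-3) P * s)%R).
  assert (G := gronwall_diff (fun t => eta (P + RtoC t * RtoC r)) _ k
    (fun s => (Rabs r * K3 * tw (-3) P)%R) 0 1 ltac:(lra)
    (fun s Hs => rder_eta P (RtoC r) s (proj1 (HE s Hs)))).
  cbv beta in G. rewrite Cmult_0_l, Cplus_0_r, Cmult_1_l in G.
  assert (P3 := Rpower_pos (depth P) (-3/3)).
  eapply Rle_trans; [apply G|].
  - intros s Hs. unfold k. auto_derive; auto. ring.
  - intros s Hs. apply Rmult_le_pos; [|lra]. apply Rmult_le_pos; lra.
  - intros s Hs. destruct (HE s Hs) as [HEs Ed].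
    eapply Rle_trans; [apply Cmod_deta; apply h_bound; auto|].
    rewrite Cmod_R, Ed, <- Rmult_assoc. apply Rmult_le_compat_r; [apply Cmod_ge_0|].
    apply Rmult_le_compat_l; [apply Rmult_le_pos; lra|]. apply tw_le; auto. lra.
  - rewrite Rmult_comm. apply Rmult_le_compat_r; [apply Cmod_ge_0|].
    unfold k. rewrite Rmult_0_r, Rmult_1_r, Rminus_0_r. apply exp_m1_le. split; auto.
    apply Rmult_le_pos; [|lra]. apply Rmult_le_pos; lra.
Qed.

(** [Theta] is the limit down the imaginary axis. Another point [U] is compared with it by
    descending vertically to the depth of some [P n], at a cost bounded by the right-hand side, and
    then moving horizontally, at a cost that tends to 0 with [n]. *)
Lemma eta_limit : exists Theta : C, forall U, E U ->
  (Cmod (Theta - eta U) <= 2 * (K3 * tw (-3) U) * Cmod (eta U))%R.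
Proof.
  assert (M1 := m_ge1). assert (PK := K3_pos).
  set (U0 := ((0, - (m + 1)) : C)%R).
  assert (d0 : depth U0 = (m + 1)%R) by (unfold depth, U0, Im; simpl; ring).
  assert (HU0 : E U0).
  { unfold E, sector. change (- Im U0)%R with (depth U0). rewrite d0.
    change (Re U0) with 0%R. rewrite Rabs_R0. lra. }
  set (P := fun n : nat => U0 + RtoC (INR n) * - Ci).
  assert (HP : forall n, E (P n)) by (intros n; apply E_down; auto; apply pos_INR).
  assert (dP : forall n, depth (P n) = (m + 1 + INR n)%R) by (intros n; unfold P; now rewrite depth_down, d0).
  set (A := Cmod (eta U0)). assert (A0 : (0 <= A)%R) by apply Cmod_ge_0.
  assert (bP : forall n, (Cmod (eta (P n)) <= 2 * A)%R) by (intros n; apply eta_down_le; auto; apply pos_INR).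
  assert (tP : forall n, (tw (-3) (P n) <= Rpower (1 + INR n) (- (1)))%R).
  { intros n. rewrite dP. replace (-3/3)%R with (- (1))%R by lra.
    apply Rpower_anti; [generalize (pos_INR n); lra|lra]. }
  destruct (complex_cauchy (fun n => eta (P n)) (fun n => 4 * K3 * A * Rpower (1 + INR n) (- (1)))%R) as [Th HTh].
  - replace 0%R with (4 * K3 * A * 0)%R by ring.
    apply (is_lim_seq_scal_l (fun n => Rpower (1 + INR n) (- (1))) (4 * K3 * A) 0).
    apply is_lim_seq_power_decay. lra.
  - intros n k Hnk. apply le_INR in Hnk.
    replace (P k) with (P n + RtoC (INR k - INR n) * - Ci).
    2: { unfold P. rewrite RtoC_minus. ring. }
    eapply Rle_trans; [apply eta_down_diff; auto; lra|].
    replace (4 * K3 * A * Rpower (1 + INR n) (- (1)))%R with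
      (2 * (K3 * Rpower (1 + INR n) (- (1))) * (2 * A))%R by ring.
    assert (Q := Rpower_pos (depth (P n)) (-3/3)). specialize (tP n).
    apply Rmult_le_compat; auto using Cmod_ge_0; [nra|].
    apply Rmult_le_compat_l; [lra|]. apply Rmult_le_compat_l; lra.
  - exists Th. intros U HU. apply le_epsilon. intros e He.
    set (r := Re U). assert (Pr := Rabs_pos r).
    (* In order: the distance of [eta (P n)] from its limit, the horizontal variation, the smallness
       condition for the horizontal estimate, and [e] to make [C2] positive. *)
    set (C2 := (4 * K3 * A + 4 * (Rabs r * K3) * A + 2 * (Rabs r * K3) + e)%R).
    assert (Q1 : (0 <= K3 * A)%R) by nra. assert (Q2 : (0 <= Rabs r * K3)%R) by nra.
    assert (Q3 : (0 <= Rabs r * K3 * A)%R) by nra.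
    assert (HC2 : (0 < C2)%R) by (unfold C2; lra).
    assert (dl : (0 < Rmin e 1 / C2)%R) by (apply Rdiv_lt_0_compat; [apply Rmin_pos; lra|auto]).
    destruct (proj1 (is_lim_seq_Reals _ _) (is_lim_seq_power_decay 1 ltac:(lra)) _ dl) as [N HN].
    destruct (nfloor_ex (depth U)) as [N2 [_ HN2]]; [generalize (depth_ge U HU); lra|].
    set (n := Nat.max N N2).
    specialize (HN n ltac:(unfold n; lia)). unfold R_dist in HN.
    rewrite Rminus_0_r, Rabs_pos_eq in HN by (left; apply Rpower_pos).
    assert (HN2' : (INR N2 <= INR n)%R) by (apply le_INR; unfold n; lia).
    set (z := Rpower (1 + INR n) (- (1))) in *. assert (z0 : (0 < z)%R) by apply Rpower_pos.
    assert (Hz : (C2 * z < Rmin e 1)%R).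
    { apply (Rmult_lt_compat_l C2) in HN; auto.
      replace (C2 * (Rmin e 1 / C2))%R with (Rmin e 1) in HN by (field; lra). exact HN. }
    assert (Hz1 := Rlt_le_trans _ _ _ Hz (Rmin_l e 1)). assert (Hz2 := Rlt_le_trans _ _ _ Hz (Rmin_r e 1)).
    (* The descent that brings [U] to the depth of [P n], so that the two points differ by the real
       number [Re U]. *)
    set (t := (m + 1 + INR n - depth U)%R). assert (Ht : (0 <= t)%R) by (unfold t; lra).
    assert (EV : U + RtoC t * - Ci = P n + RtoC r).
    { unfold P, U0, t, r, depth, Re, Im. destruct U as [u1 u2]. simpl.
      unfold RtoC, Ci, Cplus, Cmult, Copp; simpl. f_equal; ring. }
    assert (HV : E (U + RtoC t * - Ci)) by now apply E_down.
    assert (D1 := eta_down_diff U t HU Ht). rewrite EV in D1, HV.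
    assert (RP : Re (P n) = 0%R) by (unfold P, U0, Re; simpl; ring).
    assert (tn := tP n). fold z in tn.
    assert (kap : (Rabs r * K3 * tw (-3) (P n) <= Rabs r * K3 * z)%R) by (apply Rmult_le_compat_l; lra).
    assert (D2 := eta_horizontal_diff (P n) r (HP n) HV ltac:(rewrite RP; lra)
      ltac:(unfold C2 in Hz2; nra)).
    replace (Th - eta U) with
      ((eta (P n + RtoC r) - eta U) - ((eta (P n + RtoC r) - eta (P n)) - (Th - eta (P n)))) by ring.
    apply Cmod_minus_le; [exact D1|].
    eapply Rle_trans; [apply Cmod_minus_le; [exact D2|apply HTh]|]. fold z.
    assert (bn := bP n).
    assert (D3 : (2 * (Rabs r * K3 * tw (-3) (P n)) * Cmod (eta (P n)) <= 2 * (Rabs r * K3 * z) * (2 * A))%R).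
    { assert (Q := Rpower_pos (depth (P n)) (-3/3)).
      apply Rmult_le_compat; auto using Cmod_ge_0; [|lra].
      apply Rmult_le_pos; [lra|]. apply Rmult_le_pos; lra. }
    unfold C2 in Hz1. nra.
Qed.

(** Since [2 K3 / depth <= 1/2], [eta] is within half of its own modulus of [Theta], so
    [|eta| <= 2 |Theta|]. Bounds relative to [y] thus become bounds relative to [Theta], which
    permits the later division by it. *)
Lemma sector_asymptotics : exists Theta : C, forall U, E U ->
  (Cmod (cexp (Ci * U) * w U) <= 12 * K * Cmod Theta * tw (-7) U)%R /\
  (Cmod (cexp (Ci * U) * x U) <= 4 * K3 * Cmod Theta * tw (-6) U)%R /\
  (Cmod (cexp (Ci * U) * y U - Theta) <= 4 * K3 * Cmod Theta * tw (-3) U)%R.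
Proof.
  destruct eta_limit as [Th H]. exists Th. intros U HU. specialize (H U HU).
  destruct (depth_small U HU) as [S1 S2].
  assert (e0 := Cmod_ge_0 (eta U)). assert (PK := K3_pos).
  assert (eT : (Cmod (eta U) <= 2 * Cmod Th)%R).
  { generalize (Cmod_triangle_inv (eta U) Th). rewrite Cmod_minus_sym. nra. }
  assert (Ex := exp_pos (depth U)).
  assert (G : forall g c p, (0 <= c)%R -> (Cmod (g U) <= c * tw p U * Cmod (y U))%R ->
    (Cmod (cexp (Ci * U) * g U) <= 2 * c * Cmod Th * tw p U)%R).
  { intros g c p Hc Hg. assert (P := Rpower_pos (depth U) (p/3)).
    assert (Q : (0 <= c * tw p U)%R) by (apply Rmult_le_pos; lra).
    rewrite Cmod_mult. unfold eta in eT. rewrite Cmod_mult in eT. rewrite Cmod_cexp_depth in *.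
    apply Rle_trans with (c * tw p U * (exp (depth U) * Cmod (y U)))%R.
    - replace (c * tw p U * (exp (depth U) * Cmod (y U)))%R with
       (exp (depth U) * (c * tw p U * Cmod (y U)))%R by ring. apply Rmult_le_compat_l; lra.
    - replace (2 * c * Cmod Th * tw p U)%R with (c * tw p U * (2 * Cmod Th))%R by ring.
      apply Rmult_le_compat_l; auto. }
  split; [|split].
  - replace (12 * K)%R with (2 * (6 * K))%R by ring. apply G; [lra|]. now apply w_bound.
  - replace (4 * K3)%R with (2 * (2 * K3))%R by ring. apply G; [lra|]. now apply x_bound.
  - change (cexp (Ci * U) * y U) with (eta U). rewrite Cmod_minus_sym.
    eapply Rle_trans; [exact H|].
    replace (4 * K3 * Cmod Th * tw (-3) U)%R with (2 * (K3 * tw (-3) U) * (2 * Cmod Th))%R by ring.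
    apply Rmult_le_compat_l; lra.
Qed.
End Difference.

(** * Domains and branches *)

(** For [sg = 1] (resp. [-1]) an open neighbourhood of [D^u] (resp. [D^s]). *)
Definition outer (sg T k : R) (U : C) : Prop := (sg * T * Re U + k < Rabs (Im U))%R.

Section Domains.
Variables (sg T k : R).
Hypothesis Hsg : (sg = 1 \/ sg = -1)%R.
Hypothesis HT : (0 < T)%R.
Hypothesis Hk : (0 <= k)%R.

Lemma Rabs_sg (r : R) : Rabs (sg * r) = Rabs r.
Proof.
  destruct Hsg as [-> | ->]; [now rewrite Rmult_1_l|].
  replace (-1 * r)%R with (- r)%R by ring. apply Rabs_Ropp.
Qed.

Lemma outer_open : copen (outer sg T k).
Proof.
  intros z Hz. unfold outer in *.
  exists ((Rabs (Im z) - (sg * T * Re z + k)) / (2 * (1 + T)))%R. split.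
  - apply Rdiv_lt_0_compat; lra.
  - intros w Hw. set (d := Cmod (w - z)) in *.
    assert (A := re_le_Cmod (w - z)). assert (B := im_le_Cmod (w - z)). fold d in A, B.
    replace (Re (w - z)) with (Re w - Re z)%R in A by reflexivity.
    replace (Im (w - z)) with (Im w - Im z)%R in B by reflexivity.
    assert (C1 : (sg * (Re w - Re z) <= d)%R).
    { eapply Rle_trans; [apply Rle_abs|]. now rewrite Rabs_sg. }
    assert (C2 : (Rabs (Im z) - Rabs (Im w) <= d)%R).
    { eapply Rle_trans; [apply Rabs_triang_inv|]. now rewrite Rabs_minus_sym. }
    apply (Rmult_lt_compat_r (2 * (1 + T))) in Hw; [|lra].
    replace ((Rabs (Im z) - (sg * T * Re z + k)) / (2 * (1 + T)) * (2 * (1 + T)))%R with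
      (Rabs (Im z) - (sg * T * Re z + k))%R in Hw by (field; lra).
    assert (d0 : (0 <= d)%R) by apply Cmod_ge_0. nra.
Qed.

Let c2 : R := (Rmin 1 T / (4 + 2 * T))%R.

Lemma c2_pos : (0 < c2)%R.
Proof. apply Rdiv_lt_0_compat; [apply Rmin_pos; lra|lra]. Qed.

(** On [outer] the functional [|Im| - (T/2) sg Re] dominates the modulus and it
    does not decrease along directions [(-sg, e)] with [|e| <= T/2]. *)
Lemma outer_ray (e : R) : (Rabs e <= T / 2)%R ->
  ray_closed (outer sg T k) (c2 / (2 + c2)) ((- sg, e)%R : C).
Proof.
  intros He U t HU Ht. unfold outer in *. assert (Pc := c2_pos).
  set (z := U + RtoC t * ((- sg, e)%R : C)).
  assert (Rz : Re z = (Re U - sg * t)%R) by (unfold z, Re; simpl; ring).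
  assert (Iz : Im z = (Im U + t * e)%R) by (unfold z, Im; simpl; ring).
  assert (te : (Rabs (t * e) <= t * (T / 2))%R).
  { rewrite Rabs_mult, (Rabs_pos_eq t) by auto. now apply Rmult_le_compat_l. }
  assert (sg2 : (sg * sg = 1)%R) by (destruct Hsg as [-> | ->]; ring).
  assert (Lz : (Rabs (Im U) - t * (T / 2) <= Rabs (Im z))%R).
  { rewrite Iz. generalize (Rabs_triang_inv (Im U) (- (t * e))). rewrite Rabs_Ropp.
    replace (Im U - - (t * e))%R with (Im U + t * e)%R by ring. lra. }
  assert (Sz : (sg * T * Re z = sg * T * Re U - T * t)%R).
  { rewrite Rz. replace (sg * T * (Re U - sg * t))%R with (sg * T * Re U - (sg * sg) * (T * t))%R by ring.
    rewrite sg2. ring. }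
  assert (tT : (0 <= t * T)%R) by nra.
  split; [lra|].
  assert (G1 : (c2 * Cmod U <= Cmod z)%R).
  { assert (A : (Rabs (Im z) - T / 2 * (sg * Re z) <= (1 + T / 2) * Cmod z)%R).
    { assert (P := im_le_Cmod z). assert (Q := re_le_Cmod z). rewrite <- Rabs_sg in Q.
      generalize (Rle_abs (- (sg * Re z))). rewrite Rabs_Ropp. nra. }
    assert (B : (Rabs (Im U) - T / 2 * (sg * Re U) <= Rabs (Im z) - T / 2 * (sg * Re z))%R).
    { replace (sg * Re z)%R with (sg * Re U - t)%R; [lra|].
      rewrite Rz. replace (sg * (Re U - sg * t))%R with (sg * Re U - (sg * sg) * t)%R by ring.
      rewrite sg2. ring. }
    assert (D : (Rmin 1 T * Cmod U <= 4 * (Rabs (Im U) - T / 2 * (sg * Re U)))%R).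
    { assert (M1 := Rmin_l 1 T). assert (M2 := Rmin_r 1 T).
      assert (M0 : (0 < Rmin 1 T)%R) by (apply Rmin_pos; lra).
      assert (P := Cmod_le_ReIm U). rewrite <- (Rabs_sg (Re U)) in P.
      assert (I0 := Rabs_pos (Im U)). assert (R0 := Rabs_pos (sg * Re U)).
      apply Rle_trans with (T * Rabs (sg * Re U) + 1 * Rabs (Im U))%R.
      - apply Rle_trans with (Rmin 1 T * (Rabs (sg * Re U) + Rabs (Im U)))%R; [apply Rmult_le_compat_l; lra|].
        rewrite Rmult_plus_distr_l. apply Rplus_le_compat; apply Rmult_le_compat_r; auto.
      - destruct (Rle_or_lt 0 (sg * Re U)) as [L|L].
        + rewrite (Rabs_pos_eq (sg * Re U)) by auto. nra.
        + rewrite (Rabs_left (sg * Re U)) by auto. nra. }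
    unfold c2. apply Rmult_le_reg_r with (4 + 2 * T)%R; [lra|].
    replace (Rmin 1 T / (4 + 2 * T) * Cmod U * (4 + 2 * T))%R with (Rmin 1 T * Cmod U)%R by (field; lra).
    lra. }
  assert (G2 : (t <= Cmod z + Cmod U)%R).
  { assert (Q := re_le_Cmod (z - U)). replace (Re (z - U)) with (- (sg * t))%R in Q
      by (replace (Re (z - U)) with (Re z - Re U)%R by reflexivity; rewrite Rz; ring).
    rewrite Rabs_Ropp, Rabs_sg, Rabs_pos_eq in Q by auto.
    generalize (Cmod_minus_le z U _ _ (Rle_refl _) (Rle_refl _)). lra. }
  assert (z0 := Cmod_ge_0 z). assert (U0 := Cmod_ge_0 U).
  apply Rmult_le_reg_r with (2 + c2)%R; [lra|].
  replace (c2 / (2 + c2) * (Cmod U + t) * (2 + c2))%R with (c2 * (Cmod U + t))%R by (field; lra). nra.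
Qed.

Lemma outer_Cmod (U : C) : outer sg T k U -> (k / (1 + T) <= Cmod U)%R.
Proof.
  intros HU. unfold outer in HU.
  apply Rmult_le_reg_r with (1 + T)%R; [lra|]. unfold Rdiv. rewrite Rmult_assoc, Rinv_l by lra.
  assert (P := im_le_Cmod U). assert (Q := re_le_Cmod U). rewrite <- Rabs_sg in Q.
  generalize (Rle_abs (- (sg * Re U))). rewrite Rabs_Ropp. nra.
Qed.
End Domains.

Lemma arg_s_good (U : C) : (Im U <> 0 \/ 0 < Re U)%R ->
  polar arg_s U /\ ccont (fun w => RtoC (arg_s w)) U.
Proof.
  intros H. split; [|now apply ccont_Arg].
  apply polar_Arg. intros E. rewrite E in H. unfold Re, Im in H. simpl in H. lra.
Qed.

Lemma arg_u_good (U : C) : (Im U <> 0 \/ Re U < 0)%R ->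
  polar arg_u U /\ ccont (fun w => RtoC (arg_u w)) U.
Proof.
  intros H.
  assert (H' : (Im (- U) <> 0 \/ 0 < Re (- U))%R).
  { change (Im (- U)) with (- Im U)%R. change (Re (- U)) with (- Re U)%R.
    destruct H as [H|H]; [left|right]; lra. }
  split.
  - destruct (arg_s_good _ H') as [P _]. unfold polar, arg_s in P. rewrite Cmod_opp in P.
    unfold polar, arg_u. rewrite cos_minus, sin_minus, cos_PI, sin_PI.
    transitivity (- (- U)); [ring|]. rewrite P at 1. unfold Copp; simpl. f_equal; ring.
  - apply ccont_near with (fun w => RtoC (Arg (- w)) + RtoC (- PI)).
    + apply near_all. intros w. unfold arg_u. now rewrite <- RtoC_plus.
    + apply ccont_plus; [|apply ccont_const].
      apply (ccont_comp (fun w => RtoC (Arg w)) (fun w => - w)); [|now apply ccont_Arg].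
      eapply cder_ccont. apply cder_opp, cder_id.
Qed.

(** The two half-angle tangents are opposite inverses, because [(m - x) (m + x) = y^2]; the identity
    [atan (1/p) = PI/2 - atan p] accounts for the shift by [PI]. *)
Lemma arg_agree (U : C) : (Im U < 0)%R -> arg_u U = arg_s U.
Proof.
  intros H. unfold arg_u, arg_s.
  assert (H1 : (Im (- U) <> 0 \/ 0 < Re (- U))%R) by (left; change (Im (- U)) with (- Im U)%R; lra).
  assert (H2 : (Im U <> 0 \/ 0 < Re U)%R) by (left; lra).
  assert (S1 := slit_pos _ H1). assert (S2 := slit_pos _ H2).
  rewrite (Arg_slit _ H1), (Arg_slit _ H2). rewrite Cmod_opp in *.
  change (Im (- U)) with (- Im U)%R. change (Re (- U)) with (- Re U)%R in *.
  assert (E := Cmod_sq U).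
  set (p := (- Im U / (Cmod U + - Re U))%R).
  assert (Pp : (0 < p)%R) by (apply Rdiv_lt_0_compat; lra).
  replace (Im U / (Cmod U + Re U))%R with (- / p)%R.
  - rewrite atan_opp, atan_inv by auto. lra.
  - unfold p. apply Rmult_eq_reg_r with ((Cmod U + Re U) * Im U)%R.
    + replace (Im U / (Cmod U + Re U) * ((Cmod U + Re U) * Im U))%R with (Im U * Im U)%R by (field; lra).
      replace (- / (- Im U / (Cmod U + - Re U)) * ((Cmod U + Re U) * Im U))%R with
        ((Cmod U + - Re U) * (Cmod U + Re U))%R by (field; lra).
      lra.
    + apply Rmult_integral_contrapositive_currified; lra.
Qed.

(** Analyticity on the closed set [D'] asks for differentiability on a disc around each of its
    points; it is obtained by solving on an open set [D] that contains [D']. *)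
Lemma inner_solution_inv (argf : C -> R) (D D' : C -> Prop) (phi : C -> C3) :
  copen D -> (forall U, D' U -> D U) ->
  (forall U, D U -> U <> 0 /\ polar argf U /\ ccont (fun w => RtoC (argf w)) U /\
     (Cmod (Jh (cbrt argf U) (phi U)) <= 1/2)%R) ->
  inner_solution argf D phi -> inv_solution argf D' phi.
Proof.
  intros Ho Hsub Hg Hs.
  assert (An : forall (f f' : C -> C), (forall U, D U -> cder f U (f' U)) -> analytic_on D' f).
  { intros f f' Hf U HU. destruct (Ho U (Hsub U HU)) as [d [Hd H]]. exists d. split; auto.
    intros V HV. exists (f' V). apply cder_is_derive. apply Hf. now apply H. }
  split; [|split; [|split]].
  - eapply An. intros U HU. apply (Hs U HU).
  - eapply An. intros U HU. apply (Hs U HU).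
  - eapply An. intros U HU. apply (Hs U HU).
  - intros U HU. destruct (Hg U (Hsub U HU)) as [N [Hp [Ha HJ]]].
    destruct (Hs U (Hsub U HU)) as [S1 [S2 S3]].
    assert (R := Rcal_Rh argf U phi N).
    cbv zeta in R. fold (cbrt argf U) in R. rewrite R; auto.
    + unfold add3, Acal, mk3, Wc, Xc, Yc; cbn [fst snd].
      split; [|split]; apply cder_is_derive.
      * eapply cder_eq; [exact S1|]. unfold Wc. ring.
      * exact S2.
      * exact S3.
    + generalize (Ho U (Hsub U HU)). apply near_mono. intros w Hw. now apply Hg.
Qed.

Lemma weighted_bound (argf : C -> R) (p b : R) (n : Z) (U z : C) :
  (p = IZR n / 3)%R -> (0 < Cmod U)%R -> (Cmod z <= b * wt n (rad U))%R ->
  (Cmod (cpow argf p U * z) <= b)%R.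
Proof.
  intros -> HU Hz. rewrite Cmod_mult, Cmod_cpow.
  apply Rle_trans with (Rpower (Cmod U) (IZR n / 3) * (b * wt n (rad U)))%R.
  - apply Rmult_le_compat_l; auto. left. apply Rpower_pos.
  - rewrite wt_rad. right.
    replace (Rpower (Cmod U) (IZR n / 3) * (b * Rpower (Cmod U) (- IZR n / 3)))%R with
      (b * (Rpower (Cmod U) (IZR n / 3) * Rpower (Cmod U) (- IZR n / 3)))%R by ring.
    rewrite <- Rpower_plus. replace (IZR n / 3 + - IZR n / 3)%R with 0%R by field.
    rewrite Rpower_O by auto. ring.
Qed.

(** * The main theorem *)

Lemma wt_depth (n : Z) (U : C) : (0 <= n)%Z -> (0 < depth U)%R ->
  (wt n (rad U) <= Rpower (depth U) (- IZR n / 3))%R.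
Proof.
  intros Hn Hd. rewrite wt_rad. apply IZR_le in Hn. apply Rpower_anti; [|lra].
  generalize (depth_le_Cmod U). lra.
Qed.

Lemma sector_Cmod (T m : R) (U : C) : (0 < T)%R -> (0 <= m)%R -> sector T m U ->
  (Cmod U <= (1 + / T) * depth U)%R.
Proof.
  intros HT Hm HU. unfold sector in HU. assert (H := Cmod_le_ReIm U).
  assert (P := Rabs_pos (Re U)).
  assert (D : Rabs (Im U) = depth U) by (unfold depth; apply Rabs_left; nra).
  assert (Q : (Rabs (Re U) <= / T * depth U)%R).
  { apply Rmult_le_reg_l with T; auto. rewrite <- Rmult_assoc, Rinv_r by lra. unfold depth. lra. }
  lra.
Qed.

(** Passes from the depth back to the modulus, at the cost of the aperture factor [(1 + 1/T)^p]. *)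
Lemma tw_Cmod (T m a p : R) (U z : C) : (0 < T)%R -> (0 <= m)%R -> sector T m U -> (0 <= a)%R -> (0 <= p)%R ->
  (Cmod z <= a * Rpower (depth U) (- p))%R ->
  (Rpower (Cmod U) p * Cmod z <= a * Rpower (1 + / T) p)%R.
Proof.
  intros HT Hm HU Ha Hp Hz. assert (L := sector_Cmod T m U HT Hm HU).
  assert (Hd : (0 < depth U)%R).
  { unfold sector in HU. unfold depth. assert (0 <= T * Rabs (Re U))%R by (apply Rmult_le_pos; [lra|apply Rabs_pos]). lra. }
  assert (Hc : (0 < 1 + / T)%R) by (generalize (Rinv_0_lt_compat T HT); lra).
  assert (PU : (0 < Cmod U)%R) by (generalize (depth_le_Cmod U); lra).
  apply Rle_trans with (Rpower ((1 + / T) * depth U) p * (a * Rpower (depth U) (- p)))%R.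
  - apply Rmult_le_compat; auto using Cmod_ge_0; [left; apply Rpower_pos|]. apply Rle_Rpower_l; lra.
  - rewrite <- Rpower_mult_distr by auto. right.
    replace (Rpower (1 + / T) p * Rpower (depth U) p * (a * Rpower (depth U) (- p)))%R with
      (a * Rpower (1 + / T) p * (Rpower (depth U) p * Rpower (depth U) (- p)))%R by ring.
    rewrite <- Rpower_plus, Rplus_opp_r, Rpower_O by auto. ring.
Qed.

Theorem theorem2p7 :
  forall beta0 : R, (0 < beta0 < PI / 2)%R ->
  exists kappa0 b1 : R, (0 < kappa0)%R /\ (0 < b1)%R /\
  exists (Theta : C) (b2 : R), (0 < b2)%R /\
  forall kappa : R, (kappa0 <= kappa)%R ->
  exists Zu Zs chi : C -> C3,
    inv_solution arg_u (Du beta0 kappa) Zu /\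
    inv_solution arg_s (Ds beta0 kappa) Zs /\
    (forall U, Du beta0 kappa U ->
       (Cmod (cpow arg_u (8/3)%R U * Wc (Zu U)) <= b1)%R /\
       (Cmod (cpow arg_u (4/3)%R U * Xc (Zu U)) <= b1)%R /\
       (Cmod (cpow arg_u (4/3)%R U * Yc (Zu U)) <= b1)%R) /\
    (forall U, Ds beta0 kappa U ->
       (Cmod (cpow arg_s (8/3)%R U * Wc (Zs U)) <= b1)%R /\
       (Cmod (cpow arg_s (4/3)%R U * Xc (Zs U)) <= b1)%R /\
       (Cmod (cpow arg_s (4/3)%R U * Yc (Zs U)) <= b1)%R) /\
    (forall U, Ek beta0 kappa U ->
       sub3 (Zu U) (Zs U)
       = scal3 (Theta * cexp (- Ci * U)) (add3 (mk3 0 0 1) (chi U))) /\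
    (forall U, Ek beta0 kappa U ->
       (Cmod (cpow arg_s (7/3)%R U * Wc (chi U)) <= b2)%R /\
       (Cmod (U * U * Xc (chi U)) <= b2)%R /\
       (Cmod (U * Yc (chi U)) <= b2)%R).
Proof.
  intros beta0 Hbeta.
  assert (HT : (0 < tan beta0)%R) by (apply tan_gt_0; lra).
  set (T := tan beta0) in *.
  set (c2 := (Rmin 1 T / (4 + 2 * T))%R). assert (Pc2 : (0 < c2)%R) by now apply c2_pos.
  set (c1 := (c2 / (2 + c2))%R). assert (Pc1 : (0 < c1)%R) by (apply Rdiv_lt_0_compat; lra).
  (* The tilts [-T/2] for [X] and [T/2] for [Y] give [Re (i v) = T/2] and [Re (- i v) = T/2]
     respectively; half the slope of the boundary keeps the rays inside the domain. The stable case
     uses the same tilts with the horizontal direction reversed. *)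
  destruct (inner_existence c1 ((-1, 0)%R : C) ((-1, - (T/2))%R : C) ((-1, T/2)%R : C))
    as [bu [ru [Pbu [Pru Hu]]]]; [auto|simpl; lra|simpl; lra|].
  destruct (inner_existence c1 ((- (-1), 0)%R : C) ((- (-1), - (T/2))%R : C) ((- (-1), T/2)%R : C))
    as [bs [rs [Pbs [Prs Hs]]]]; [auto|simpl; lra|simpl; lra|].
  set (b := (bu + bs)%R).
  destruct (Rh_estimates b 8 4) as [K0 [rd [HK0 [Prd HR]]]]; try lia; [unfold b; lra|].
  set (K := (K0 + 1)%R). set (K3 := (6 * K * K + 2 * K)%R).
  set (rho := (ru + rs + rd)%R).
  (* The summands ensure, in order, [|U| >= rho^3] on the outer domains, [3 K <= depth^(1/6)],
     [9 K <= k^(2/3)] and [4 K3 <= k]. *)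
  set (k := ((1 + T) * (rho * rho * rho) + (3 * K) ^ 6 + (9 * K) * (9 * K) + 4 * K3)%R).
  assert (HK : (1 <= K)%R) by (unfold K; lra).
  assert (HK3 : (8 <= K3)%R) by (unfold K3; nra).
  assert (P6 : (0 < (3 * K) ^ 6)%R) by (apply pow_lt; lra).
  assert (Prho : (1 <= rho)%R) by (unfold rho; lra).
  assert (rho3 : (1 <= rho * rho * rho)%R).
  { assert (1 <= rho * rho)%R by nra. nra. }
  assert (Q1 : (0 < (1 + T) * (rho * rho * rho))%R) by nra.
  assert (Q2 : (81 <= (9 * K) * (9 * K))%R) by nra.
  assert (Hk : (0 < k)%R) by (unfold k; lra).
  assert (Hm : ((3 * K) ^ 6 <= k /\ 9 * K <= Rpower k (2/3) /\ 4 * K3 <= k)%R).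
  { split; [unfold k; lra|]. split; [|unfold k; lra].
    apply Rle_trans with (Rpower ((9 * K) * (9 * K)) (2/3)).
    - rewrite <- (Rpower_1 (9 * K)) at 1 by lra.
      rewrite <- (Rpower_mult_distr (9 * K) (9 * K)), <- Rpower_plus by lra. apply Rpower_1_anti; lra.
    - apply Rle_Rpower_l; [lra|]. unfold k. lra. }
  set (Ou := outer 1 T k). set (Os := outer (-1) T k).
  assert (Osize : forall sg U, (sg = 1 \/ sg = -1)%R -> outer sg T k U -> (rho <= rad U /\ 1 <= Cmod U)%R).
  { intros sg U Hsg HU. assert (L := outer_Cmod sg T k Hsg HT U HU).
    assert (A : (rho * rho * rho <= Cmod U)%R).
    { eapply Rle_trans; [|exact L]. apply Rmult_le_reg_r with (1 + T)%R; [lra|].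
      replace (k / (1 + T) * (1 + T))%R with k by (field; lra). unfold k. lra. }
    split; [now apply rad_ge|lra]. }
  assert (Gu : forall U, Ou U -> polar arg_u U /\ ccont (fun w => RtoC (arg_u w)) U).
  { intros U HU. apply arg_u_good. unfold Ou, outer in HU.
    destruct (Req_dec (Im U) 0) as [E|N]; auto. right. rewrite E, Rabs_R0 in HU. nra. }
  assert (Gs : forall U, Os U -> polar arg_s U /\ ccont (fun w => RtoC (arg_s w)) U).
  { intros U HU. apply arg_s_good. unfold Os, outer in HU.
    destruct (Req_dec (Im U) 0) as [E|N]; auto. right. rewrite E, Rabs_R0 in HU. nra. }
  assert (S1 : (1 = 1 \/ 1 = -1)%R) by auto. assert (S2 : (-1 = 1 \/ -1 = -1)%R) by auto.
  assert (A0 : (Rabs 0 <= T / 2)%R) by (rewrite Rabs_R0; lra).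
  assert (A1 : (Rabs (T/2) <= T / 2)%R) by (rewrite Rabs_pos_eq; lra).
  assert (A2 : (Rabs (- (T/2)) <= T / 2)%R) by now rewrite Rabs_Ropp.
  destruct (Hu arg_u Ou) as [Zu [Su Bu]].
  { split; [now apply outer_open|].
    split; [apply (outer_ray 1 T k S1 HT (Rlt_le _ _ Hk) 0 A0)|].
    split; [apply (outer_ray 1 T k S1 HT (Rlt_le _ _ Hk) _ A2)|].
    split; [apply (outer_ray 1 T k S1 HT (Rlt_le _ _ Hk) _ A1)|].
    intros U HU. destruct (Osize 1%R U S1 HU). destruct (Gu U HU). unfold rho in *.
    repeat split; auto; lra. }
  destruct (Hs arg_s Os) as [Zs [Ss Bs]].
  { split; [now apply outer_open|].
    split; [apply (outer_ray (-1) T k S2 HT (Rlt_le _ _ Hk) 0 A0)|].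
    split; [apply (outer_ray (-1) T k S2 HT (Rlt_le _ _ Hk) _ A2)|].
    split; [apply (outer_ray (-1) T k S2 HT (Rlt_le _ _ Hk) _ A1)|].
    intros U HU. destruct (Osize (-1)%R U S2 HU). destruct (Gs U HU). unfold rho in *.
    repeat split; auto; lra. }
  assert (wide : forall b' r z, (0 < b' <= b)%R -> in_ball b' 8 4 r z -> in_ball b 8 4 r z).
  { intros b' r z Hb' [I1 [I2 I3]]. generalize (wt_pos 8 r) (wt_pos 4 r). intros.
    split; [|split]; (eapply Rle_trans; [eassumption|]); apply Rmult_le_compat_r; lra. }
  assert (Bu' : forall U, Ou U -> in_ball b 8 4 (rad U) (Zu U)).
  { intros U HU. apply (wide bu); [unfold b; lra|auto]. }
  assert (Bs' : forall U, Os U -> in_ball b 8 4 (rad U) (Zs U)).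
  { intros U HU. apply (wide bs); [unfold b; lra|auto]. }
  clear Bu Bs Hu Hs wide.
  assert (HRr : forall argf U z, (rho <= rad U)%R -> in_ball b 8 4 (rad U) z ->
    regular (cbrt argf U) z /\
    forall z', in_ball b 8 4 (rad U) z' ->
      (Cmod (Rh1 (cbrt argf U) z - Rh1 (cbrt argf U) z') <= K0 * (wt 9 (rad U) * dW z z' + wt 7 (rad U) * dXY z z'))%R /\
      (Cmod (Rh2 (cbrt argf U) z - Rh2 (cbrt argf U) z') <= K0 * (wt 2 (rad U) * dW z z' + wt 6 (rad U) * dXY z z'))%R /\
      (Cmod (Rh3 (cbrt argf U) z - Rh3 (cbrt argf U) z') <= K0 * (wt 2 (rad U) * dW z z' + wt 6 (rad U) * dXY z z'))%R).
  { intros argf U z Hr Hz. assert (E := HR (cbrt argf U)). rewrite Cmod_cbrt in E.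
    destruct (E ltac:(unfold rho in Hr; lra) z Hz) as [E1 [_ [_ [_ E2]]]]. split; auto. }
  assert (Esub : forall U, sector T k U -> Ou U /\ Os U /\ (Im U < 0)%R /\ (k <= depth U)%R).
  { intros U HU. unfold sector in HU. unfold Ou, Os, outer, depth.
    assert (P := Rabs_pos (Re U)). assert (TP : (0 <= T * Rabs (Re U))%R) by nra.
    assert (I : (Im U < 0)%R) by lra. rewrite (Rabs_left (Im U)) by lra.
    assert (L1 := Rle_abs (Re U)). assert (L2 := Rle_abs (- Re U)). rewrite Rabs_Ropp in L2.
    repeat split; auto; nra. }
  (* Below the real axis both solutions satisfy the same equation with the same [s], so the
     Lipschitz bounds apply to the difference of their sources. *)
  assert (cb : forall U, (Im U < 0)%R -> cbrt arg_u U = cbrt arg_s U).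
  { intros U HU. unfold cbrt, cpow. now rewrite arg_agree. }
  assert (Lip : forall U (p q : Z) y, sector T k U -> (0 <= p)%Z -> (0 <= q)%Z ->
    (y <= K0 * (wt p (rad U) * dW (Zu U) (Zs U) + wt q (rad U) * dXY (Zu U) (Zs U)))%R ->
    (y <= K * (Rpower (depth U) (- IZR p / 3) * Cmod (Wc (Zu U) - Wc (Zs U)) +
      Rpower (depth U) (- IZR q / 3) * (Cmod (Xc (Zu U) - Xc (Zs U)) + Cmod (Yc (Zu U) - Yc (Zs U)))))%R).
  { intros U p q y HU Hp Hq Hy. destruct (Esub U HU) as [_ [_ [_ Hd]]].
    assert (L1 := wt_depth p U Hp ltac:(lra)). assert (L2 := wt_depth q U Hq ltac:(lra)).
    fold (dW (Zu U) (Zs U)). fold (dXY (Zu U) (Zs U)).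
    assert (D1 := dW_pos (Zu U) (Zs U)). assert (D2 := dXY_pos (Zu U) (Zs U)).
    assert (W1 := wt_pos p (rad U)). assert (W2 := wt_pos q (rad U)).
    eapply Rle_trans; [exact Hy|]. apply Rmult_le_compat; try (unfold K; lra).
    - apply Rplus_le_le_0_compat; apply Rmult_le_pos; lra.
    - apply Rplus_le_compat; apply Rmult_le_compat_r; lra. }
  assert (Size : forall U (n : Z) u v, sector T k U -> (0 <= n)%Z -> (Cmod u <= b * wt n (rad U))%R ->
    (Cmod v <= b * wt n (rad U))%R -> (Cmod (u - v) <= 2 * b * Rpower (depth U) (- IZR n / 3))%R).
  { intros U n u v HU Hn H1 H2. destruct (Esub U HU) as [_ [_ [_ Hd]]].
    assert (L1 := wt_depth n U Hn ltac:(lra)). eapply Rle_trans; [apply Cmod_minus_le; eauto|].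
    assert (b0 : (0 < b)%R) by (unfold b; lra). nra. }
  destruct (sector_asymptotics T k K (2 * b)
    (fun U => Wc (Zu U) - Wc (Zs U)) (fun U => Xc (Zu U) - Xc (Zs U)) (fun U => Yc (Zu U) - Yc (Zs U))
    (fun U => Rh1 (cbrt arg_u U) (Zu U) - Rh1 (cbrt arg_s U) (Zs U))
    (fun U => Rh2 (cbrt arg_u U) (Zu U) - Rh2 (cbrt arg_s U) (Zs U))
    (fun U => Rh3 (cbrt arg_u U) (Zu U) - Rh3 (cbrt arg_s U) (Zs U)))
    as [Th HTh]; [exact HT|exact HK| | | | | | | | |exact Hm|].
  { intros U HU. destruct (Esub U HU) as [E1 [E2 _]]. apply cder_minus; [apply (Su U E1)|apply (Ss U E2)]. }
  { intros U HU. destruct (Esub U HU) as [E1 [E2 _]].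
    eapply cder_eq; [apply cder_minus; [apply (Su U E1)|apply (Ss U E2)]|]. cbv beta. ring. }
  { intros U HU. destruct (Esub U HU) as [E1 [E2 _]].
    eapply cder_eq; [apply cder_minus; [apply (Su U E1)|apply (Ss U E2)]|]. cbv beta. ring. }
  { intros U HU. destruct (Esub U HU) as [E1 [E2 [E3 _]]]. rewrite (cb U E3).
    apply (Lip U 9%Z 7%Z _ HU); try lia.
    apply (proj2 (HRr arg_s U (Zu U) (proj1 (Osize _ U S1 E1)) (Bu' U E1)) (Zs U) (Bs' U E2)). }
  { intros U HU. destruct (Esub U HU) as [E1 [E2 [E3 _]]]. rewrite (cb U E3).
    apply (Lip U 2%Z 6%Z _ HU); try lia.
    apply (proj2 (HRr arg_s U (Zu U) (proj1 (Osize _ U S1 E1)) (Bu' U E1)) (Zs U) (Bs' U E2)). }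
  { intros U HU. destruct (Esub U HU) as [E1 [E2 [E3 _]]]. rewrite (cb U E3).
    apply (Lip U 2%Z 6%Z _ HU); try lia.
    apply (proj2 (HRr arg_s U (Zu U) (proj1 (Osize _ U S1 E1)) (Bu' U E1)) (Zs U) (Bs' U E2)). }
  { intros U HU. destruct (Esub U HU) as [E1 [E2 _]].
    apply (Size U 8%Z _ _ HU); [lia|apply (Bu' U E1)|apply (Bs' U E2)]. }
  { intros U HU. destruct (Esub U HU) as [E1 [E2 _]].
    apply (Size U 4%Z _ _ HU); [lia|apply (Bu' U E1)|apply (Bs' U E2)]. }
  set (c := (1 + / T)%R).
  assert (Pc : forall p, (0 < Rpower c p)%R) by (intros; apply Rpower_pos).
  set (b2 := (12 * K * Rpower c (7/3) + 4 * K3 * Rpower c 2 + 4 * K3 * Rpower c 1)%R).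
  assert (N1 : (0 < 12 * K * Rpower c (7/3))%R) by (apply Rmult_lt_0_compat; [lra|apply Pc]).
  assert (N2 : (0 < 4 * K3 * Rpower c 2)%R) by (apply Rmult_lt_0_compat; [lra|apply Pc]).
  assert (N3 : (0 < 4 * K3 * Rpower c 1)%R) by (apply Rmult_lt_0_compat; [lra|apply Pc]).
  (* The margin 1 puts the closed domains strictly inside the open ones. [Zu], [Zs] and [Th] are
     already fixed when [kappa] is introduced. *)
  exists (k + 1)%R, b. split; [lra|]. split; [unfold b; lra|].
  exists Th, b2. split; [unfold b2; lra|]. intros kappa Hkappa.
  (* For nonzero [Th] the decomposition of the difference forces this formula; for [Th = 0] any
     [chi] fits, and zero meets the bounds. *)
  set (chi := fun U => if excluded_middle_informative (Th = 0) then mk3 0 0 0 else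
    mk3 (cexp (Ci * U) * (Wc (Zu U) - Wc (Zs U)) / Th) (cexp (Ci * U) * (Xc (Zu U) - Xc (Zs U)) / Th)
        (cexp (Ci * U) * (Yc (Zu U) - Yc (Zs U)) / Th - 1)).
  assert (Dou : forall U, Du beta0 kappa U -> Ou U).
  { intros U HU. unfold Du in HU. fold T in HU. unfold Ou, outer. lra. }
  assert (Dos : forall U, Ds beta0 kappa U -> Os U).
  { intros U HU. unfold Ds, Du in HU. fold T in HU.
    change (Im (- U)) with (- Im U)%R in HU. change (Re (- U)) with (- Re U)%R in HU.
    rewrite Rabs_Ropp in HU. unfold Os, outer. lra. }
  assert (Eks : forall U, Ek beta0 kappa U -> sector T k U).
  { intros U [H1 [H2 H3]]. apply Dou in H1. apply Dos in H2. unfold Ou, Os, outer in H1, H2.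
    rewrite (Rabs_left (Im U)) in H1, H2 by auto. unfold sector.
    destruct (Rle_or_lt 0 (Re U)) as [L|L]; [rewrite Rabs_pos_eq by auto|rewrite Rabs_left by auto]; lra. }
  assert (ecancel : forall U, cexp (- Ci * U) * cexp (Ci * U) = 1).
  { intros U. rewrite <- cexp_plus. replace (- Ci * U + Ci * U) with (RtoC 0) by ring. apply cexp_0. }
  exists Zu, Zs, chi. split; [|split; [|split; [|split; [|split]]]].
  - apply (inner_solution_inv arg_u Ou); auto; [now apply outer_open|].
    intros U HU. destruct (Osize _ U S1 HU) as [Z1 Z2]. destruct (Gu U HU) as [G1 G2].
    split; [apply Cmod_gt_0; lra|]. split; [auto|]. split; [auto|].
    apply (HRr arg_u U (Zu U) Z1 (Bu' U HU)).
  - apply (inner_solution_inv arg_s Os); auto; [now apply outer_open|].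
    intros U HU. destruct (Osize _ U S2 HU) as [Z1 Z2]. destruct (Gs U HU) as [G1 G2].
    split; [apply Cmod_gt_0; lra|]. split; [auto|]. split; [auto|].
    apply (HRr arg_s U (Zs U) Z1 (Bs' U HU)).
  - intros U HU. apply Dou in HU. destruct (Bu' U HU) as [I1 [I2 I3]].
    assert (PU : (0 < Cmod U)%R) by (generalize (Osize _ U S1 HU); lra).
    split; [|split]; eapply weighted_bound; eauto; lra.
  - intros U HU. apply Dos in HU. destruct (Bs' U HU) as [I1 [I2 I3]].
    assert (PU : (0 < Cmod U)%R) by (generalize (Osize _ U S2 HU); lra).
    split; [|split]; eapply weighted_bound; eauto; lra.
  - intros U HU. apply Eks in HU. destruct (HTh U HU) as [T1 [T2 T3]]. unfold chi.
    assert (ec := ecancel U).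
    (* All three asymptotic bounds carry the factor [|Th|], so [Th = 0] makes the difference vanish
       identically. *)
    destruct (excluded_middle_informative (Th = 0)) as [E|N].
    + rewrite E, Cmod_0 in *. rewrite !Rmult_0_r, !Rmult_0_l in *.
      assert (Z : forall g, (Cmod (cexp (Ci * U) * g) <= 0)%R -> g = 0).
      { intros g Hg. assert (G0 : cexp (Ci * U) * g = 0).
        { apply Cmod_eq_0. generalize (Cmod_ge_0 (cexp (Ci * U) * g)). lra. }
        replace g with (cexp (- Ci * U) * cexp (Ci * U) * g) by (rewrite ec; ring).
        rewrite <- Cmult_assoc, G0. ring. }
      unfold sub3, scal3, add3. rewrite (Z _ T1), (Z _ T2).
      rewrite (Z (Yc (Zu U) - Yc (Zs U))).
      * unfold mk3, Wc, Xc, Yc; cbn [fst snd]. f_equal; [f_equal|]; ring.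
      * eapply Rle_trans; [|exact T3]. right. f_equal. ring.
    + unfold sub3, scal3, add3, mk3, Wc, Xc, Yc; cbn [fst snd].
      assert (R : forall g, g = Th * cexp (- Ci * U) * (cexp (Ci * U) * g / Th)).
      { intros g. transitivity (cexp (- Ci * U) * cexp (Ci * U) * g); [rewrite ec; ring|]. field. auto. }
      f_equal; [f_equal|].
      * rewrite Cplus_0_l. apply R.
      * rewrite Cplus_0_l. apply R.
      * etransitivity; [apply R|]. f_equal. ring.
  - intros U HU. apply Eks in HU. destruct (HTh U HU) as [T1 [T2 T3]]. unfold chi.
    destruct (excluded_middle_informative (Th = 0)) as [E|N].
    + unfold mk3, Wc, Xc, Yc; cbn [fst snd]. rewrite !Cmult_0_r, Cmod_0. unfold b2. lra.
    + unfold mk3 at 1 2 3. unfold Wc at 1, Xc at 1, Yc at 1; cbn [fst snd].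
      assert (PT : (0 < Cmod Th)%R) by now apply Cmod_gt_0.
      assert (PU : (0 < Cmod U)%R).
      { destruct (Esub U HU) as [E1 _]. generalize (Osize _ U S1 E1). lra. }
      assert (Dv : forall g a p, (Cmod g <= a * Cmod Th * p)%R -> (Cmod (g / Th) <= a * p)%R).
      { intros g a p Hg. rewrite Cmod_div by auto. apply Rmult_le_reg_r with (Cmod Th); auto.
        unfold Rdiv. rewrite Rmult_assoc, Rinv_l by lra. lra. }
      assert (U1 : Rpower (Cmod U) 1 = Cmod U) by now apply Rpower_1.
      assert (U2 : Rpower (Cmod U) 2 = (Cmod U * Cmod U)%R).
      { replace 2%R with (1 + 1)%R by ring. now rewrite Rpower_plus, U1. }
      split; [|split].
      * rewrite Cmod_mult, Cmod_cpow. eapply Rle_trans.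
        -- apply (tw_Cmod T k (12 * K)); auto; try lra.
           replace (- (7/3))%R with (-7/3)%R by field. now apply Dv.
        -- fold c. unfold b2. lra.
      * rewrite !Cmod_mult, <- U2. eapply Rle_trans.
        -- apply (tw_Cmod T k (4 * K3)); auto; try lra.
           replace (- (2))%R with (-6/3)%R by field. now apply Dv.
        -- fold c. unfold b2. lra.
      * rewrite Cmod_mult, <- U1. eapply Rle_trans.
        -- apply (tw_Cmod T k (4 * K3)); auto; try lra.
           replace (- (1))%R with (-3/3)%R by field.
           replace (cexp (Ci * U) * (Yc (Zu U) - Yc (Zs U)) / Th - 1) with
             ((cexp (Ci * U) * (Yc (Zu U) - Yc (Zs U)) - Th) / Th) by (field; auto).
           now apply Dv.
        -- fold c. unfold b2. lra.
Qed.
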